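(* Let $g(\cdot,t)=u(\cdot,t)\,g_{S^2}$ be an ancient compact solution to the Ricci flow $\frac{\partial g_{ij}}{\partial t}=-2R_{ij}$, $t\in(-\infty,0)$. Then $u$ is either one of the contracting spheres or one of the King–Rosenau solutions.
   Context: An ancient compact solution here means a solution of the two-dimensional Ricci flow $\frac{\partial g_{ij}}{\partial t}=-2R_{ij}$ on a compact surface which exists for all $t\in(-\infty,0)$ and becomes extinct (singular) at time $T=0$. Such a solution has positive scalar curvature $R$ and becomes spherical at time $T=0$: after a normalization, the normalized flow converges to a spherical metric, called the limiting sphere. Since the flow preserves the conformal class, it is parametrized by the limiting sphere, that is, written as $g(\cdot,t)=u(\cdot,t)\,g_{S^2}$ with $u>0$, where $g_{S^2}=d\psi^2+\cos^2\psi\,d\theta^2$ is the spherical metric and $\psi,\theta$ are global coordinates on $S^2$. The Ricci flow is then equivalent to $u_t=\Delta_{S^2}\log u-2$ on $S^2\times(-\infty,0)$, where $\Delta_{S^2}$ is the Laplacian of $g_{S^2}$. The pressure function is $v=u^{-1}$. The contracting spheres are described by the pressure $v_S(\psi,t)=\frac{1}{2(-t)}$. The King–Rosenau solutions are described by a pressure of the form $v_K(\psi,t)=a(t)-b(t)\sin^2\psi$, where $a(t)=-\mu\coth(2\mu t)$ and $b(t)=-\mu\tanh(2\mu t)$ for some constant $\mu>0$. *)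

(* Defs.v *)
From mathcomp Require Import all_boot all_order all_algebra.
From mathcomp Require Import all_classical all_reals all_analysis.

Set Implicit Arguments.
Unset Strict Implicit.
Unset Printing Implicit Defensive.

Import Order.TTheory GRing.Theory Num.Theory.
Import numFieldNormedType.Exports.

Local Open Scope classical_set_scope.
Local Open Scope ring_scope.

(* For U open and V finite-dimensional this is C^infinity on U: every iterated
   directional derivative exists and is continuous at every point of U. *)
Definition smooth_on (R : realType) (V : normedModType R) (U : set V)
    (f : V -> R) : Prop :=
  forall (vs : seq V) (x : V), U x ->
    let df := foldr (fun v h => 'D_v h) f vs in
    {for x, continuous df} /\ forall v, derivable df x v.

Definition pderiv (R : realType) (n : nat) (i : 'I_n) (f : 'rV[R]_n -> R) :
    'rV[R]_n -> R :=
  'D_(delta_mx 0 i) f.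

(* Gamma^k_ij of a metric g given by its matrix in local coordinates. *)
Definition christoffel (R : realType) (n : nat) (g : 'rV[R]_n -> 'M[R]_n)
    (k i j : 'I_n) (x : 'rV[R]_n) : R :=
  2^-1 * \sum_l invmx (g x) k l *
    (pderiv i (fun y => g y j l) x + pderiv j (fun y => g y i l) x
     - pderiv l (fun y => g y i j) x).

(* Sign convention: the Ricci tensor of a round sphere is positive. *)
Definition ricci (R : realType) (n : nat) (g : 'rV[R]_n -> 'M[R]_n)
    (i j : 'I_n) (x : 'rV[R]_n) : R :=
  \sum_k (pderiv k (christoffel g k i j) x - pderiv j (christoffel g k i k) x
    + \sum_l (christoffel g k k l x * christoffel g l i j x
              - christoffel g k j l x * christoffel g l i k x)).

Definition sphere (R : realType) : set 'rV[R]_3 :=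
  [set p | \sum_i p 0 i ^+ 2 = 1].

(* Inverse stereographic projection from the pole (0, 0, 1) (b = false) or
   (0, 0, -1) (b = true); together the two parametrizations cover the sphere. *)
Definition stereo (R : realType) (b : bool) (x : 'rV[R]_2) : 'rV[R]_3 :=
  let r2 := x 0 0 ^+ 2 + x 0 1 ^+ 2 in
  (1 + r2)^-1 *:
    \row_(i < 3) [:: 2 * x 0 0; 2 * x 0 1; (-1) ^+ b * (r2 - 1)]`_i.

(* Point of latitude psi and longitude theta: here the metric induced from R^3
   is d psi^2 + cos^2 psi d theta^2. *)
Definition sphere_coord (R : realType) (psi theta : R) : 'rV[R]_3 :=
  \row_(i < 3) [:: cos psi * cos theta; cos psi * sin theta; sin psi]`_i.

(* Matrix of the metric induced from the Euclidean metric of R^m by the local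
   parametrization s. *)
Definition induced_metric (R : realType) (n m : nat)
    (s : 'rV[R]_n -> 'rV[R]_m) (x : 'rV[R]_n) : 'M[R]_n :=
  \matrix_(i, j) \sum_k
    pderiv i (fun y => s y 0 k) x * pderiv j (fun y => s y 0 k) x.

(* In what follows u p t is the conformal factor at the point p of the sphere
   and time t; only its values for p on the sphere and t < 0 matter. *)

(* Matrix of g(t) = u(., t) g_{S^2} in the stereographic coordinates. *)
Definition conformal_metric (R : realType) (u : 'rV[R]_3 -> R -> R) (b : bool)
    (t : R) (x : 'rV[R]_2) : 'M[R]_2 :=
  u (stereo b x) t *: induced_metric (stereo b) x.

Definition smooth_conformal_factor (R : realType) (u : 'rV[R]_3 -> R -> R) :
    Prop :=
  (forall p t, sphere p -> t < 0 -> 0 < u p t) /\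
  (forall b, smooth_on [set z : 'rV[R]_2 * R | z.2 < 0]
               (fun z : 'rV[R]_2 * R => u (stereo b z.1) z.2)).

Definition ricci_flow (R : realType) (u : 'rV[R]_3 -> R -> R) : Prop :=
  forall (b : bool) (t : R) (x : 'rV[R]_2) (i j : 'I_2), t < 0 ->
    is_derive t 1 (fun s : R => conformal_metric u b s x i j)
      (- 2 * ricci (conformal_metric u b t) i j x).

Definition extinct_at_0 (R : realType) (u : 'rV[R]_3 -> R -> R) : Prop :=
  {uniform @sphere R, (fun t p => u p t) @ 0^'- --> (fun=> 0 : R)}.

(* A solution extinct at time 0 has area 8 pi (- t) by Gauss-Bonnet, so
   (2 (- t))^-1 g(t) is the normalized flow, of constant area 4 pi. The metric
   g_{S^2} is the limiting sphere when the normalized flow converges to it;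
   this fixes the conformal parametrization up to isometries of g_{S^2}. *)
Definition limiting_sphere (R : realType) (u : 'rV[R]_3 -> R -> R) : Prop :=
  {uniform @sphere R,
    (fun t p => u p t / (2 * (- t))) @ 0^'- --> (fun=> 1 : R)}.

Definition ancient_compact_solution (R : realType)
    (u : 'rV[R]_3 -> R -> R) : Prop :=
  [/\ smooth_conformal_factor u, ricci_flow u, extinct_at_0 u
    & limiting_sphere u].

Definition pressure (R : realType) (u : 'rV[R]_3 -> R -> R) (p : 'rV[R]_3)
    (t : R) : R :=
  (u p t)^-1.

Definition tanh (R : realType) (x : R) : R :=
  (expR x - expR (- x)) / (expR x + expR (- x)).

Definition coth (R : realType) (x : R) : R :=
  (expR x + expR (- x)) / (expR x - expR (- x)).

Definition contracting_sphere (R : realType) (u : 'rV[R]_3 -> R -> R) : Prop :=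
  forall psi theta t : R, t < 0 ->
    pressure u (sphere_coord psi theta) t = (2 * (- t))^-1.

(* The limiting sphere determines the coordinates psi, theta only up to a
   rotation Q, whence the choice of the axis of symmetry. *)
Definition king_rosenau (R : realType) (u : 'rV[R]_3 -> R -> R) : Prop :=
  exists (mu : R) (Q : 'M[R]_3),
    [/\ 0 < mu, Q *m Q^T = 1%:M, \det Q = 1 &
      forall psi theta t : R, t < 0 ->
        let a := - mu * coth (2 * mu * t) in
        let b := - mu * tanh (2 * mu * t) in
        pressure u (sphere_coord psi theta *m Q) t = a - b * sin psi ^+ 2].

(* Main.v *)
(* Only the maximum principle is used. In a stereographic chart
   g(t) = |dx|^2 / p, so that the flow reads p_t = p (p_xx + p_yy) - |Dp|^2. Let
   v = 1/u be the pressure and R the scalar curvature, and write grad, lap for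
   the metric g(t).

   Since the solution is ancient, R > 0 and Hamilton's Harnack inequality reads
   lap (log R) + R >= 0. It makes R + |grad log v|^2 nondecreasing in time, as is v,
   so v, R and |grad log v| are bounded as t -> -oo. With z = x + iy and f = log p,
   let E = 64 p^2 |f_zz + f_z^2 / 2|^2 and Q = 64 p |p_zzz|^2, which are functions
   on the sphere. Then E_t <= lap E - 4 Q and Q_t <= lap Q, so the maximum of
   4 (t - s) Q + E does not increase after time s. A similar argument bounds E
   backward in time, and letting s -> -oo gives Q = 0.

   Now p_zzz = 0 means that v is the restriction to the sphere of
   n |-> tr A - <A n, n> + 2 <b, n> with A(t) symmetric, and the flow becomes
   A' = 4 (adj A - b b^T), b' = 4 A b. The ratio of |b|^2 to tr A^2 + |b|^2 + const
   is nondecreasing near t = 0 and tends to 0 because the limiting shape is the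
   round sphere: hence b = 0. Then A^2 is constant modulo scalar matrices, so A is
   diagonal in a fixed orthonormal frame with eigenvalues d_i' = 4 d_j d_k.
   Boundedness backward in time forces the two smallest eigenvalues to agree, and
   the remaining system for two functions is solved explicitly. *)

From HB Require Import structures.
Require Import Defs.
From mathcomp Require Import all_boot all_order all_algebra.
From mathcomp Require Import ring lra.
From mathcomp Require Import polyrcf.
From mathcomp Require Import all_classical all_reals all_analysis.

Set Implicit Arguments.
Unset Strict Implicit.
Unset Printing Implicit Defensive.

Import Order.TTheory GRing.Theory Num.Theory.
Import numFieldNormedType.Exports.

Local Open Scope classical_set_scope.
Local Open Scope ring_scope.

(** * Smooth functions on the past *)

(** No backward limit of the flow is ever extracted: bounds that are uniform in the past replace it.
    The King-Rosenau pressures are quadratic functions on the sphere, and [p_zzz = 0] is the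
    equation of such functions, so a nonnegative quantity measuring [p_zzz] must be shown to vanish.
    It comes from [E]: the coefficient [q = f_zz + f_z^2 / 2] satisfies [(p^2 q)_z = p p_zzz], hence
    [Q] is part of the squared covariant derivative of [q dz^2] and enters the evolution of [E] with
    a good sign.

    Two obstacles shape the argument. The maximum principle needs functions on the sphere, while [p]
    and its derivatives depend on the chart; beyond the Laplacian and products of gradients no
    transformation law is computed, and each quantity is instead exhibited as built from known ones
    by these operators and by time derivatives. Moreover the Harnack quantity contains the logarithm
    of the curvature, for which the maximum principle on an ancient solution only yields
    nonnegativity; strict positivity is obtained from an explicit barrier. *)

Inductive dir := DX | DY | DT.

Section Smooth.
Context {R : realType}.
Local Notation V := ('rV[R]_2 * R)%type.
Implicit Types (f g : V -> R) (z : V) (i j : dir).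

Definition dvec i : V :=
  match i with
  | DX => (delta_mx 0 0, 0) | DY => (delta_mx 0 1, 0) | DT => (0, 1)
  end.

(** The cut-off at [t >= 0] keeps derivatives among the vanishing functions, so that differential
    identities can be stated as equalities of functions. *)
Definition pd i f : V -> R := fun z => if z.2 < 0 then 'D_(dvec i) f z else 0.

(** Weaker than its name suggests: continuity of the partial derivatives is only supplied by the
    next order of [Sm]. *)
Definition C1 f : Prop :=
  forall z, z.2 < 0 -> {for z, continuous f} /\ forall i, derivable f z (dvec i).

Fixpoint Sm n f : Prop :=
  C1 f /\ (if n is m.+1 then forall i, Sm m (pd i f) else True).

Definition vanishing f : Prop := forall z, 0 <= z.2 -> f z = 0.

Lemma near_past z : z.2 < 0 -> \near z, z.2 < 0.
Proof.
move=> z0; exists (setT, [set t | t < 0]); last by move=> [x t] [].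
by split; [exact: filterT | exact: lt_nbhsl].
Qed.

Lemma pdE i f z : z.2 < 0 -> pd i f z = 'D_(dvec i) f z.
Proof. by rewrite /pd => ->. Qed.

Lemma pd_vanishing i f : vanishing (pd i f).
Proof. by move=> z z0; rewrite /pd ltNge z0. Qed.

Lemma SmS n f : Sm n.+1 f -> Sm n f.
Proof. by elim: n f => [|n IH] f [Cf Df]; split=> // i; exact: IH. Qed.

Lemma funext_past (f g : V -> R) : vanishing f -> vanishing g ->
  (forall z, z.2 < 0 -> f z = g z) -> f = g.
Proof.
by move=> vf vg fg; apply/funext => z; case: (ltP z.2 0) => z0;
  [exact: fg | rewrite vf ?vg].
Qed.

Lemma C1_near f g : (forall z, z.2 < 0 -> f z = g z) -> C1 f -> C1 g.
Proof.
move=> fg Cf z z0; have [cf df] := Cf z z0.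
have nfg : \near z, f z = g z by near=> y; apply: fg; near: y; exact: near_past.
split=> [|i]; last exact: near_eq_derivable (df i).
rewrite /prop_for /continuous_at -(fg _ z0).
by apply: cvg_trans cf; exact: near_eq_cvg.
Unshelve. all: by end_near. Qed.

Lemma pd_near i f g : (forall z, z.2 < 0 -> f z = g z) -> pd i f = pd i g.
Proof.
move=> fg; apply: funext_past; [exact: pd_vanishing..|] => z z0.
rewrite !pdE //; apply: near_eq_derive.
by near=> y; apply: fg; near: y; exact: near_past.
Unshelve. all: by end_near. Qed.

Lemma Sm_near n f g : (forall z, z.2 < 0 -> f z = g z) -> Sm n f -> Sm n g.
Proof.
move=> fg; case: n => [|n] /= [Cf Df]; (split; first exact: C1_near Cf) => // i.
by rewrite -(pd_near i fg).
Qed.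

Lemma C1D f g : C1 f -> C1 g -> C1 (f + g).
Proof.
move=> Cf Cg z z0; have [cf df] := Cf z z0; have [cg dg] := Cg z z0.
split=> [|i]; [exact: cvgD | exact: derivableD].
Qed.

Lemma C1N f : C1 f -> C1 (- f).
Proof.
move=> Cf z z0; have [cf df] := Cf z z0.
split=> [|i]; [exact: cvgN | exact: derivableN].
Qed.

Lemma C1M f g : C1 f -> C1 g -> C1 (f * g).
Proof.
move=> Cf Cg z z0; have [cf df] := Cf z z0; have [cg dg] := Cg z z0.
split=> [|i]; [exact: cvgM | exact: derivableM].
Qed.

Lemma pdD i f g : C1 f -> C1 g -> pd i (f + g) = pd i f + pd i g.
Proof.
move=> Cf Cg; apply: funext_past => [|z z0|z z0]; first exact: pd_vanishing.
  by rewrite fctE !pd_vanishing ?addr0.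
have [cf df] := Cf z z0; have [cg dg] := Cg z z0.
by rewrite -[RHS]/(pd i f z + pd i g z) !pdE// deriveD.
Qed.

Lemma pdN i f : C1 f -> pd i (- f) = - pd i f.
Proof.
move=> Cf; apply: funext_past => [|z z0|z z0]; first exact: pd_vanishing.
  by rewrite fctE !pd_vanishing ?oppr0.
by have [cf df] := Cf z z0; rewrite -[RHS]/(- pd i f z) !pdE// deriveN.
Qed.

Lemma pdM i f g : C1 f -> C1 g -> pd i (f * g) = pd i f * g + f * pd i g.
Proof.
move=> Cf Cg; apply: funext_past => [|z z0|z z0]; first exact: pd_vanishing.
  by rewrite -[LHS]/(pd i f z * g z + f z * pd i g z) !pd_vanishing// mulr0 mul0r addr0.
have [cf df] := Cf z z0; have [cg dg] := Cg z z0.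
rewrite -[RHS]/(pd i f z * g z + f z * pd i g z) !pdE// deriveM//.
by rewrite addrC; congr (_ + _); rewrite -[LHS]/(g z * _) mulrC.
Qed.

Lemma SmD n f g : Sm n f -> Sm n g -> Sm n (f + g).
Proof.
elim: n f g => [|n IH] f g; first by case=> Cf _ [Cg _]; split; [exact: C1D|].
case=> Cf Df [Cg Dg]; split; first exact: C1D.
by move=> i; rewrite pdD//; exact: IH (Df i) (Dg i).
Qed.

Lemma SmN n f : Sm n f -> Sm n (- f).
Proof.
elim: n f => [|n IH] f; first by case=> Cf _; split; [exact: C1N|].
case=> Cf Df; split; first exact: C1N.
by move=> i; rewrite pdN//; exact: IH (Df i).
Qed.

Lemma SmSP n f : Sm n.+1 f <-> C1 f /\ forall i, Sm n (pd i f).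
Proof. by []. Qed.

Lemma SmM n f g : Sm n f -> Sm n g -> Sm n (f * g).
Proof.
elim: n f g => [|n IH] f g; first by case=> Cf _ [Cg _]; split; [exact: C1M|].
move=> Sf Sg; have [/SmSP[Cf Df] /SmSP[Cg Dg]] := (Sf, Sg).
split; first exact: C1M.
have [Sf' Sg'] := (SmS Sf, SmS Sg).
by move=> i; rewrite pdM//; apply: SmD; apply: IH.
Qed.

Lemma C1_cst (c : R) : C1 (fun=> c).
Proof. by move=> z z0; split=> [|i]; [exact: cvg_cst|exact: derivable_cst]. Qed.

Lemma Sm_cst n (c : R) : Sm n (fun=> c).
Proof.
elim: n c => [|n IH] c; first by split; [exact: C1_cst|].
apply/SmSP; split=> [|i]; first exact: C1_cst.
suff -> : pd i (fun=> c) = (fun=> 0) by exact: IH.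
by apply: funext_past => // [|z z0]; [exact: pd_vanishing|rewrite pdE// derive_cst].
Qed.

Lemma Sm_affine n f (c : dir -> R) : (forall z, {for z, continuous f}) ->
  (forall z i (h : R), f (h *: dvec i + z) = h * c i + f z) -> Sm n f.
Proof.
move=> cf df.
have dd z i : is_derive z (dvec i) f (c i).
  have E : (fun h : R => h^-1 *: ((f \o shift z) (h *: dvec i) - f z)) @ 0^' --> c i.
    apply: cvg_near_cst; near=> h => /=.
    rewrite df addrK /GRing.scale /= mulKf//.
    by near: h; exact: nbhs_dnbhs_neq.
  by split; [apply/cvg_ex; exists (c i) | exact/cvg_lim].
have Cf : C1 f by move=> z z0; split.
case: n => [|n]; first by split.
apply/SmSP; split=> // i; apply: (@Sm_near _ (fun=> c i)); last exact: Sm_cst.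
by move=> z z0; rewrite pdE// derive_val.
Unshelve. all: by end_near. Qed.

Lemma derive_line f z v : 'D_v f z = (fun h : R => f (h *: v + z))^`()%classic 0.
Proof.
rewrite derive1E /derive; set g1 := fun h => h^-1 *: _; set g2 := fun h => h^-1 *: _.
suff -> : g1 = g2 by [].
by apply/funext => h; rewrite /g1 /g2 /= addr0 scale0r add0r [_%:A]mulr1.
Qed.

(** Since [f] is only known to be derivable in the direction [v], the chain rule is taken on the
    line through [z], where everything is a function of one real variable. *)
Lemma derive_comp1 (phi : R -> R) f z v : derivable f z v ->
  derivable phi (f z) 1 ->
  is_derive z v (phi \o f) (phi^`()%classic (f z) * 'D_v f z).
Proof.
move=> /derivable1P df dphi.
have dphi' : derivable phi ((fun h : R => f (h *: v + z)) 0) 1.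
  by rewrite /= scale0r add0r.
split; last first.
  rewrite !derive_line -[RHS]/(_ * _).
  rewrite -[X in X^`()%classic 0]/(phi \o (fun h : R => f (h *: v + z))).
  by rewrite (derive1_comp df dphi') scale0r add0r.
apply/derivable1P/derivable1_diffP.
rewrite -[X in differentiable X _]/(phi \o (fun h : R => f (h *: v + z))).
apply: differentiable_comp; first exact/derivable1_diffP.
exact/derivable1_diffP.
Qed.

Lemma C1_comp (phi : R -> R) f : C1 f ->
  (forall z, z.2 < 0 -> derivable phi (f z) 1) -> C1 (phi \o f).
Proof.
move=> Cf dphi z z0; have [cf df] := Cf z z0.
split=> [|i]; last by have [] := derive_comp1 (df i) (dphi z z0).
apply: continuous_comp => //.
exact/differentiable_continuous/derivable1_diffP/dphi.
Qed.

Lemma pd_comp i (phi : R -> R) f : C1 f ->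
  (forall z, z.2 < 0 -> derivable phi (f z) 1) ->
  pd i (phi \o f) = (phi^`()%classic \o f) * pd i f.
Proof.
move=> Cf dphi; apply: funext_past => [|z z0|z z0]; first exact: pd_vanishing.
  by rewrite -[LHS]/((phi^`()%classic (f z)) * pd i f z) pd_vanishing// mulr0.
have [cf df] := Cf z z0.
rewrite -[RHS]/((phi^`()%classic (f z)) * pd i f z) !pdE//.
by have [_ ->] := derive_comp1 (df i) (dphi z z0).
Qed.

Lemma Sm_inv n f : (forall z, z.2 < 0 -> f z != 0) -> Sm n f ->
  Sm n (GRing.inv \o f).
Proof.
move=> f0; have dV z : z.2 < 0 -> derivable (GRing.inv : R -> R) (f z) 1.
  by move=> z0; apply: derivableV => //; exact: f0.
elim: n => [|n IH]; first by move=> [Cf _]; split=> //; exact: C1_comp.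
move=> Sf; have /SmSP[Cf Df] := Sf.
apply/SmSP; split=> [|i]; first exact: C1_comp.
rewrite pd_comp//.
apply: (@Sm_near _ (- ((GRing.inv \o f) * (GRing.inv \o f)) * pd i f)).
  move=> z z0; rewrite -[RHS]/((GRing.inv^`()%classic (f z)) * pd i f z).
  rewrite -[LHS]/(- ((f z)^-1 * (f z)^-1) * pd i f z); congr (_ * _).
  rewrite derive1E deriveV//; last exact: f0.
  by rewrite derive_id -[RHS]/(- (f z) ^- 2 * 1) mulr1 expr2 invfM.
have IH' := IH (SmS Sf).
by apply: SmM => //; apply/SmN/SmM.
Qed.

Lemma Sm_ln n f : (forall z, z.2 < 0 -> 0 < f z) -> Sm n f -> Sm n (@ln R \o f).
Proof.
move=> f0; have dl z : z.2 < 0 -> is_derive (f z) 1 (@ln R) (f z)^-1.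
  by move=> z0; apply: is_derive1_ln; exact: f0.
have dV z : z.2 < 0 -> derivable (@ln R) (f z) 1 by move=> /dl[].
case: n => [|n]; first by move=> [Cf _]; split=> //; exact: C1_comp.
move=> Sf; have /SmSP[Cf Df] := Sf.
apply/SmSP; split=> [|i]; first exact: C1_comp.
rewrite pd_comp//.
apply: (@Sm_near _ ((GRing.inv \o f) * pd i f)).
  move=> z z0; rewrite -[RHS]/(((@ln R)^`()%classic (f z)) * pd i f z).
  rewrite -[LHS]/((f z)^-1 * pd i f z); congr (_ * _).
  by rewrite derive1E; have [_ ->] := dl z z0.
apply: SmM => //; apply: Sm_inv (SmS Sf) => z z0.
by rewrite gt_eqF// f0.
Qed.

Lemma Sm_exp n f : Sm n f -> Sm n (@expR R \o f).
Proof.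
have dV x : derivable (@expR R) x 1 by [].
elim: n => [|n IH]; first by move=> [Cf _]; split=> //; exact: C1_comp.
move=> Sf; have /SmSP[Cf Df] := Sf.
apply/SmSP; split=> [|i]; first exact: C1_comp.
rewrite pd_comp//.
have -> : (@expR R)^`()%classic = @expR R.
  by apply/funext => x; rewrite derive1E derive_val.
by apply: SmM => //; exact: IH (SmS Sf).
Qed.

End Smooth.

(** * The ring of smooth functions on the past *)

Section Sfun.
Context {R : realType}.
Local Notation V := ('rV[R]_2 * R)%type.

Definition sfun_spec (f : V -> R) : Prop := (forall n, Sm n f) /\ vanishing f.

(* Extending by 0 to [t >= 0] makes equality on the past the equality of [sfun]. *)
Record sfun := Sfun { sfun_fun :> V -> R; sfunP : sfun_spec sfun_fun }.

HB.instance Definition _ := gen_eqMixin sfun.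
HB.instance Definition _ := gen_choiceMixin sfun.

Implicit Types (f g : sfun) (z : V) (i j : dir).

Lemma sfun_eq f g : (forall z, z.2 < 0 -> f z = g z) -> f = g.
Proof.
case: f g => [f pf] [g pg] /= fg.
have E : f = g by apply: funext_past => //; [exact: pf.2 | exact: pg.2].
by case: _ / E pg => pg; congr Sfun; exact: Prop_irrelevance.
Qed.

Definition trunc (f : V -> R) : V -> R := fun z => if z.2 < 0 then f z else 0.

Lemma trunc_spec (f : V -> R) : (forall n, Sm n f) -> sfun_spec (trunc f).
Proof.
move=> Sf; split=> [n|z z0]; last by rewrite /trunc ltNge z0.
by apply: Sm_near (Sf n) => z z0; rewrite /trunc z0.
Qed.

(* The operations are hidden behind [cid] so that unification never unfolds them. *)
Lemma sadd_spec : exists h : sfun -> sfun -> sfun,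
  forall f g z, h f g z = f z + g z.
Proof.
have S f g : sfun_spec (fun z => f z + g z).
  have [Sf vf] := sfunP f; have [Sg vg] := sfunP g.
  by split=> [n|z z0]; [exact: SmD | rewrite vf ?vg ?addr0].
by exists (fun f g => Sfun (S f g)).
Qed.
Definition sadd : sfun -> sfun -> sfun := projT1 (cid sadd_spec).
Lemma sadd_val f g z : sadd f g z = f z + g z.
Proof. exact: (projT2 (cid sadd_spec)). Qed.

Lemma sopp_spec : exists h : sfun -> sfun, forall f z, h f z = - f z.
Proof.
have S f : sfun_spec (fun z => - f z).
  have [Sf vf] := sfunP f.
  by split=> [n|z z0]; [exact: SmN | rewrite vf ?oppr0].
by exists (fun f => Sfun (S f)).
Qed.
Definition sopp : sfun -> sfun := projT1 (cid sopp_spec).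
Lemma sopp_val f z : sopp f z = - f z.
Proof. exact: (projT2 (cid sopp_spec)). Qed.

Lemma smul_spec : exists h : sfun -> sfun -> sfun,
  forall f g z, h f g z = f z * g z.
Proof.
have S f g : sfun_spec (fun z => f z * g z).
  have [Sf vf] := sfunP f; have [Sg vg] := sfunP g.
  by split=> [n|z z0]; [exact: SmM | rewrite vf ?mul0r].
by exists (fun f g => Sfun (S f g)).
Qed.
Definition smul : sfun -> sfun -> sfun := projT1 (cid smul_spec).
Lemma smul_val f g z : smul f g z = f z * g z.
Proof. exact: (projT2 (cid smul_spec)). Qed.

Lemma scst_spec : exists h : R -> sfun, forall c z, h c z = trunc (fun=> c) z.
Proof. by exists (fun c => Sfun (trunc_spec (fun n => Sm_cst n c))). Qed.
Definition scst : R -> sfun := projT1 (cid scst_spec).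
Lemma scst_val c z : scst c z = trunc (fun=> c) z.
Proof. exact: (projT2 (cid scst_spec)). Qed.

Lemma saddA : associative sadd.
Proof. by move=> f g h; apply: sfun_eq => z z0; rewrite !sadd_val addrA. Qed.
Lemma saddC : commutative sadd.
Proof. by move=> f g; apply: sfun_eq => z z0; rewrite !sadd_val addrC. Qed.
Lemma sadd0 : left_id (scst 0) sadd.
Proof. by move=> f; apply: sfun_eq => z z0; rewrite sadd_val scst_val /trunc z0 add0r. Qed.
Lemma saddN : left_inverse (scst 0) sopp sadd.
Proof. by move=> f; apply: sfun_eq => z z0; rewrite sadd_val sopp_val scst_val /trunc z0 addNr. Qed.

HB.instance Definition _ := GRing.isZmodule.Build sfun saddA saddC sadd0 saddN.

Lemma smulA : associative smul.
Proof. by move=> f g h; apply: sfun_eq => z z0; rewrite !smul_val mulrA. Qed.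
Lemma smulC : commutative smul.
Proof. by move=> f g; apply: sfun_eq => z z0; rewrite !smul_val mulrC. Qed.
Lemma smul1 : left_id (scst 1) smul.
Proof. by move=> f; apply: sfun_eq => z z0; rewrite smul_val scst_val /trunc z0 mul1r. Qed.
Lemma smulDl : left_distributive smul sadd.
Proof. by move=> f g h; apply: sfun_eq => z z0; rewrite smul_val !sadd_val !smul_val mulrDl. Qed.
Lemma sone_neq0 : scst 1 != 0.
Proof.
apply/eqP => /(congr1 (fun f : sfun => f (0, -1))).
by rewrite !scst_val /trunc /= ltrN10 => /eqP; rewrite oner_eq0.
Qed.

HB.instance Definition _ :=
  GRing.Zmodule_isComNzRing.Build sfun smulA smulC smul1 smulDl sone_neq0.

Lemma saddE f g z : (f + g) z = f z + g z. Proof. exact: sadd_val. Qed.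
Lemma soppE f z : (- f) z = - f z. Proof. exact: sopp_val. Qed.
Lemma smulE f g z : (f * g) z = f z * g z. Proof. exact: smul_val. Qed.
Lemma scstE c z : z.2 < 0 -> scst c z = c.
Proof. by move=> z0; rewrite scst_val /trunc z0. Qed.
Lemma s0E z : (0 : sfun) z = 0.
Proof. by rewrite [LHS]scst_val /trunc; case: ifP. Qed.
Lemma s1E z : z.2 < 0 -> (1 : sfun) z = 1. Proof. exact: scstE. Qed.
Lemma sexpE f n z : z.2 < 0 -> (f ^+ n) z = f z ^+ n.
Proof.
by move=> z0; elim: n => [|n IH]; rewrite ?s1E// !exprS smulE IH.
Qed.
Lemma snatE f n z : (f *+ n) z = f z *+ n.
Proof. by elim: n => [|n IH]; rewrite ?s0E// !mulrS saddE IH. Qed.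
Lemma pd_spec i f : sfun_spec (pd i f).
Proof.
have [Sf vf] := sfunP f; split; last exact: pd_vanishing.
by move=> n; have /SmSP[_] := Sf n.+1; apply.
Qed.

Lemma D_spec : exists h : dir -> sfun -> sfun, forall i f, h i f = pd i f :> (V -> R).
Proof. by exists (fun i f => Sfun (pd_spec i f)). Qed.
Definition D : dir -> sfun -> sfun := projT1 (cid D_spec).
Lemma D_val i f : D i f = pd i f :> (V -> R).
Proof. exact: (projT2 (cid D_spec)). Qed.

Lemma sfun_C1 f : C1 f. Proof. by have [/(_ 0%N)[]] := sfunP f. Qed.

Lemma DE i f z : z.2 < 0 -> D i f z = 'D_(dvec i) f z.
Proof. by move=> z0; rewrite D_val pdE. Qed.

Lemma is_derive_pd i f z : z.2 < 0 -> is_derive z (dvec i) f (D i f z).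
Proof. by move=> z0; rewrite DE//; have [_ ?] := sfun_C1 f z0; split. Qed.

Lemma sfun_continuous f z : z.2 < 0 -> {for z, continuous f}.
Proof. by move=> z0; have [] := sfun_C1 f z0. Qed.

Lemma D_add i f g : D i (f + g) = D i f + D i g.
Proof.
apply: sfun_eq => z z0; rewrite saddE !D_val.
have -> : (f + g : sfun) = (f : V -> R) + g :> (V -> R) by apply/funext => y; rewrite saddE.
by rewrite pdD//; exact: sfun_C1.
Qed.

Lemma D_opp i f : D i (- f) = - D i f.
Proof.
apply: sfun_eq => z z0; rewrite soppE !D_val.
have -> : (- f : sfun) = - (f : V -> R) :> (V -> R) by apply/funext => y; rewrite soppE.
by rewrite pdN//; exact: sfun_C1.
Qed.

Lemma D_mul i f g : D i (f * g) = D i f * g + f * D i g.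
Proof.
apply: sfun_eq => z z0; rewrite saddE !smulE !D_val.
have -> : (f * g : sfun) = (f : V -> R) * g :> (V -> R) by apply/funext => y; rewrite smulE.
by rewrite pdM//; exact: sfun_C1.
Qed.

Lemma D_cst i c : D i (scst c) = 0.
Proof.
apply: sfun_eq => z z0; rewrite s0E DE// (@near_eq_derive _ _ _ _ (fun=> c)).
  by rewrite derive_cst.
by near=> y; rewrite scstE//; near: y; exact: near_past.
Unshelve. all: by end_near. Qed.

Lemma D_0 i : D i 0 = 0. Proof. exact: D_cst. Qed.
Lemma D_1 i : D i 1 = 0. Proof. exact: D_cst. Qed.

Lemma D_nat i f n : D i (f *+ n) = D i f *+ n.
Proof. by elim: n => [|n IH]; rewrite ?D_0// !mulrS D_add IH. Qed.

Lemma D_exp i f n : D i (f ^+ n.+1) = (D i f * f ^+ n) *+ n.+1.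
Proof.
elim: n => [|n IH]; first by rewrite expr1 expr0 mulr1.
rewrite exprS D_mul IH [f ^+ n.+1]exprS -mulrnAr [RHS]mulrS -!mulrnAr; ring.
Qed.

Definition derE := (D_nat, D_exp, D_mul, D_opp, D_add, D_0, D_1, D_cst).

Lemma scalarE c f z : (scst c * f) z = c * f z.
Proof.
rewrite smulE scst_val /trunc; case: ifP => // z0.
by have [_ vf] := sfunP f; rewrite vf ?mulr0// leNgt z0.
Qed.

(* [sinv f] is meaningful only when [f] vanishes nowhere on the past. *)
Lemma sinv_spec f : exists g : sfun,
  (forall z, z.2 < 0 -> f z != 0) -> forall z, z.2 < 0 -> g z = (f z)^-1.
Proof.
have [f0|nf0] := pselect (forall z, z.2 < 0 -> f z != 0); last by exists 0.
have S n : Sm n (GRing.inv \o f).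
  by apply: Sm_inv => //; exact: (sfunP f).1.
by exists (Sfun (trunc_spec S)) => _ z z0; rewrite /= /trunc z0.
Qed.
Definition sinv f : sfun := projT1 (cid (sinv_spec f)).

Lemma sinvE f z : (forall z, z.2 < 0 -> f z != 0) -> z.2 < 0 ->
  sinv f z = (f z)^-1.
Proof. by move=> f0; apply: (projT2 (cid (sinv_spec f))). Qed.

Lemma mul_sinv f : (forall z, z.2 < 0 -> f z != 0) -> f * sinv f = 1.
Proof.
move=> f0; apply: sfun_eq => z z0.
by rewrite smulE sinvE// mulfV ?f0// s1E.
Qed.

Lemma sln_spec f : exists g : sfun,
  (forall z, z.2 < 0 -> 0 < f z) -> forall z, z.2 < 0 -> g z = ln (f z).
Proof.
have [f0|nf0] := pselect (forall z, z.2 < 0 -> 0 < f z); last by exists 0.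
have S n : Sm n (@ln R \o f).
  by apply: Sm_ln => //; exact: (sfunP f).1.
by exists (Sfun (trunc_spec S)) => _ z z0; rewrite /= /trunc z0.
Qed.
Definition sln f : sfun := projT1 (cid (sln_spec f)).

Lemma slnE f z : (forall z, z.2 < 0 -> 0 < f z) -> z.2 < 0 ->
  sln f z = ln (f z).
Proof. by move=> f0; apply: (projT2 (cid (sln_spec f))). Qed.

Lemma D_sln i f : (forall z, z.2 < 0 -> 0 < f z) -> D i f = f * D i (sln f).
Proof.
move=> f0; apply: sfun_eq => z z0; rewrite smulE 2?DE//.
have fz0 := f0 _ z0; have [df _] := is_derive_pd i f z0.
have [_ E] : is_derive z (dvec i) (@ln R \o f)
    ((@ln R)^`()%classic (f z) * 'D_(dvec i) f z).
  by apply: derive_comp1 => //; have [] := is_derive1_ln fz0.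
rewrite (@near_eq_derive _ _ _ (sln f) (@ln R \o f)).
  rewrite E derive1E; have [_ ->] := is_derive1_ln fz0.
  by rewrite mulrA mulfV ?mul1r// gt_eqF.
by near=> y; rewrite slnE//; near: y; exact: near_past.
Unshelve. all: by end_near. Qed.

Lemma sexpR_spec f : sfun_spec (trunc (@expR R \o f)).
Proof. by apply: trunc_spec => n; apply: Sm_exp; exact: (sfunP f).1. Qed.
Lemma sexpR_ex : exists h : sfun -> sfun, forall f z, z.2 < 0 -> h f z = expR (f z).
Proof.
by exists (fun f => Sfun (sexpR_spec f)) => f z z0; rewrite /= /trunc z0.
Qed.
Definition sexpR : sfun -> sfun := projT1 (cid sexpR_ex).
Lemma sexpRE f z : z.2 < 0 -> sexpR f z = expR (f z).
Proof. exact: (projT2 (cid sexpR_ex)). Qed.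

Lemma D_sexpR i f : D i (sexpR f) = D i f * sexpR f.
Proof.
apply: sfun_eq => z z0; rewrite smulE sexpRE// 2?DE//.
have [df _] := is_derive_pd i f z0.
have [_ E] : is_derive z (dvec i) (@expR R \o f)
    ((@expR R)^`()%classic (f z) * 'D_(dvec i) f z).
  by apply: derive_comp1.
rewrite (@near_eq_derive _ _ _ _ (@expR R \o f)).
  by rewrite E derive1E derive_val mulrC.
by near=> y; rewrite sexpRE//; near: y; exact: near_past.
Unshelve. all: by end_near. Qed.

Definition coord_fun (i : dir) z : R :=
  match i with DX => z.1 0 0 | DY => z.1 0 1 | DT => z.2 end.

Definition samedir i j : bool :=
  match i, j with DX, DX | DY, DY | DT, DT => true | _, _ => false end.

Lemma coord_line i j z (h : R) :
  coord_fun i (h *: dvec j + z) = h * (samedir i j)%:R + coord_fun i z.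
Proof.
by case: i; rewrite /coord_fun -?[(_ + z).1]/(h *: (dvec j).1 + z.1)
  -?[(_ + z).2]/(h * (dvec j).2 + z.2); case: j; rewrite /= ?mxE.
Qed.

Lemma coord_continuous i z : {for z, continuous (coord_fun i)}.
Proof.
case: i => /=.
- apply: (@continuous_comp _ _ _ fst (fun x : 'rV[R]_2 => x 0 0)).
    exact: cvg_fst.
  exact: coord_continuous.
- apply: (@continuous_comp _ _ _ fst (fun x : 'rV[R]_2 => x 0 1)).
    exact: cvg_fst.
  exact: coord_continuous.
- exact: cvg_snd.
Qed.

Lemma coord_Sm i n : Sm n (coord_fun i).
Proof.
apply: Sm_affine; first exact: coord_continuous.
by move=> z j h; exact: coord_line.
Qed.

Lemma coord_ex : exists h : dir -> sfun, forall i z, z.2 < 0 -> h i z = coord_fun i z.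
Proof.
by exists (fun i => Sfun (trunc_spec (coord_Sm i))) => i z z0; rewrite /= /trunc z0.
Qed.
Definition coord : dir -> sfun := projT1 (cid coord_ex).
Lemma coordE i z : z.2 < 0 -> coord i z = coord_fun i z.
Proof. exact: (projT2 (cid coord_ex)). Qed.

Lemma D_coord i j : D j (coord i) = (samedir i j)%:R.
Proof.
have -> : (samedir i j)%:R = scst (samedir i j)%:R by case: samedir.
apply: sfun_eq => z z0; rewrite scstE// DE//.
rewrite (@near_eq_derive _ _ _ _ (coord_fun i)); last first.
  by near=> y; rewrite coordE//; near: y; exact: near_past.
apply: cvg_lim => //; apply: cvg_near_cst; near=> h => /=.
rewrite coord_line addrK -[LHS]/(h^-1 * _) mulKf//.
by near: h; exact: nbhs_dnbhs_neq.
Unshelve. all: by end_near. Qed.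

Lemma smooth_on_Sm (f : V -> R) :
  smooth_on [set z : V | z.2 < 0] f -> forall n, Sm n (trunc f).
Proof.
move=> sf n; suff : forall vs : seq V, Sm n (trunc (foldr (fun v h => 'D_v h) f vs)).
  exact: (fun H => H [::]).
elim: n => [|n IH] vs.
  split=> //; apply: (@C1_near _ (foldr (fun v h => 'D_v h) f vs)).
    by move=> z z0; rewrite /trunc z0.
  by move=> z z0; have [cf df] := sf vs z z0; split.
apply/SmSP; split=> [|i].
  apply: (@C1_near _ (foldr (fun v h => 'D_v h) f vs)).
    by move=> z z0; rewrite /trunc z0.
  by move=> z z0; have [cf df] := sf vs z z0; split.
suff -> : pd i (trunc (foldr (fun v h => 'D_v h) f vs)) =
    trunc (foldr (fun v h => 'D_v h) f (dvec i :: vs)) by exact: IH.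
rewrite (@pd_near _ _ _ (foldr (fun v h => 'D_v h) f vs)) //.
by move=> z z0; rewrite /trunc z0.
Qed.

End Sfun.
Arguments sfun : clear implicits.
Arguments scst {R} c.
Arguments coord {R} i.

(** * Restriction to lines and extrema *)

Section Calculus.
Context {R : realType}.
Local Notation V := ('rV[R]_2 * R)%type.
Implicit Types (f g : sfun R) (z : V) (i j : dir).

Lemma near_box (P : set V) z i j : (\near z, P z) ->
  exists2 e : R, 0 < e & forall h k : R, `|h| < e -> `|k| < e ->
    P (h *: dvec i + (k *: dvec j + z)).
Proof.
move=> nP; pose m (q : R * R) : V := q.1 *: dvec i + (q.2 *: dvec j + z).
have cm : m q @[q --> ((0, 0) : R * R)] --> m (0, 0).
  apply: cvgD; first by apply: cvgZr_tmp; exact: cvg_fst.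
  by apply: cvgD; [apply: cvgZr_tmp; exact: cvg_snd | exact: cvg_cst].
have m0 : m (0, 0) = z by rewrite /m /= !scale0r !add0r.
rewrite m0 in cm; have := cm _ nP.
move=> /nbhs_ballP[e /= e0 He]; exists e => // h k hh kk.
apply: (He (h, k)); split; rewrite /ball /= sub0r normrN //.
Qed.

Lemma is_derive_line f z i (h : R) : (h *: dvec i + z).2 < 0 ->
  is_derive h 1 (fun h : R => f (h *: dvec i + z)) (D i f (h *: dvec i + z)).
Proof.
move=> hz; have [df Ef] := is_derive_pd i f hz.
have E : (fun k : R => k^-1 *: (((fun h : R => f (h *: dvec i + z)) \o shift h) (k *: 1)
    - f (h *: dvec i + z))) = (fun k : R => k^-1 *:
    ((f \o shift (h *: dvec i + z)) (k *: dvec i) - f (h *: dvec i + z))).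
  by apply/funext => k /=; rewrite [_%:A]mulr1 scalerDl addrA.
by split; [rewrite /derivable E | rewrite -Ef /derive E].
Qed.

Lemma mvt_line f z i (a b : R) : a < b ->
  (forall h, h \in `[a, b] -> (h *: dvec i + z).2 < 0) ->
  exists2 c, c \in `]a, b[ &
    f (b *: dvec i + z) - f (a *: dvec i + z) = D i f (c *: dvec i + z) * (b - a).
Proof.
move=> ab past; apply: (@MVT _ (fun h => f (h *: dvec i + z))) => //.
  by move=> x /subset_itv_oo_cc xab; apply: is_derive_line; exact: past.
apply: derivable_within_continuous => x xab.
by have [] := is_derive_line f (past x xab).
Qed.

(** Two mean value theorems turn the second difference over a square into a value of the mixed
    derivative. Exchanging [i] and [j] does not change that difference, which is the source of
    [D_comm]. *)
Lemma double_difference f z i j (e : R) : 0 < e ->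
  (forall h k : R, `|h| < e -> `|k| < e ->
     (h *: dvec i + (k *: dvec j + z)).2 < 0) ->
  forall h : R, 0 < h < e -> exists a b : R, [/\ `|a| < e, `|b| < e &
    f (h *: dvec i + (h *: dvec j + z)) - f (h *: dvec i + z)
      - (f (h *: dvec j + z) - f z)
    = D j (D i f) (a *: dvec i + (b *: dvec j + z)) * (h * h)].
Proof.
move=> e0 past h /andP[h0 he].
have nh k : k \in `[0, h] -> `|k| < e.
  by rewrite in_itv /= => /andP[k0 kh]; rewrite ger0_norm// (le_lt_trans kh).
have n0 : `|0 : R| < e by rewrite normr0.
pose phi (a : R) := f (a *: dvec i + (h *: dvec j + z)) - f (a *: dvec i + z).
have nhh : `|h| < e by rewrite gtr0_norm.
have past0 (a : R) : `|a| < e -> (a *: dvec i + z).2 < 0.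
  by move=> ae; have := past a 0 ae n0; rewrite scale0r add0r.
have dphi (a : R) : `|a| < e -> is_derive a 1 phi
    (D i f (a *: dvec i + (h *: dvec j + z)) - D i f (a *: dvec i + z)).
  move=> ae; apply: is_deriveB; apply: is_derive_line; last exact: past0.
  exact: past.
have [a ah Ea] : exists2 a, a \in `]0, h[ & phi h - phi 0 =
    (D i f (a *: dvec i + (h *: dvec j + z)) - D i f (a *: dvec i + z)) * (h - 0).
  apply: (@MVT _ phi (fun a => D i f (a *: dvec i + (h *: dvec j + z)) - D i f (a *: dvec i + z))) => //.
    by move=> x /subset_itv_oo_cc /nh xe; exact: dphi.
  apply: derivable_within_continuous => x /nh xe.
  by have [] := dphi x xe.
have ae : `|a| < e by apply: nh; apply: subset_itv_oo_cc ah.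
have [b bh Eb] : exists2 b, b \in `]0, h[ &
    D i f (h *: dvec j + (a *: dvec i + z)) - D i f (0 *: dvec j + (a *: dvec i + z))
    = D j (D i f) (b *: dvec j + (a *: dvec i + z)) * (h - 0).
  by apply: mvt_line => // k /nh ke; rewrite addrCA; exact: past.
exists a, b; split => //; first by apply: nh; apply: subset_itv_oo_cc bh.
move: Ea Eb; rewrite /phi !scale0r !add0r !subr0 => -> Eb.
rewrite [a *: dvec i + (h *: _ + _)]addrCA Eb.
by rewrite [b *: _ + _]addrCA mulrA.
Qed.

Lemma D_comm i j f : D i (D j f) = D j (D i f).
Proof.
suff le i' j' : forall z (eps : R), z.2 < 0 -> 0 < eps ->
    D i' (D j' f) z - D j' (D i' f) z <= eps.
  apply: sfun_eq => z z0; apply/le_anti/andP; split;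
    by rewrite -subr_le0; apply/ler_addgt0Pl => eps eps0; rewrite addr0 le.
move=> z eps z0 eps0.
have e20 : 0 < eps / 2 by rewrite divr_gt0.
have cl (g : sfun R) : \forall y \near z, `|g z - g y| < eps / 2.
  by have /cvgrPdist_lt := @sfun_continuous _ g _ z0; exact.
have [e1 e10 H1] : exists2 e : R, 0 < e & forall h k : R, `|h| < e -> `|k| < e ->
    [/\ (h *: dvec i' + (k *: dvec j' + z)).2 < 0,
    `|D i' (D j' f) z - D i' (D j' f) (h *: dvec i' + (k *: dvec j' + z))| < eps / 2 &
    `|D j' (D i' f) z - D j' (D i' f) (h *: dvec i' + (k *: dvec j' + z))| < eps / 2].
  apply: (@near_box (fun y => [/\ y.2 < 0, `|D i' (D j' f) z - D i' (D j' f) y| < eps / 2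
    & `|D j' (D i' f) z - D j' (D i' f) y| < eps / 2])).
  apply: filterS3 (near_past z0) (cl (D i' (D j' f))) (cl (D j' (D i' f))).
  by move=> y; split.
pose h := e1 / 2.
have h0 : 0 < h < e1 by rewrite /h; apply/andP; split; lra.
have past1 (a b : R) : `|a| < e1 -> `|b| < e1 -> (a *: dvec i' + (b *: dvec j' + z)).2 < 0.
  by move=> ae be; have [] := H1 a b ae be.
have past2 (a b : R) : `|a| < e1 -> `|b| < e1 -> (a *: dvec j' + (b *: dvec i' + z)).2 < 0.
  by move=> ae be; rewrite addrCA; exact: past1.
have [a [b [ae be Eab]]] := double_difference f e10 past1 h0.
have [a' [b' [ae' be' Eab']]] := double_difference f e10 past2 h0.
have swap (x y : R) : x *: dvec j' + (y *: dvec i' + z) =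
    y *: dvec i' + (x *: dvec j' + z) by exact: addrCA.
have hh0 : h * h != 0 by rewrite mulf_neq0// gt_eqF//; case/andP: h0.
have E : D j' (D i' f) (a *: dvec i' + (b *: dvec j' + z)) =
    D i' (D j' f) (a' *: dvec j' + (b' *: dvec i' + z)).
  rewrite (swap h h) in Eab'; have ab (p q r s : R) : p - q - (r - s) = p - r - (q - s) by ring.
  apply: (mulIf hh0 (etrans (esym Eab) (etrans (ab _ _ _ _) Eab'))).
have [_ _ A1] := H1 _ _ ae be.
have [_ A2 _] := H1 _ _ be' ae'.
move: A1 A2; rewrite E (swap a' b').
move: (D i' (D j' f) _) (D i' (D j' f) z) (D j' (D i' f) z) => p q r A1 A2.
move: A1 A2; rewrite !ltr_norml => /andP[B1 B2] /andP[B3 B4].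
clear -B1 B2 B3 B4; lra.
Unshelve. all: by end_near. Qed.

Definition spatial i : bool := if i is DT then false else true.

Lemma spatial_past i z (h : R) : spatial i -> z.2 < 0 -> (h *: dvec i + z).2 < 0.
Proof. by case: i => // _ z0; rewrite -[(_ + z).2]/(h * 0 + z.2) mulr0 add0r. Qed.

Lemma mvt_spatial f z i (a b : R) : spatial i -> z.2 < 0 ->
  exists2 c, `|c - a| <= `|b - a| &
    f (b *: dvec i + z) - f (a *: dvec i + z) = D i f (c *: dvec i + z) * (b - a).
Proof.
move=> si z0; have past h := spatial_past h si z0.
case: (ltgtP a b) => [ab|ba|->]; last by exists b; rewrite !subrr ?mulr0.
- have [//|c cab E] := @mvt_line f z i a b ab _; exists c => //.
  move: cab; rewrite in_itv /= => /andP[ac cb].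
  by rewrite !gtr0_norm ?subr_gt0// lerB// ltW.
- have [//|c cab E] := @mvt_line f z i b a ba _; exists c.
    move: cab; rewrite in_itv /= => /andP[ac cb].
    by rewrite !ltr0_norm ?subr_lt0// lerN2 lerB// ltW.
  by rewrite -opprB E -mulrN opprB.
Qed.

Lemma line_const f i z (a : R) : spatial i -> D i f = 0 -> z.2 < 0 ->
  f (a *: dvec i + z) = f z.
Proof.
move=> si Df z0; have [c _] := mvt_spatial f 0 a si z0.
by rewrite Df s0E mul0r scale0r add0r => /eqP; rewrite subr_eq0 => /eqP.
Qed.

Lemma near_line (P : set V) z i : (\near z, P z) ->
  exists2 e : R, 0 < e & forall h : R, `|h| < e -> P (h *: dvec i + z).
Proof.
move=> /(@near_box _ _ i i)[e e0 He]; exists e => // h he.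
by have := He h 0 he; rewrite normr0 scale0r add0r; exact.
Qed.

Lemma near_sign f z : z.2 < 0 -> 0 < f z -> \near z, 0 < f z.
Proof.
move=> z0 fz; have cf := @sfun_continuous _ f _ z0.
exact: (cvgr_gt _ cf).
Qed.

Lemma D_max_spatial f z i : spatial i -> z.2 < 0 ->
  (forall h : R, f (h *: dvec i + z) <= f z) -> D i f z = 0.
Proof.
move=> si z0 fmax; have past h := spatial_past h si z0.
have half (e : R) : 0 < e -> 0 < e / 2 < e by move=> e0; apply/andP; split; lra.
case: (ltgtP (D i f z) 0) => // Dz.
- have /near_line -/(_ i)[e e0 He] : \near z, 0 < (- D i f) z.
    by apply: near_sign => //; rewrite soppE oppr_gt0.
  have /andP[h0 he] := half _ e0.
  have [|//|c] := @mvt_line f z i (- (e / 2)) 0 _ _; first by rewrite oppr_lt0.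
  rewrite in_itv /= => /andP[c0 ch]; rewrite scale0r add0r sub0r opprK => E.
  have : 0 < (- D i f) (c *: dvec i + z).
    by apply: He; rewrite ltr0_norm//; clear -c0 he; lra.
  rewrite soppE oppr_gt0 => Hc.
  have : f z - f (- (e / 2) *: dvec i + z) < 0 by rewrite E pmulr_llt0.
  by rewrite subr_lt0 ltNge fmax.
- have /near_line -/(_ i)[e e0 He] := near_sign z0 Dz.
  have /andP[h0 he] := half _ e0.
  have [//|//|c] := @mvt_line f z i 0 (e / 2) _ _.
  rewrite in_itv /= => /andP[c0 ch]; rewrite scale0r add0r subr0 => E.
  have Hc : 0 < D i f (c *: dvec i + z).
    by apply: He; rewrite gtr0_norm//; clear -ch he; lra.
  have : 0 < f (e / 2 *: dvec i + z) - f z by rewrite E mulr_gt0.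
  by rewrite subr_gt0 ltNge fmax.
Qed.

Lemma D2_max_spatial f z i : spatial i -> z.2 < 0 ->
  (forall h : R, f (h *: dvec i + z) <= f z) -> D i (D i f) z <= 0.
Proof.
move=> si z0 fmax; have past h := spatial_past h si z0.
rewrite leNgt; apply/negP => /(near_sign z0) /near_line -/(_ i)[e e0 He].
pose h := e / 2; have h0 : 0 < h by rewrite divr_gt0.
have he : h < e by rewrite /h; lra.
have [//|c ch Ec] := @mvt_line f z i 0 h h0 _.
move: (ch); rewrite in_itv /= => /andP[c0 cle].
have [//|d dh Ed] := @mvt_line (D i f) z i 0 c c0 _.
move: (dh); rewrite in_itv /= => /andP[d0 dle].
move: Ed; rewrite scale0r add0r (D_max_spatial si z0 fmax) !subr0 => Ed.
move: Ec; rewrite scale0r add0r Ed subr0 => Ec.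
have : 0 < D i (D i f) (d *: dvec i + z) * c * h.
  by rewrite !mulr_gt0// He// gtr0_norm//; lra.
by rewrite -Ec subr_gt0 ltNge fmax.
Qed.

Lemma D_max_time f z (s : R) : s < z.2 -> z.2 < 0 ->
  (forall h : R, s <= h + z.2 <= z.2 -> f (h *: dvec DT + z) <= f z) ->
  0 <= D DT f z.
Proof.
move=> sz z0 fmax; rewrite leNgt; apply/negP => Dneg.
have /near_line -/(_ DT)[e e0 He] : \near z, 0 < (- D DT f) z.
  by apply: near_sign => //; rewrite soppE oppr_gt0.
pose h := Num.min (e / 2) (z.2 - s).
have h0 : 0 < h by rewrite lt_min subr_gt0 sz divr_gt0.
have he : h < e by rewrite gt_min; apply/orP; left; lra.
have hs : h <= z.2 - s by rewrite ge_min lexx orbT.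
have snd (k : R) : (k *: dvec DT + z).2 = k + z.2.
  by rewrite -[LHS]/(k * 1 + z.2) mulr1.
have [||c] := @mvt_line f z DT (- h) 0.
- by rewrite oppr_lt0.
- by move=> k; rewrite snd in_itv /= => /andP[_ k0]; clear -k0 z0; lra.
rewrite in_itv /= => /andP[c0 ch]; rewrite scale0r add0r sub0r opprK => E.
have Hc : 0 < (- D DT f) (c *: dvec DT + z) by apply: He; rewrite ltr0_norm//; lra.
have : f z - f (- h *: dvec DT + z) < 0.
  by rewrite E pmulr_llt0// -oppr_gt0 -soppE.
by rewrite subr_lt0 ltNge fmax//; apply/andP; split; lra.
Qed.

Definition pt (x y t : R) : V := x *: dvec DX + (y *: dvec DY + t *: dvec DT).

Lemma pt2 x y t : (pt x y t).2 = t.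
Proof. by rewrite /pt -[LHS]/(x * 0 + (y * 0 + t * 1)); ring. Qed.

Lemma ord2P (k : 'I_2) : k = 0 \/ k = 1.
Proof. by case: k => [[|[|//]] p]; [left | right]; exact: val_inj. Qed.

Lemma pt1 x y t : (pt x y t).1 = \row_(k < 2) (if k == 0 then x else y).
Proof.
rewrite -[LHS]/(x *: delta_mx 0 0 + (y *: delta_mx 0 1 + t *: 0)).
apply/rowP => k; rewrite !mxE /= mulr0 addr0.
by case: (ord2P k) => ->; rewrite /= ?mulr0 ?mulr1 ?addr0 ?add0r.
Qed.

Lemma ptE z : z = pt (z.1 0 0) (z.1 0 1) z.2.
Proof.
rewrite [LHS]surjective_pairing [RHS]surjective_pairing pt2 pt1; congr pair.
by apply/rowP => k; rewrite !mxE; case: (ord2P k) => ->.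
Qed.

Lemma pt_addX h x y t : h *: dvec DX + pt x y t = pt (h + x) y t.
Proof. by rewrite /pt scalerDl !addrA. Qed.

Lemma pt_addY h x y t : h *: dvec DY + pt x y t = pt x (h + y) t.
Proof. by rewrite /pt addrCA scalerDl -addrA. Qed.

(** The increment is taken along a path with one horizontal and one vertical leg; the mean value
    theorem on each leg and the continuity of the partial derivatives give the limit. *)
Lemma is_derive_curve f (a b : R -> R) (h0 a' b' t : R) : t < 0 ->
  is_derive h0 1 a a' -> is_derive h0 1 b b' ->
  is_derive h0 1 (fun h => f (pt (a h) (b h) t))
    (D DX f (pt (a h0) (b h0) t) * a' + D DY f (pt (a h0) (b h0) t) * b').
Proof.
move=> t0 da db.
have quot (c : R -> R) c' : is_derive h0 1 c c' ->
    (fun k : R => k^-1 * (c (k + h0) - c h0)) @ 0^' --> c'.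
  move=> [dc <-]; apply: cvg_trans (dc) => /=; apply: near_eq_cvg.
  by near=> k => /=; rewrite [_%:A]mulr1.
have cont (c : R -> R) c' : is_derive h0 1 c c' ->
    (fun k : R => c (k + h0)) @ 0^' --> c h0.
  move=> [/derivable1_diffP/differentiable_continuous cc _].
  have sh : (fun k : R => k + h0) @ 0^' --> h0.
    rewrite -[X in _ --> X]add0r; apply: cvgD; last exact: cvg_cst.
    exact: cvg_within.
  exact: (cvg_comp _ _ sh cc).
have /choice[xi Hxi] : forall k : R, exists c, `|c - a h0| <= `|a (k + h0) - a h0| /\
    f (pt (a (k + h0)) (b (k + h0)) t) - f (pt (a h0) (b (k + h0)) t)
    = D DX f (pt c (b (k + h0)) t) * (a (k + h0) - a h0).
  move=> k; have past : (pt 0 (b (k + h0)) t).2 < 0 by rewrite pt2.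
  have [c c1 c2] := @mvt_spatial f _ DX (a h0) (a (k + h0)) isT past.
  by exists c; split=> //; move: c2; rewrite !pt_addX !addr0.
have /choice[eta Heta] : forall k : R, exists c, `|c - b h0| <= `|b (k + h0) - b h0| /\
    f (pt (a h0) (b (k + h0)) t) - f (pt (a h0) (b h0) t)
    = D DY f (pt (a h0) c t) * (b (k + h0) - b h0).
  move=> k; have past : (pt (a h0) 0 t).2 < 0 by rewrite pt2.
  have [c c1 c2] := @mvt_spatial f _ DY (b h0) (b (k + h0)) isT past.
  by exists c; split=> //; move: c2; rewrite !pt_addY !addr0.
have squeeze (c d : R -> R) (l : R) : (forall k, `|d k - l| <= `|c (k + h0) - l|) ->
    (fun k : R => c (k + h0)) @ 0^' --> l -> d @ 0^' --> l.
  move=> cd /cvgrPdist_lt cl; apply/cvgrPdist_lt => e e0.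
  have := cl e e0; apply: filterS => k; rewrite distrC => ck.
  by rewrite distrC; exact: le_lt_trans (cd k) ck.
have cpt (c d : R -> R) x y (g : sfun R) : c @ 0^' --> x -> d @ 0^' --> y ->
    (fun k : R => g (pt (c k) (d k) t)) @ 0^' --> g (pt x y t).
  move=> cx dy.
  have cg : {for pt x y t, continuous g} by apply: sfun_continuous; rewrite pt2.
  have ck : (fun k : R => pt (c k) (d k) t) @ 0^' --> pt x y t.
    apply: cvgD; first exact: cvgZr_tmp.
    by apply: cvgD; [exact: cvgZr_tmp | exact: cvg_cst].
  exact: (cvg_comp _ _ ck cg).
have ca := cont _ _ da; have cb := cont _ _ db.
set L := (X in is_derive _ _ _ X).
have lim : (fun k : R => k^-1 *: (((fun h => f (pt (a h) (b h) t)) \o shift h0) (k *: 1)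
     - f (pt (a h0) (b h0) t))) @ 0^' --> L.
  have -> : (fun k : R => k^-1 *: (((fun h => f (pt (a h) (b h) t)) \o shift h0) (k *: 1)
     - f (pt (a h0) (b h0) t))) = (fun k : R =>
     D DX f (pt (xi k) (b (k + h0)) t) * (k^-1 * (a (k + h0) - a h0)) +
     D DY f (pt (a h0) (eta k) t) * (k^-1 * (b (k + h0) - b h0))).
    apply/funext => k /=; rewrite [_%:A]mulr1.
    rewrite mulrCA -(Hxi k).2 [in RHS]mulrCA -(Heta k).2 -mulrDr.
    by congr (_ * _); rewrite addrA subrK.
  apply: cvgD; apply: cvgM; try exact: quot.
    by apply: cpt => //; apply: squeeze ca => k; exact: (Hxi k).1.
  apply: cpt; first exact: cvg_cst.
  by apply: squeeze cb => k; exact: (Heta k).1.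
by split; [apply/cvg_ex; exists L | exact/cvg_lim].
Unshelve. all: by end_near. Qed.

End Calculus.

(** * Functions on the sphere in two stereographic charts *)

Section Inversion.
Context {R : realType}.
Local Notation V := ('rV[R]_2 * R)%type.
Implicit Types (F G : sfun R) (x y t : R).

Definition inv2 x y : R := (x ^+ 2 + y ^+ 2)^-1.

Definition inverted F G : Prop := forall x y t, t < 0 -> x ^+ 2 + y ^+ 2 != 0 ->
  G (pt x y t) = F (pt (x * inv2 x y) (y * inv2 x y) t).

Lemma is_derive_ext (f g : R -> R) x f' g' :
  is_derive x 1 f f' -> f =1 g -> f' = g' -> is_derive x 1 g g'.
Proof. by move=> df /funext <- <-. Qed.

Lemma is_derive_mul (f g : R -> R) x f' g' :
  is_derive x 1 f f' -> is_derive x 1 g g' ->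
  is_derive x 1 (fun x => f x * g x) (f x * g' + g x * f').
Proof. by move=> df dg; exact: is_deriveM. Qed.

Lemma is_derive_add (f g : R -> R) x f' g' :
  is_derive x 1 f f' -> is_derive x 1 g g' ->
  is_derive x 1 (fun x => f x + g x) (f' + g').
Proof. by move=> df dg; exact: is_deriveD. Qed.

Lemma is_derive_inv2X x y : x ^+ 2 + y ^+ 2 != 0 ->
  is_derive x 1 (inv2^~ y) (- (2 * x) * inv2 x y ^+ 2).
Proof.
move=> r0; pose q (x : R) := x ^+ 2 + y ^+ 2; have q0 : q x != 0 by [].
have [dq Eq] : is_derive x 1 q (2 * x).
  have := is_derive_add (is_derive_mul (is_derive_id x 1) (is_derive_id x 1))
    (is_derive_cst (y ^+ 2) x 1).
  by move/is_derive_ext; apply=> [z|]; rewrite /q /=; ring.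
rewrite (_ : inv2^~ y = (fun x => (q x)^-1))//.
split; first exact: (@derivableV R R q x 1 q0 dq).
rewrite (@deriveV R R q x 1 q0 dq) Eq -[LHS]/(- q x ^- 2 * (2 * x)) /inv2 exprVn.
by rewrite mulNr mulrC mulNr.
Qed.

Lemma inv2C x y : inv2 x y = inv2 y x. Proof. by rewrite /inv2 addrC. Qed.

Lemma is_derive_inv2Y x y : x ^+ 2 + y ^+ 2 != 0 ->
  is_derive y 1 (inv2 x) (- (2 * y) * inv2 x y ^+ 2).
Proof.
rewrite addrC => /is_derive_inv2X; rewrite inv2C.
by rewrite (_ : inv2^~ x = inv2 x)//; apply/funext => z; rewrite inv2C.
Qed.

Lemma near_r2X x y : x ^+ 2 + y ^+ 2 != 0 -> \forall x' \near x, x' ^+ 2 + y ^+ 2 != 0.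
Proof.
move=> r0; have c : {for x, continuous (fun x : R => x ^+ 2 + y ^+ 2)}.
  by apply: cvgD; [exact: exprn_continuous | exact: cvg_cst].
exact: (cvgr_neq0 _ c).
Qed.

Lemma is_derive_DX G x y t : t < 0 ->
  is_derive x 1 (fun x => G (pt x y t)) (D DX G (pt x y t)).
Proof.
move=> t0; have := is_derive_curve G t0 (is_derive_id x 1) (is_derive_cst y x 1).
by rewrite mulr1 mulr0 addr0.
Qed.

Lemma is_derive_DY G x y t : t < 0 ->
  is_derive y 1 (fun y => G (pt x y t)) (D DY G (pt x y t)).
Proof.
move=> t0; have := is_derive_curve G t0 (is_derive_cst x y 1) (is_derive_id y 1).
by rewrite mulr1 mulr0 add0r.
Qed.

Lemma pt_addT h x y t : h *: dvec DT + pt x y t = pt x y (h + t).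
Proof.
by rewrite /pt addrCA; congr (_ + _); rewrite addrCA scalerDl.
Qed.

Lemma is_derive_DT G x y t : t < 0 ->
  is_derive t 1 (fun t => G (pt x y t)) (D DT G (pt x y t)).
Proof.
move=> t0; have E h : h *: dvec DT + pt x y 0 = pt x y h by rewrite pt_addT addr0.
have past : (t *: dvec DT + pt x y 0).2 < 0 by rewrite E pt2.
by move/is_derive_ext: (is_derive_line G past); apply=> [h|]; rewrite E.
Qed.

Lemma derive_uniq_near (f g : R -> R) x f' g' : is_derive x 1 f f' ->
  is_derive x 1 g g' -> (\forall y \near x, f y = g y) -> f' = g'.
Proof. by move=> [_ <-] [_ <-] fg; exact: near_eq_derive. Qed.

Section FG.
Context (F G : sfun R) (FG : inverted F G).
Local Notation io := inv2.
Local Notation ev H x y t := (H (pt (x * inv2 x y) (y * inv2 x y) t)).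

Lemma is_derive_evX (H : sfun R) x y t : t < 0 -> x ^+ 2 + y ^+ 2 != 0 ->
  is_derive x 1 (fun x => ev H x y t)
   (ev (D DX H) x y t * (io x y - 2 * x ^+ 2 * io x y ^+ 2)
    + ev (D DY H) x y t * (- (2 * x * y) * io x y ^+ 2)).
Proof.
move=> t0 r0; have di := is_derive_inv2X r0.
have := is_derive_curve H t0 (is_derive_mul (is_derive_id x 1) di)
  (is_derive_mul (is_derive_cst y x 1) di).
by move/is_derive_ext; apply=> //; congr (_ * _ + _ * _); rewrite /cst; ring.
Qed.

Lemma is_derive_evY (H : sfun R) x y t : t < 0 -> x ^+ 2 + y ^+ 2 != 0 ->
  is_derive y 1 (fun y => ev H x y t)
   (ev (D DX H) x y t * (- (2 * x * y) * io x y ^+ 2)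
    + ev (D DY H) x y t * (io x y - 2 * y ^+ 2 * io x y ^+ 2)).
Proof.
move=> t0 r0; have di := is_derive_inv2Y r0.
have := is_derive_curve H t0 (is_derive_mul (is_derive_cst x y 1) di)
  (is_derive_mul (is_derive_id y 1) di).
by move/is_derive_ext; apply=> //; congr (_ * _ + _ * _); rewrite /cst; ring.
Qed.

Lemma inverted_DX x y t : t < 0 -> x ^+ 2 + y ^+ 2 != 0 ->
  D DX G (pt x y t) = ev (D DX F) x y t * (io x y - 2 * x ^+ 2 * io x y ^+ 2)
    + ev (D DY F) x y t * (- (2 * x * y) * io x y ^+ 2).
Proof.
move=> t0 r0; apply: derive_uniq_near (is_derive_DX G x y t0) (is_derive_evX F t0 r0) _.
by near=> x'; apply: FG => //; near: x'; exact: near_r2X.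
Unshelve. all: by end_near. Qed.

Lemma near_r2Y x y : x ^+ 2 + y ^+ 2 != 0 -> \forall y' \near y, x ^+ 2 + y' ^+ 2 != 0.
Proof.
rewrite addrC => /near_r2X; apply: filterS => z; by rewrite addrC.
Qed.

Lemma inverted_DY x y t : t < 0 -> x ^+ 2 + y ^+ 2 != 0 ->
  D DY G (pt x y t) = ev (D DX F) x y t * (- (2 * x * y) * io x y ^+ 2)
    + ev (D DY F) x y t * (io x y - 2 * y ^+ 2 * io x y ^+ 2).
Proof.
move=> t0 r0; apply: derive_uniq_near (is_derive_DY G x y t0) (is_derive_evY F t0 r0) _.
by near=> y'; apply: FG => //; near: y'; exact: near_r2Y.
Unshelve. all: by end_near. Qed.

Lemma inverted_DT : inverted (D DT F) (D DT G).
Proof.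
move=> x y t t0 r0.
apply: derive_uniq_near (is_derive_DT G x y t0) (is_derive_DT F _ _ t0) _.
near=> t'; apply: FG => //; near: t'; exact: lt_nbhsl.
Unshelve. all: by end_near. Qed.

(** Inversion is conformal with dilatation [inv2], so in dimension two it merely rescales the
    Laplacian. *)
Lemma inverted_laplacian x y t : t < 0 -> x ^+ 2 + y ^+ 2 != 0 ->
  (D DX (D DX G) + D DY (D DY G)) (pt x y t) =
  ev (D DX (D DX F) + D DY (D DY F)) x y t * io x y ^+ 2.
Proof.
move=> t0 r0; rewrite 2!saddE.
have di := is_derive_inv2X r0; have dj := is_derive_inv2Y r0.
have dXX := is_derive_add
  (is_derive_mul (is_derive_evX (D DX F) t0 r0)
    (is_derive_add di (is_derive_mul (is_derive_mul (is_derive_cst (-2 : R) x 1)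
      (is_derive_mul (is_derive_id x 1) (is_derive_id x 1))) (is_derive_mul di di))))
  (is_derive_mul (is_derive_evX (D DY F) t0 r0)
    (is_derive_mul (is_derive_mul (is_derive_cst (-2 : R) x 1)
      (is_derive_mul (is_derive_id x 1) (is_derive_cst y x 1))) (is_derive_mul di di))).
have dYY := is_derive_add
  (is_derive_mul (is_derive_evY (D DX F) t0 r0)
    (is_derive_mul (is_derive_mul (is_derive_cst (-2 : R) y 1)
      (is_derive_mul (is_derive_cst x y 1) (is_derive_id y 1))) (is_derive_mul dj dj)))
  (is_derive_mul (is_derive_evY (D DY F) t0 r0)
    (is_derive_add dj (is_derive_mul (is_derive_mul (is_derive_cst (-2 : R) y 1)
      (is_derive_mul (is_derive_id y 1) (is_derive_id y 1))) (is_derive_mul dj dj)))).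
have EX := derive_uniq_near (is_derive_DX (D DX G) x y t0) dXX.
have EY := derive_uniq_near (is_derive_DY (D DY G) x y t0) dYY.
rewrite EX; last first.
  near=> x'; rewrite inverted_DX//; last by near: x'; exact: near_r2X.
  by rewrite /cst; ring.
rewrite EY; last first.
  near=> y'; rewrite inverted_DY//; last by near: y'; exact: near_r2Y.
  by rewrite /cst; ring.
rewrite (D_comm DY DX F) /cst /inv2; set q := x ^+ 2 + y ^+ 2.
rewrite {}/q in r0 *.
move: (D DX (D DX F) _) (D DX (D DY F) _) (D DY (D DY F) _) => fxx fxy fyy.
move: (D DX F _) (D DY F _) => fx fy.
by field.
Unshelve. all: by end_near. Qed.
End FG.
End Inversion.

(** * Gluing of the two charts and the maximum principle *)

Section Compat.
Context {R : realType}.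
Local Notation V := ('rV[R]_2 * R)%type.
Implicit Types (F G : bool -> sfun R) (x y t : R) (b : bool).

(* The two charts then define a single function on the sphere. *)
Definition compat F : Prop := inverted (F false) (F true).

Lemma inv2_neq0 x y : x ^+ 2 + y ^+ 2 != 0 ->
  (x * inv2 x y) ^+ 2 + (y * inv2 x y) ^+ 2 = inv2 x y.
Proof. by move=> r0; rewrite /inv2; field. Qed.

Lemma inv2K x y : x ^+ 2 + y ^+ 2 != 0 ->
  inv2 (x * inv2 x y) (y * inv2 x y) = x ^+ 2 + y ^+ 2.
Proof. by move=> r0; rewrite {1}/inv2 inv2_neq0// /inv2 invrK. Qed.

Lemma inverted_sym (F G : sfun R) : inverted F G -> inverted G F.
Proof.
move=> FG x y t t0 r0; rewrite FG//; last first.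
  by rewrite inv2_neq0// /inv2 invr_eq0.
by rewrite inv2K// /inv2 !divfK.
Qed.

Lemma compat_neg F b : compat F -> inverted (F b) (F (~~ b)).
Proof. by case: b => //; exact: inverted_sym. Qed.

Lemma compat_add F G : compat F -> compat G -> compat (fun b => F b + G b).
Proof. by move=> cF cG x y t t0 r0; rewrite 2!saddE cF ?cG. Qed.

Lemma compat_opp F : compat F -> compat (fun b => - F b).
Proof. by move=> cF x y t t0 r0; rewrite 2!soppE cF. Qed.

Lemma compat_mul F G : compat F -> compat G -> compat (fun b => F b * G b).
Proof. by move=> cF cG x y t t0 r0; rewrite 2!smulE cF ?cG. Qed.

Lemma compat_cst (c : R) : compat (fun=> scst c).
Proof. by move=> x y t t0 r0; rewrite !scstE ?pt2. Qed.

Lemma compat_nat F n : compat F -> compat (fun b => F b *+ n).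
Proof. by move=> cF x y t t0 r0; rewrite 2!snatE cF. Qed.

Lemma compat_exp F n : compat F -> compat (fun b => F b ^+ n).
Proof. by move=> cF x y t t0 r0; rewrite 2?sexpE ?pt2// cF. Qed.

Lemma compat_DT F : compat F -> compat (fun b => D DT (F b)).
Proof. exact: inverted_DT. Qed.

Lemma compat_time : compat (fun=> coord DT).
Proof. by move=> x y t t0 r0; rewrite !coordE ?pt2// /coord_fun !pt2. Qed.

Lemma compat_sln F : (forall b z, z.2 < 0 -> 0 < F b z) -> compat F ->
  compat (fun b => sln (F b)).
Proof.
move=> F0 cF x y t t0 r0; rewrite !slnE ?pt2 ?cF//; exact: F0.
Qed.

Lemma compat_sexpR F : compat F -> compat (fun b => sexpR (F b)).
Proof. by move=> cF x y t t0 r0; rewrite !sexpRE ?pt2 ?cF. Qed.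

(* Laplacian and product of gradients for the metric [|dx|^2 / p] *)
Definition conf_lap (p F : sfun R) : sfun R := p * (D DX (D DX F) + D DY (D DY F)).
Definition conf_gam (p F G : sfun R) : sfun R := p * (D DX F * D DX G + D DY F * D DY G).

Lemma lapE (p F : sfun R) z : conf_lap p F z = p z * (D DX (D DX F) + D DY (D DY F)) z.
Proof. exact: smulE. Qed.

Lemma gamE (p F G : sfun R) z :
  conf_gam p F G z = p z * (D DX F z * D DX G z + D DY F z * D DY G z).
Proof.
rewrite /conf_gam (smulE p _ z) (saddE (D DX F * D DX G) (D DY F * D DY G) z).
by rewrite (smulE (D DX F) (D DX G) z) (smulE (D DY F) (D DY G) z).
Qed.

(** Says that the metrics [|dx|^2 / p] of the two charts correspond under inversion, whose
    dilatation is [1 / (x^2 + y^2)]. *)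
Definition conformal_pair (p : bool -> sfun R) : Prop := forall x y t, t < 0 ->
  x ^+ 2 + y ^+ 2 != 0 -> p true (pt x y t) =
    (x ^+ 2 + y ^+ 2) ^+ 2 * p false (pt (x * inv2 x y) (y * inv2 x y) t).

Lemma compat_lap p F : conformal_pair p -> compat F ->
  compat (fun b => conf_lap (p b) (F b)).
Proof.
move=> hp cF x y t t0 r0; have EL := inverted_laplacian cF t0 r0; have Ep := hp _ _ _ t0 r0.
have E1 := lapE (p true) (F true) (pt x y t).
have E2 := lapE (p false) (F false) (pt (x * inv2 x y) (y * inv2 x y) t).
rewrite EL Ep in E1; apply: (etrans E1); apply: (etrans _ (esym E2)).
clear -r0; move: (p false _) (sfun_fun (_ + _) _) => a b.
by rewrite /inv2; field.
Qed.

Lemma compat_gam p F G : conformal_pair p -> compat F -> compat G ->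
  compat (fun b => conf_gam (p b) (F b) (G b)).
Proof.
move=> hp cF cG x y t t0 r0; have Ep := hp _ _ _ t0 r0.
have E1 := gamE (p true) (F true) (G true) (pt x y t).
have E2 := gamE (p false) (F false) (G false) (pt (x * inv2 x y) (y * inv2 x y) t).
rewrite (inverted_DX cF t0 r0) (inverted_DX cG t0 r0) Ep in E1.
rewrite (inverted_DY cF t0 r0) (inverted_DY cG t0 r0) in E1.
apply: (etrans E1); apply: (etrans _ (esym E2)).
clear -r0.
move: (p false _) (D DX (F false) _) (D DY (F false) _) (D DX (G false) _)
  (D DY (G false) _) => a b c d e.
by rewrite /inv2; field.
Qed.

(** Compactness is used only on the square [[-1, 1]^2] of each chart: it contains the unit disc, and
    a point outside the disc is inverted into the disc of the other chart. *)
Lemma max_sphere F (s T : R) : compat F -> s <= T -> T < 0 ->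
  exists b x y t, [/\ s <= t, t <= T & forall b' x' y' t', s <= t' -> t' <= T ->
    F b' (pt x' y' t') <= F b (pt x y t)].
Proof.
move=> cF sT T0.
pose A : set (R * R * R) := (`[-1, 1] `*` `[-1, 1]) `*` `[s, T].
have cA : compact A by do !apply: compact_setX; exact: segment_compact.
have A0 : A !=set0.
  exists (0, 0, s); split; [split|]; rewrite /= in_itv /=; apply/andP; split => //;
    by rewrite ?lerN10 ?ler01 ?lexx.
have EVT b : exists2 c, c \in A & forall q, q \in A ->
    F b (pt q.1.1 q.1.2 q.2) <= F b (pt c.1.1 c.1.2 c.2).
  apply: (@compact_EVT_max _ _ (fun q : R * R * R => F b (pt q.1.1 q.1.2 q.2))) => //.
  apply: continuous_in_subspaceT => q /set_mem [_] /=; rewrite in_itv /= => /andP[_ qT].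
  have q0 : (pt q.1.1 q.1.2 q.2).2 < 0 by rewrite pt2; exact: le_lt_trans qT T0.
  have cq : (fun q : R * R * R => pt q.1.1 q.1.2 q.2) @ q --> pt q.1.1 q.1.2 q.2.
    have c1 : (fun q : R * R * R => q.1.1) @ q --> q.1.1.
      by apply: (cvg_comp _ _ cvg_fst cvg_fst).
    have c2 : (fun q : R * R * R => q.1.2) @ q --> q.1.2.
      by apply: (cvg_comp _ _ cvg_fst cvg_snd).
    have c3 : (fun q : R * R * R => q.2) @ q --> q.2 by exact: cvg_snd.
    apply: cvgD; first exact: cvgZr_tmp.
    by apply: cvgD; exact: cvgZr_tmp.
  exact: (cvg_comp _ _ cq (@sfun_continuous _ (F b) _ q0)).
have [c0 /set_mem cA0 H0] := EVT false; have [c1 /set_mem cA1 H1] := EVT true.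
have [c [b [cA' Hc]]] : exists c b, A c /\ forall b' q, q \in A ->
    F b' (pt q.1.1 q.1.2 q.2) <= F b (pt c.1.1 c.1.2 c.2).
  case: (leP (F false (pt c0.1.1 c0.1.2 c0.2)) (F true (pt c1.1.1 c1.1.2 c1.2))) => l.
    exists c1, true; split=> // -[] q qA; first exact: H1.
    exact: le_trans (H0 _ qA) l.
  exists c0, false; split=> // -[] q qA; last exact: H0.
  exact: le_trans (H1 _ qA) (ltW l).
exists b, c.1.1, c.1.2, c.2; move: cA' => [_] /=; rewrite in_itv /= => /andP[c2s c2T].
split=> // b' x y t st tT.
have box u v b2 : -1 <= u <= 1 -> -1 <= v <= 1 ->
    F b2 (pt u v t) <= F b (pt c.1.1 c.1.2 c.2).
  move=> hu hv; apply: (Hc b2 (u, v, t)); apply/mem_set.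
  by split; [split|]; rewrite /= in_itv //= st tT.
have sq1 (a : R) : a ^+ 2 <= 1 -> -1 <= a <= 1.
  by move=> a1; rewrite -ler_norml -(ler_pXn2r (n := 2)) ?nnegrE// real_normK ?num_real// expr1n.
have [r1|r1] := leP (x ^+ 2 + y ^+ 2) 1.
  by apply: box; apply: sq1; apply: le_trans r1; rewrite ?lerDl ?lerDr sqr_ge0.
have t0 : t < 0 by exact: le_lt_trans tT T0.
have r0 : x ^+ 2 + y ^+ 2 != 0 by rewrite gt_eqF// (lt_trans ltr01).
have -> : F b' (pt x y t) = F (~~ b') (pt (x * inv2 x y) (y * inv2 x y) t).
  by have := compat_neg (~~ b') cF t0 r0; rewrite negbK.
have i1 : (x * inv2 x y) ^+ 2 + (y * inv2 x y) ^+ 2 <= 1.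
  by rewrite inv2_neq0// /inv2 invf_le1 ?ltW// (lt_trans ltr01).
by apply: box; apply: sq1; apply: le_trans i1; rewrite ?lerDl ?lerDr sqr_ge0.
Qed.

Lemma lap_max (p : sfun R) (F : sfun R) x y t : t < 0 -> 0 < p (pt x y t) ->
  (forall x' y', F (pt x' y' t) <= F (pt x y t)) ->
  [/\ D DX F (pt x y t) = 0, D DY F (pt x y t) = 0 & conf_lap p F (pt x y t) <= 0].
Proof.
move=> t0 p0 Fmax; have past : (pt x y t).2 < 0 by rewrite pt2.
have mX (h : R) : F (h *: dvec DX + pt x y t) <= F (pt x y t).
  by rewrite pt_addX; exact: Fmax.
have mY (h : R) : F (h *: dvec DY + pt x y t) <= F (pt x y t).
  by rewrite pt_addY; exact: Fmax.
split; [exact: D_max_spatial mX | exact: D_max_spatial mY|].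
rewrite lapE saddE pmulr_rle0//.
have := D2_max_spatial (i := DX) isT past mX.
have := D2_max_spatial (i := DY) isT past mY.
move: (D DX (D DX F) _) (D DY (D DY F) _) => a b a0 b0.
by clear -a0 b0; lra.
Qed.

(* Spatial extremality makes the gradient vanish and the Laplacian nonpositive; the
   time derivative is nonnegative unless the maximum sits on the initial slice. *)
Lemma max_principle (p F : bool -> sfun R) (s T : R) :
  (forall b z, z.2 < 0 -> 0 < p b z) -> compat F -> s <= T -> T < 0 ->
  exists b x y t, [/\ s <= t, t <= T & forall b' x' y' t', s <= t' -> t' <= T ->
    F b' (pt x' y' t') <= F b (pt x y t)] /\
    [/\ D DX (F b) (pt x y t) = 0, D DY (F b) (pt x y t) = 0,
      conf_lap (p b) (F b) (pt x y t) <= 0 & s < t -> 0 <= D DT (F b) (pt x y t)].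
Proof.
move=> p0 cF sT T0; have [b [x [y [t [st tT Fmax]]]]] := max_sphere cF sT T0.
have t0 : t < 0 := le_lt_trans tT T0.
have past : (pt x y t).2 < 0 by rewrite pt2.
have [d1 d2 d3] := @lap_max (p b) (F b) x y t t0 (p0 b _ past)
  (fun x' y' => Fmax b x' y' t st tT).
exists b, x, y, t; split=> //; split=> // lt_st.
apply: (@D_max_time _ (F b) _ s); rewrite ?pt2// => h /andP[h1 h2].
rewrite pt_addT; apply: Fmax => //; exact: le_trans h2 tT.
Qed.
End Compat.

(** * Evolution equations in a chart *)

Section ChartAlgebra.
Context {R : realType}.
Implicit Types (F G H : sfun R).

Definition commE := (@D_comm R DY DX, @D_comm R DT DX, @D_comm R DT DY).

Section Metric.
Context (p K : sfun R).
Hypothesis Dtp : D DT p = K * p.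
Hypothesis Kp : K * p = p * (D DX (D DX p) + D DY (D DY p)) - D DX p ^+ 2 - D DY p ^+ 2.

Local Notation lap := (conf_lap p).
Local Notation gam := (conf_gam p).

(** With [hess2], the trace-free Hessian for the metric [|dx|^2 / p] in an orthonormal frame: the
    difference of the diagonal entries and twice the off-diagonal one. *)
Definition hess1 F := p * (D DX (D DX F) - D DY (D DY F)) + D DX p * D DX F - D DY p * D DY F.
Definition hess2 F := p * D DX (D DY F) *+ 2 + D DX p * D DY F + D DY p * D DX F.

Lemma gamC F G : gam F G = gam G F.
Proof. by rewrite /conf_gam; ring. Qed.

Lemma gamDr F G H : gam F (G + H) = gam F G + gam F H.
Proof. by rewrite /conf_gam !derE; ring. Qed.

Lemma gamNr F G : gam F (- G) = - gam F G.
Proof. by rewrite /conf_gam !derE; ring. Qed.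

Lemma lapD F G : lap (F + G) = lap F + lap G.
Proof. by rewrite /conf_lap !derE; ring. Qed.

Lemma lapN F : lap (- F) = - lap F.
Proof. by rewrite /conf_lap !derE; ring. Qed.

Lemma Dt_gam F G : D DT (gam F G) = K * gam F G + gam (D DT F) G + gam F (D DT G).
Proof. by rewrite /conf_gam !derE Dtp !commE; ring. Qed.

Lemma Dt_lap F : D DT (lap F) = K * lap F + lap (D DT F).
Proof. by rewrite /conf_lap !derE Dtp !commE; ring. Qed.

Lemma gam_gam F : gam F (gam F F) = lap F * gam F F
  + p * (hess1 F * (D DX F ^+ 2 - D DY F ^+ 2) + hess2 F * D DX F * D DY F *+ 2).
Proof. by rewrite /conf_gam /conf_lap /hess1 /hess2 !derE !commE; ring. Qed.

(** Bochner's formula. In dimension two, twice the squared Hessian is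
    [lap F ^+ 2 + hess1 F ^+ 2 + hess2 F ^+ 2], and twice the Ricci tensor is the scalar curvature
    [K] times the metric. *)
Lemma bochner F : lap (gam F F) = lap F ^+ 2 + hess1 F ^+ 2 + hess2 F ^+ 2
  + gam F (lap F) *+ 2 + K * gam F F.
Proof.
have -> : K * gam F F = (K * p) * (D DX F ^+ 2 + D DY F ^+ 2) by rewrite /conf_gam; ring.
by rewrite Kp /conf_gam /conf_lap /hess1 /hess2 !derE !commE; ring.
Qed.
End Metric.

Lemma mulsI (g F G : sfun R) : (forall z, z.2 < 0 -> g z != 0) -> g * F = g * G -> F = G.
Proof.
move=> g0 gFG; apply: sfun_eq => z z0; apply: (mulfI (g0 z z0)).
by rewrite -!smulE gFG.
Qed.

Section Flow.
Context (p : sfun R).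
Hypothesis p_gt0 : forall z, z.2 < 0 -> 0 < p z.
Hypothesis flow : D DT p = p * (D DX (D DX p) + D DY (D DY p)) - D DX p ^+ 2 - D DY p ^+ 2.

Local Notation lap := (conf_lap p).
Local Notation gam := (conf_gam p).
Local Notation X := (coord DX).
Local Notation Y := (coord DY).

Let p_neq0 z : z.2 < 0 -> p z != 0. Proof. by move=> /p_gt0 h; rewrite gt_eqF. Qed.

Definition log_p := sln p.
Local Notation f := log_p.
(** The scalar curvature of [|dx|^2 / p], that is, twice its Gauss curvature. *)
Definition curv := lap f.

Lemma D_p i : D i p = p * D i f. Proof. exact: D_sln. Qed.

Lemma curv_p : curv * p = p * (D DX (D DX p) + D DY (D DY p)) - D DX p ^+ 2 - D DY p ^+ 2.
Proof. by rewrite /curv /conf_lap !(D_p, derE); ring. Qed.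

Lemma Dt_p : D DT p = curv * p. Proof. by rewrite flow curv_p. Qed.

Lemma Dt_log_p : D DT f = curv.
Proof. by apply: (mulsI p_neq0); rewrite -D_p Dt_p mulrC. Qed.

Lemma Dt_curv : D DT curv = lap curv + curv ^+ 2.
Proof. by rewrite /curv (Dt_lap Dt_p) Dt_log_p -/curv; ring. Qed.

Definition sphere_den : sfun R := 1 + X ^+ 2 + Y ^+ 2.
Local Notation s := sphere_den.

Lemma sphere_denE z : z.2 < 0 -> s z = 1 + z.1 0 0 ^+ 2 + z.1 0 1 ^+ 2.
Proof. by move=> z0; rewrite !saddE s1E// !sexpE// !coordE. Qed.

Lemma sphere_den_gt0 z : z.2 < 0 -> 0 < s z.
Proof.
move=> z0; rewrite sphere_denE// -addrA ltr_pwDl// addr_ge0// sqr_ge0//.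
Qed.

Lemma sphere_den_neq0 z : z.2 < 0 -> s z != 0.
Proof. by move=> /sphere_den_gt0 h; rewrite gt_eqF. Qed.

Definition iden := sinv s.
Lemma mul_iden : s * iden = 1. Proof. exact: mul_sinv sphere_den_neq0. Qed.

Lemma D_iden i : D i iden = - (D i s * iden ^+ 2).
Proof.
apply: (mulsI sphere_den_neq0).
have := congr1 (D i) mul_iden; rewrite !(D_mul, D_1) => /eqP.
rewrite addr_eq0 => /eqP E.
have -> : s * - (D i s * iden ^+ 2) = - (s * iden) * (D i s * iden) by ring.
by rewrite mul_iden E; ring.
Qed.

(** The round metric is [4 |dx|^2 / s^2] in this chart, so this is the reciprocal of the conformal
    factor relative to it. *)
Definition press := p * iden ^+ 2 *+ 4.
Local Notation v := press.

Lemma pressE z : z.2 < 0 -> v z = p z * (s z)^-1 ^+ 2 *+ 4.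
Proof.
move=> z0; rewrite snatE smulE sexpE// sinvE//; exact: sphere_den_neq0.
Qed.

Lemma press_gt0 z : z.2 < 0 -> 0 < v z.
Proof.
by move=> z0; rewrite pressE// pmulrn_lgt0// mulr_gt0 ?p_gt0// exprn_gt0// invr_gt0 sphere_den_gt0.
Qed.

Let press_neq0 z : z.2 < 0 -> v z != 0.
Proof. by move=> /press_gt0 h; rewrite gt_eqF. Qed.

Definition log_press := sln v.
Local Notation w := log_press.

Lemma D_press i : D i v = v * D i w. Proof. exact: D_sln press_gt0. Qed.

Lemma D_log_press i : D i w = D i f - D i s * iden *+ 2.
Proof.
apply: (mulsI press_neq0); rewrite -D_press /v !(derE, D_iden) (D_p i).
rewrite -/s; ring.
Qed.

Lemma D_den : (D DX s = X *+ 2) * (D DY s = Y *+ 2) * (D DT s = 0).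
Proof. by rewrite /s !derE !D_coord /=; do !split; ring. Qed.

Lemma D_X : (D DX X = 1 :> sfun R) * (D DY X = 0 :> sfun R) * (D DT X = 0 :> sfun R).
Proof. by rewrite !D_coord. Qed.
Lemma D_Y : (D DX Y = 0 :> sfun R) * (D DY Y = 1 :> sfun R) * (D DT Y = 0 :> sfun R).
Proof. by rewrite !D_coord. Qed.

Definition chartE := (D_log_press, D_den, D_X, D_Y, D_iden, D_p, @derE R).

Lemma Dt_log_press : D DT w = curv.
Proof. by rewrite !chartE Dt_log_p; ring. Qed.

Lemma Dt_press : D DT v = v * curv. Proof. by rewrite D_press Dt_log_press. Qed.

(** Up to a constant, [w] is [f - 2 log s], and the second term contributes [- 2 v] because the unit
    sphere has scalar curvature 2. *)
Lemma lap_log_press : lap w = curv - v *+ 2.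
Proof.
have E : iden ^+ 2 = iden - (X ^+ 2 + Y ^+ 2) * iden ^+ 2.
  have h : iden = s * iden * iden by rewrite mul_iden mul1r.
  by rewrite [X in _ = X - _]h /s; ring.
have -> : v *+ 2 = p * (iden - (X ^+ 2 + Y ^+ 2) * iden ^+ 2) *+ 8.
  by rewrite -E /v; ring.
by rewrite /curv /conf_lap !chartE; ring.
Qed.

Lemma lap_press : lap v = v * (curv - v *+ 2 + gam w w).
Proof. by rewrite -lap_log_press /conf_lap /conf_gam !(D_press, derE); ring. Qed.

Definition grad2 := gam w w.

Lemma gam_log_press F : gam F v = v * gam F w.
Proof. by rewrite /conf_gam !D_press; ring. Qed.

Lemma Dt_grad2 : D DT grad2 = lap grad2 - (curv - v *+ 2) ^+ 2
  - hess1 p w ^+ 2 - hess2 p w ^+ 2 + v * grad2 *+ 4.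
Proof.
rewrite /grad2 (Dt_gam Dt_p) Dt_log_press (bochner curv_p) lap_log_press.
rewrite gamDr gamNr.
have -> : gam w (v *+ 2) = v * gam w w *+ 2.
  by rewrite !mulr2n gamDr gam_log_press.
by rewrite (gamC _ curv w); ring.
Qed.

(** The summand [v *+ 4] cancels the reaction term [v * grad2 *+ 4] of [Dt_grad2]. The favourable
    squares of the Hessian survive, at the price of [v ^+ 2 *+ 8], which is bounded backward in
    time. *)
Lemma Dt_grad2_press : let Z := grad2 + v *+ 4 in
  D DT Z = lap Z - (curv - v *+ 2) ^+ 2
    - (hess1 p w ^+ 2 + hess2 p w ^+ 2) + v ^+ 2 *+ 8.
Proof.
rewrite /= D_add D_nat Dt_press Dt_grad2 lapD.
have -> : lap (v *+ 4) = v * (curv - v *+ 2 + grad2) *+ 4.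
  by rewrite -lap_press /conf_lap !derE; ring.
by ring.
Qed.

(* [8 (f_zz + f_z^2 / 2) = schw1 - i schw2] with [f = ln p] *)
Definition schw1 := (D DX (D DX f) - D DY (D DY f)) *+ 2 + D DX f ^+ 2 - D DY f ^+ 2.
Definition schw2 := D DX (D DY f) *+ 4 + D DX f * D DY f *+ 2.
Definition schw_norm := p ^+ 2 * (schw1 ^+ 2 + schw2 ^+ 2).

(** This and [schw2E] replace [f] by [w], a function on the sphere. The round factor drops out since
    [g = 2 log s] satisfies [g_zz + g_z^2 / 2 = 2 s_zz / s = 0]. *)
Lemma schw1E : p * schw1 = hess1 p w *+ 2 - p * (D DX w ^+ 2 - D DY w ^+ 2).
Proof. by rewrite /schw1 /hess1 !chartE; ring. Qed.

Lemma schw2E : p * schw2 = hess2 p w *+ 2 - p * D DX w * D DY w *+ 2.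
Proof. by rewrite /schw2 /hess2 !chartE; ring. Qed.

(** Only [lap], [gam] and functions on the sphere occur on the right, which makes [schw_norm]
    independent of the chart. Squaring [schw1E] and [schw2E] gives squares of the Hessian, removed
    by [bochner], and a cross term, removed by [gam_gam]. *)
Lemma schw_normE : schw_norm = lap grad2 *+ 4 - gam w grad2 *+ 4 - gam w curv *+ 8
  + v * grad2 *+ 8 - (curv - v *+ 2) ^+ 2 *+ 4 + grad2 ^+ 2.
Proof.
have -> : schw_norm = (p * schw1) ^+ 2 + (p * schw2) ^+ 2 by rewrite /schw_norm; ring.
rewrite schw1E schw2E /grad2 (bochner curv_p) gam_gam lap_log_press gamDr gamNr.
have -> : gam w (v *+ 2) = v * gam w w *+ 2.
  by rewrite !mulr2n gamDr gam_log_press.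
rewrite /conf_gam; ring.
Qed.

(* [8 p_zzz = cubic1 - i cubic2] *)
Definition cubic1 := D DX (D DX (D DX p)) - D DX (D DY (D DY p)) *+ 3.
Definition cubic2 := D DX (D DX (D DY p)) *+ 3 - D DY (D DY (D DY p)).
Definition cubic_norm := p * (cubic1 ^+ 2 + cubic2 ^+ 2).

(** For [q = f_zz + f_z^2 / 2] the covariant derivative of [q dz^2] has the two components
    [(p^2 q)_z / p^2 = p_zzz / p] and [q_zbar = K_z / (4 p)], where [K] is the curvature; the last
    two terms are their squared norms. *)
Lemma Dt_schw_norm : D DT schw_norm = lap schw_norm - cubic_norm *+ 4 - gam curv curv *+ 4.
Proof.
rewrite /schw_norm /cubic_norm /cubic1 /cubic2 /schw1 /schw2 /conf_gam /conf_lap.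
rewrite !(D_p, derE, commE) Dt_log_p /curv /conf_lap !(D_p, derE, commE).
ring.
Qed.

(** In complex form the flow is [p_t = 4 (p p_{z zbar} - p_z p_zbar)]. In its third z-derivative the
    products of [p_zz] and [p_{zz zbar}] cancel, so [c = p_zzz] solves the linear equation [c_t = 4
    (p c_{z zbar} + 2 p_z c_zbar - p_zbar c_z - 2 p_{z zbar} c)], of which this is the real part. *)
Lemma Dt_cubic1 : D DT cubic1 = p * (D DX (D DX cubic1) + D DY (D DY cubic1))
  + D DX p * D DX cubic1 + D DY p * D DY cubic1
  + (D DX p * D DY cubic2 - D DY p * D DX cubic2) *+ 3
  - (D DX (D DX p) + D DY (D DY p)) * cubic1 *+ 2.
Proof.
rewrite /cubic1 /cubic2 !(derE, commE) flow !(derE, commE); ring.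
Qed.

Lemma Dt_cubic2 : D DT cubic2 = p * (D DX (D DX cubic2) + D DY (D DY cubic2))
  + D DX p * D DX cubic2 + D DY p * D DY cubic2
  - (D DX p * D DY cubic1 - D DY p * D DX cubic1) *+ 3
  - (D DX (D DX p) + D DY (D DY p)) * cubic2 *+ 2.
Proof.
rewrite /cubic1 /cubic2 !(derE, commE) flow !(derE, commE); ring.
Qed.

(** With [c = p_zzz], the four squares are those of the real and imaginary parts of
    [16 (p c_zbar - p_zbar c)] and [16 (p c_z + 2 p_z c)]. They absorb all first order terms; the
    remaining reaction term has a sign as soon as the curvature is nonnegative. *)
Lemma Dt_cubic_norm : D DT cubic_norm = lap cubic_norm - curv * cubic_norm *+ 4
  - (p * (D DX cubic1 + D DY cubic2) - (D DX p * cubic1 + D DY p * cubic2)) ^+ 2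
  - (p * (D DY cubic1 - D DX cubic2) - (D DY p * cubic1 - D DX p * cubic2)) ^+ 2
  - (p * (D DX cubic1 - D DY cubic2) + (D DX p * cubic1 - D DY p * cubic2) *+ 2) ^+ 2
  - (p * (D DX cubic2 + D DY cubic1) + (D DX p * cubic2 + D DY p * cubic1) *+ 2) ^+ 2.
Proof.
have -> : curv * cubic_norm = (curv * p) * (cubic1 ^+ 2 + cubic2 ^+ 2).
  by rewrite /cubic_norm; ring.
rewrite curv_p /cubic_norm /conf_lap.
move: cubic1 cubic2 Dt_cubic1 Dt_cubic2 => c1 c2 E1 E2.
rewrite !derE flow E1 E2; ring.
Qed.

End Flow.
End ChartAlgebra.

(** * Harnack inequality and a priori estimates *)

Section HarnackAlgebra.
Context {R : realType} (p : sfun R).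
Hypothesis p_gt0 : forall z, z.2 < 0 -> 0 < p z.
Hypothesis flow : D DT p = p * (D DX (D DX p) + D DY (D DY p)) - D DX p ^+ 2 - D DY p ^+ 2.
Hypothesis curv_gt0 : forall z, z.2 < 0 -> 0 < curv p z.

Local Notation lap := (conf_lap p).
Local Notation gam := (conf_gam p).
Local Notation K := (curv p).
Local Notation w := (log_press p).

Definition log_curv := sln K.
Local Notation L := log_curv.
Definition harnack := lap L + K.

Lemma D_curv i : D i K = K * D i L. Proof. exact: D_sln. Qed.

Let curv_neq0 z : z.2 < 0 -> K z != 0.
Proof. by move=> /curv_gt0 h; rewrite gt_eqF. Qed.

Lemma Dt_log_curv : D DT L = harnack + gam L L.
Proof.
apply: (mulsI curv_neq0); rewrite -D_curv (Dt_curv p_gt0 flow) /harnack.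
have -> : lap K = K * (lap L + gam L L).
  by rewrite /conf_lap /conf_gam !(D_curv, derE); ring.
ring.
Qed.

Lemma Dt_harnack : D DT harnack = lap harnack + gam L harnack *+ 2 + harnack ^+ 2
  + (hess1 p L ^+ 2 + hess2 p L ^+ 2).
Proof.
have E : lap L = harnack - K by rewrite /harnack addrK.
rewrite {1}/harnack D_add (Dt_lap (Dt_p p_gt0 flow)) D_curv Dt_log_curv lapD.
rewrite (bochner (curv_p p_gt0)) E gamDr gamNr.
have -> : gam L K = K * gam L L by rewrite /conf_gam !D_curv; ring.
ring.
Qed.

(** Since [w] has time derivative [K], the gradient part contributes [K * gam w w] and the cross
    term [K * gam w L *+ 2], which complete the [gam L L] of [Dt_log_curv] to a square. *)
Lemma Dt_curv_grad2 : D DT (K + grad2 p) = K * (harnack + gam (L + w) (L + w)).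
Proof.
rewrite D_add D_curv Dt_log_curv /grad2 (Dt_gam (Dt_p p_gt0 flow)).
rewrite (Dt_log_press p_gt0 flow) (gamC _ K w).
have -> : gam w K = K * gam w L by rewrite /conf_gam !D_curv; ring.
by rewrite /conf_gam !derE; ring.
Qed.
End HarnackAlgebra.

(** * Comparison estimates on the sphere *)

Section MaxConsequences.
Context {R : realType} (p : bool -> sfun R).
Hypothesis p_gt0 : forall b z, z.2 < 0 -> 0 < p b z.
Implicit Types (F : bool -> sfun R) (x y t : R).

Lemma compat_ext F G : compat F -> (forall b, F b = G b) -> compat G.
Proof. by move=> cF FG x y t t0 r0; rewrite -!FG cF. Qed.

Lemma past_pt x y t : t < 0 -> (pt x y t).2 < 0. Proof. by rewrite pt2. Qed.

Lemma timeE x y t : t < 0 -> coord DT (pt x y t) = t :> R.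
Proof. by move=> t0; rewrite coordE ?pt2// /coord_fun pt2. Qed.

Lemma max_growth F (c M s T : R) : compat F -> s <= T -> T < 0 ->
  (forall b z, s <= z.2 <= T -> D DT (F b) z <= conf_lap (p b) (F b) z + c) ->
  (forall b x y, F b (pt x y s) <= M) ->
  forall b x y t, s <= t <= T -> F b (pt x y t) <= M + c * (t - s).
Proof.
move=> cF sT T0 HF HM b0 x0 y0 t0 /andP[st0 t0T].
apply/ler_addgt0Pl => e e0.
have [ts0|ts0] := leP t0 s.
  have -> : t0 = s by apply/le_anti; rewrite ts0.
  by rewrite subrr mulr0 addr0; apply: le_trans (HM _ _ _) _; rewrite lerDr ltW.
(* The slope exceeds [c], which excludes a maximum after time [s]; the total excess up to [t0] is
   only [e]. *)
pose k := c + e / (t0 - s).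
pose G b := F b - scst k * (coord DT - scst s).
have cG : compat G.
  apply: compat_add => //; apply: compat_opp; apply: compat_mul; first exact: compat_cst.
  apply: compat_add; first exact: compat_time.
  by apply: compat_opp; exact: compat_cst.
have GE b x y t : t < 0 -> G b (pt x y t) = F b (pt x y t) - k * (t - s).
  move=> t1; rewrite /G (saddE (F b)) soppE scalarE saddE soppE timeE//.
  by rewrite scstE ?pt2.
have DtG b : D DT (G b) = D DT (F b) - scst k.
  by rewrite /G !derE !D_coord /=; ring.
have lapG b : conf_lap (p b) (G b) = conf_lap (p b) (F b).
  by rewrite /conf_lap /G !derE !D_coord /= !derE; ring.
have [b [x [y [t [[st tT Gmax] [_ _ lapG0 DtG0]]]]]] := max_principle p_gt0 cG sT T0.
have t1 : t < 0 := le_lt_trans tT T0.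
suff HG : G b (pt x y t) <= M.
  have := le_trans (Gmax b0 x0 y0 t0 st0 t0T) HG.
  rewrite GE ?(le_lt_trans t0T)// /k.
  have : e / (t0 - s) * (t0 - s) = e by rewrite divfK// gt_eqF// subr_gt0.
  move: (F b0 _) => q; clear; move: (e / _) => r; lra.
move: st; rewrite le_eqVlt => /predU1P[<-|lt_st].
  by rewrite GE ?(le_lt_trans sT)// subrr mulr0 subr0.
move: (DtG0 lt_st) lapG0; rewrite DtG lapG saddE soppE scstE ?pt2//.
have := HF b (pt x y t); rewrite pt2 (ltW lt_st) tT => /(_ isT).
have : 0 < e / (t0 - s) by rewrite divr_gt0// subr_gt0.
rewrite /k; move: (e / _) (D DT _ _) (conf_lap _ _ _) => r q u; clear; lra.
Qed.

(** Comparison with the solution [- 1 / (t - s)] of the Riccati equation gives [- (t - s) * F <= 1]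
    for a flow started at time [s]. On an ancient solution [s] is arbitrary, which is incompatible
    with a negative value. *)
Lemma ancient_riccati F : compat F ->
  (forall b z, z.2 < 0 -> D DX (F b) z = 0 -> D DY (F b) z = 0 ->
    conf_lap (p b) (F b) z + F b z ^+ 2 <= D DT (F b) z) ->
  forall b x y t, t < 0 -> 0 <= F b (pt x y t).
Proof.
move=> cF HF b0 x0 y0 t0 t00.
have bound s : s < t0 -> - (t0 - s) * F b0 (pt x0 y0 t0) <= 1.
  move=> st0.
  pose G b := - (coord DT - scst s) * F b.
  have cG : compat G.
    apply: compat_mul => //; apply: compat_opp.
    apply: compat_add; first exact: compat_time.
    by apply: compat_opp; exact: compat_cst.
  have GE b x y t : t < 0 -> G b (pt x y t) = - (t - s) * F b (pt x y t).
    by move=> t1; rewrite /G smulE soppE saddE soppE timeE// scstE ?pt2.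
  have DG b i : D i (G b) = - (D i (coord DT) * F b) - (coord DT - scst s) * D i (F b).
    by rewrite /G !derE; ring.
  have lapG b : conf_lap (p b) (G b) = - (coord DT - scst s) * conf_lap (p b) (F b).
    by rewrite /conf_lap /G !derE !D_coord /= !derE; ring.
  have [b [x [y [t [[st tT Gmax] [dX dY lapG0 DtG0]]]]]] :=
    max_principle p_gt0 cG (ltW st0) t00.
  have t1 : t < 0 := le_lt_trans tT t00.
  have evalE (H : sfun R) : ((coord DT - scst s) * H) (pt x y t) = (t - s) * H (pt x y t).
    by rewrite smulE saddE soppE timeE// scstE ?pt2.
  suff HG : G b (pt x y t) <= 1.
    by have := le_trans (Gmax b0 x0 y0 t0 (ltW st0) (lexx _)) HG; rewrite GE.
  move: st; rewrite le_eqVlt => /predU1P[<-|lt_st].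
    by rewrite GE ?(lt_trans st0)// subrr oppr0 mul0r ler01.
  have ts0 : 0 < t - s by rewrite subr_gt0.
  have z0 (H : sfun R) : - ((t - s) * H (pt x y t)) = 0 -> H (pt x y t) = 0.
    by move=> /eqP; rewrite oppr_eq0 mulf_eq0 gt_eqF//= => /eqP.
  have fX : D DX (F b) (pt x y t) = 0.
    apply: z0; rewrite -dX DG D_coord /= mul0r oppr0 sub0r soppE evalE //.
  have fY : D DY (F b) (pt x y t) = 0.
    apply: z0; rewrite -dY DG D_coord /= mul0r oppr0 sub0r soppE evalE //.
  have := HF b _ (past_pt x y t1) fX fY.
  move: (DtG0 lt_st) lapG0; rewrite DG D_coord /= mul1r lapG mulNr saddE !soppE !evalE.
  rewrite GE//; move: (F b _) (conf_lap _ _ _) (D DT _ _) => f l d H1 H2 H3.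
  have l0 : 0 <= l by rewrite -(pmulr_rge0 _ ts0) -oppr_le0.
  rewrite leNgt; apply/negP => H4.
  have f0 : f < 0 by rewrite -(pmulr_rlt0 _ ts0); clear -H4; lra.
  have : f ^+ 2 <= d by clear -l0 H3; lra.
  rewrite -(ler_pM2l ts0) => H5.
  have : 0 < - f * (- (t - s) * f - 1) by rewrite mulr_gt0 ?oppr_gt0// subr_gt0.
  clear -H5 H1; lra.
move: (F b0 (pt x0 y0 t0)) bound => f bound; rewrite leNgt; apply/negP => Fneg.
(* The start [t0 + 2 / f] makes the left side of [bound] equal to 2. *)
have a0 : 2 / f < 0 by rewrite pmulr_rlt0// invr_lt0.
have E : 2 / f * f = 2 by rewrite divfK// lt_eqF.
have := bound (t0 + 2 / f); move: (2 / f) a0 E => a a0 E H.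
by have := H ltac:(clear -a0; lra); clear -E; lra.
Qed.
End MaxConsequences.

(** * Geometric quantities as functions on the sphere *)

Section SphereFlow.
Context {R : realType} (p : bool -> sfun R).
Hypothesis p_gt0 : forall b z, z.2 < 0 -> 0 < p b z.
Hypothesis flow : forall b, D DT (p b) =
  p b * (D DX (D DX (p b)) + D DY (D DY (p b))) - D DX (p b) ^+ 2 - D DY (p b) ^+ 2.
Hypothesis conf : conformal_pair p.
Implicit Types (x y t : R).

Local Notation X := (coord DX).
Local Notation Y := (coord DY).

Lemma iden_pt x y t : t < 0 -> iden (pt x y t) = (1 + x ^+ 2 + y ^+ 2)^-1 :> R.
Proof.
move=> t0; rewrite sinvE ?pt2// ?sphere_denE ?pt2//; last exact: sphere_den_neq0.
by rewrite pt1 !mxE.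
Qed.

Lemma den_gt0 x y : 0 < 1 + x ^+ 2 + y ^+ 2.
Proof. by rewrite -addrA ltr_pwDl// addr_ge0// sqr_ge0. Qed.

Lemma den_neq0 x y : 1 + x ^+ 2 + y ^+ 2 != 0.
Proof. by rewrite gt_eqF// den_gt0. Qed.

Lemma coord_pt x y t : t < 0 -> (X (pt x y t) = x) * (Y (pt x y t) = y).
Proof. by move=> t0; rewrite !coordE ?pt2// /coord_fun pt1 !mxE. Qed.

Lemma press_pt b x y t : t < 0 ->
  press (p b) (pt x y t) = 4 * p b (pt x y t) / (1 + x ^+ 2 + y ^+ 2) ^+ 2.
Proof.
move=> t0; rewrite /press snatE smulE sexpE ?pt2// iden_pt//.
by have := den_neq0 x y; move: (p b _) => a d; field.
Qed.

Lemma compat_press : compat (fun b => press (p b)).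
Proof.
move=> x y t t0 r0; rewrite !press_pt// (conf t0 r0).
have d0 := den_neq0 x y; have d1 := den_neq0 (x * inv2 x y) (y * inv2 x y).
have -> : 1 + (x * inv2 x y) ^+ 2 + (y * inv2 x y) ^+ 2 =
    (1 + x ^+ 2 + y ^+ 2) / (x ^+ 2 + y ^+ 2).
  by rewrite -addrA inv2_neq0// /inv2; field.
by move: (p false _) => a; field; rewrite d0 r0.
Qed.

Lemma compat_log_press : compat (fun b => log_press (p b)).
Proof.
apply: (compat_sln (F := fun b => press (p b))) compat_press => b z.
by apply: press_gt0; exact: p_gt0.
Qed.

(** The curvature is the time derivative of [log_press], and time derivatives commute with the
    change of chart. *)
Lemma compat_curv : compat (fun b => curv (p b)).
Proof.
apply: compat_ext (compat_DT compat_log_press) _ => b.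
exact: Dt_log_press (@p_gt0 b) (@flow b).
Qed.

Lemma compat_grad2 : compat (fun b => grad2 (p b)).
Proof. by apply: compat_gam => //; exact: compat_log_press. Qed.

Lemma compat_schw_norm : compat (fun b => schw_norm (p b)).
Proof.
have cY := compat_grad2; have cK := compat_curv; have cv := compat_press.
have cw := compat_log_press.
pose G b := conf_lap (p b) (grad2 (p b)) *+ 4 - conf_gam (p b) (log_press (p b)) (grad2 (p b)) *+ 4
  - conf_gam (p b) (log_press (p b)) (curv (p b)) *+ 8
  + press (p b) * grad2 (p b) *+ 8 - (curv (p b) - press (p b) *+ 2) ^+ 2 *+ 4
  + grad2 (p b) ^+ 2.
have cG : compat G.
  have c1 := compat_nat 4 (compat_lap conf cY).
  have c2 := compat_opp (compat_nat 4 (compat_gam conf cw cY)).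
  have c3 := compat_opp (compat_nat 8 (compat_gam conf cw cK)).
  have c4 := compat_nat 8 (compat_mul cv cY).
  have c5 := compat_opp (compat_nat 4 (compat_exp 2 (compat_add cK (compat_opp (compat_nat 2 cv))))).
  exact: (compat_add (compat_add (compat_add (compat_add (compat_add c1 c2) c3) c4) c5)
    (compat_exp 2 cY)).
by apply: compat_ext cG _ => b; rewrite /G -(schw_normE (@p_gt0 b)).
Qed.

(** Read off from [Dt_schw_norm], all of whose other terms are already known to be functions on the
    sphere. *)
Lemma compat_cubic_norm : compat (fun b => cubic_norm (p b)).
Proof.
have cE := compat_schw_norm; have cK := compat_curv.
have c4 : compat (fun b => cubic_norm (p b) *+ 4).
  have c1 := compat_lap conf cE.
  have c2 := compat_opp (compat_DT cE).
  have c3 := compat_opp (compat_nat 4 (compat_gam conf cK cK)).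
  apply: compat_ext (compat_add (compat_add c1 c2) c3) _ => b /=.
  by rewrite (Dt_schw_norm (@p_gt0 b) (@flow b)); ring.
move=> x y t t0 r0; have := c4 x y t t0 r0; rewrite 2!snatE => /eqP.
by rewrite eqrMn2r// => /eqP.
Qed.

Lemma curv_ge0 b x y t : t < 0 -> 0 <= curv (p b) (pt x y t).
Proof.
apply: (ancient_riccati p_gt0 compat_curv) => b' z z0 _ _.
by rewrite (Dt_curv (@p_gt0 b') (@flow b')) saddE sexpE.
Qed.

(** The linear function [n |-> <m, n>] on the sphere, written in the chart [b]; the sign accounts
    for the two poles of projection. *)
Definition height (m : R * R * R) (b : bool) : sfun R :=
  scst m.1.1 * (X * iden *+ 2) + scst m.1.2 * (Y * iden *+ 2)
  + scst (m.2 * (-1) ^+ b) * (1 - iden *+ 2).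

Definition unit3 (m : R * R * R) := m.1.1 ^+ 2 + m.1.2 ^+ 2 + m.2 ^+ 2 = 1.

Lemma height_pt m b x y t : t < 0 -> height m b (pt x y t) =
  (m.1.1 * (2 * x) + m.1.2 * (2 * y) + m.2 * (-1) ^+ b * (x ^+ 2 + y ^+ 2 - 1))
    / (1 + x ^+ 2 + y ^+ 2).
Proof.
move=> t0; rewrite 2!saddE !scalarE (snatE (X * iden)) (snatE (Y * iden)) saddE soppE s1E ?pt2//.
rewrite snatE (smulE X) (smulE Y).
rewrite !coord_pt// iden_pt//.
have := den_neq0 x y; move: (_ ^+ b) => s d; by field.
Qed.

Lemma compat_height m : compat (height m).
Proof.
move=> x y t t0 r0; rewrite !height_pt//.
have d0 := den_neq0 x y; have d1 := den_neq0 (x * inv2 x y) (y * inv2 x y).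
have -> : 1 + (x * inv2 x y) ^+ 2 + (y * inv2 x y) ^+ 2 =
    (1 + x ^+ 2 + y ^+ 2) / (x ^+ 2 + y ^+ 2).
  by rewrite -addrA inv2_neq0// /inv2; field.
rewrite inv2_neq0// /inv2 expr1 expr0.
by field; rewrite d0 r0.
Qed.

(** Linear functions are eigenfunctions of the round Laplacian with eigenvalue 2, and the Laplacian
    of the metric is [v] times the round one. *)
Lemma lap_height m b : conf_lap (p b) (height m b) = - (press (p b) * height m b *+ 2).
Proof.
(* The two sides agree only modulo the relation [sphere_den * iden = 1]; the multiple of it that
   occurs is written out below. *)
have E : sphere_den * iden - 1 = 0 :> sfun R by rewrite mul_iden subrr.
have -> : conf_lap (p b) (height m b) = - (press (p b) * height m b *+ 2)
  + p b * iden ^+ 2 * (scst m.1.1 * X + scst m.1.2 * Y - scst (m.2 * (-1) ^+ b))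
    * (sphere_den * iden - 1) *+ 16.
  rewrite /conf_lap /height /press !(D_den, D_X, D_Y, D_iden, @derE R) /sphere_den.
  ring.
by rewrite E mulr0 mul0rn addr0.
Qed.

Lemma gam_height m b : unit3 m ->
  conf_gam (p b) (height m b) (height m b) = press (p b) * (1 - height m b ^+ 2).
Proof.
move=> m1; have E : sphere_den * iden - 1 = 0 :> sfun R by rewrite mul_iden subrr.
have <- : scst m.1.1 ^+ 2 + scst m.1.2 ^+ 2 + scst (m.2 * (-1) ^+ b) ^+ 2 = 1 :> sfun R.
  apply: sfun_eq => z z0; rewrite 2!saddE !sexpE// !scstE//.
  by rewrite exprMn sqrr_sign mulr1.
have -> : conf_gam (p b) (height m b) (height m b) = press (p b) *
   (scst m.1.1 ^+ 2 + scst m.1.2 ^+ 2 + scst (m.2 * (-1) ^+ b) ^+ 2 - height m b ^+ 2)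
  + p b * iden ^+ 3 * (scst m.1.1 * X + scst m.1.2 * Y - scst (m.2 * (-1) ^+ b)) ^+ 2
    * (sphere_den * iden - 1) *+ 16.
  rewrite /conf_gam /height /press !(D_den, D_X, D_Y, D_iden, @derE R) /sphere_den.
  ring.
by rewrite E mulr0 mul0rn addr0.
Qed.

Lemma height_le1 m b x y t : unit3 m -> t < 0 ->
  0 <= 1 - height m b (pt x y t) ^+ 2 /\ height m b (pt x y t) <= 1.
Proof.
move=> m1 t0; have past := past_pt x y t0.
have h2 : 0 <= 1 - height m b (pt x y t) ^+ 2.
  have v0 := press_gt0 (@p_gt0 b) past.
  rewrite -(pmulr_rge0 _ v0).
  have -> : 1 - height m b (pt x y t) ^+ 2 = (1 - height m b ^+ 2) (pt x y t).
    by rewrite (saddE 1) (soppE (height m b ^+ 2)) s1E// sexpE.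
  rewrite -smulE -gam_height// gamE; apply: mulr_ge0; first exact/ltW/p_gt0.
  by apply: addr_ge0; rewrite -expr2 sqr_ge0.
split=> //; have : `|height m b (pt x y t)| <= 1.
  by rewrite -(ler_pXn2r (n := 2)) ?nnegrE// real_normK ?num_real// expr1n -subr_ge0.
exact: le_trans (ler_norm _).
Qed.

(** The point of the sphere with coordinates [(x, y)] in the chart [b], used as the centre of a
    cap. *)
Definition pole_of (b : bool) x y : R * R * R :=
  let d := 1 + x ^+ 2 + y ^+ 2 in
  (2 * x / d, 2 * y / d, (-1) ^+ b * (x ^+ 2 + y ^+ 2 - 1) / d).

Lemma unit3_pole b x y : unit3 (pole_of b x y).
Proof.
rewrite /unit3 /=; have d0 := den_neq0 x y.
rewrite !exprMn sqrr_sign mul1r; by field.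
Qed.

(** For unit vectors [1 - <m, n>] is half the squared chord, here in stereographic coordinates. *)
Lemma height_pole b x0 y0 x y t : t < 0 -> 1 - height (pole_of b x0 y0) b (pt x y t)
  = 2 * ((x - x0) ^+ 2 + (y - y0) ^+ 2)
    / ((1 + x ^+ 2 + y ^+ 2) * (1 + x0 ^+ 2 + y0 ^+ 2)).
Proof.
move=> t0; rewrite height_pt// /pole_of /=.
have d0 := den_neq0 x y; have d1 := den_neq0 x0 y0.
have S : (-1) ^+ b * (-1) ^+ b = 1 :> R by rewrite -expr2 sqrr_sign.
have -> : (-1) ^+ b * (x0 ^+ 2 + y0 ^+ 2 - 1) / (1 + x0 ^+ 2 + y0 ^+ 2) * (-1) ^+ b
    = (x0 ^+ 2 + y0 ^+ 2 - 1) / (1 + x0 ^+ 2 + y0 ^+ 2) :> R.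
  by rewrite mulrAC [_ * _ * (-1) ^+ b]mulrAC S mul1r.
by field; rewrite d0 d1.
Qed.
End SphereFlow.

(** The left side comes from the motion and the damping of the barrier, the right side from its
    Laplacian. For small [y] the gradient term [6 y vv (1 - q^2)] wins, because [q - y] keeps away
    from -1 and 1: [P] is the resulting lower bound, and [B] gathers the terms of the next order in
    [y]. The quotient [B^2 / (4 P)] in [Lam] compensates them by completing a square, and the added
    1 makes the inequality strict. *)
Lemma barrier_bracket (R : realType) (e mu vm V y q vv : R) :
  let P := 6 * vm * e ^+ 2 in let B := 3 * mu + 18 * V in
  let Lam := B ^+ 2 / (4 * P) + 1 in
  0 < e < 1 -> 0 < vm -> 0 < y -> vm <= vv <= V -> q <= 1 -> 0 <= 1 - q ^+ 2 ->
  -1 + e <= q - y <= 1 - e ->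
  mu * y ^+ 2 *+ 3 - Lam * y ^+ 3 <
    y ^+ 2 * - (vv * q *+ 2) *+ 3 + y * (vv * (1 - q ^+ 2)) *+ 6.
Proof.
move=> P B Lam /andP[e0 e1] vm0.
have P0 : 0 < P by rewrite !mulr_gt0// ?exprn_gt0// ltr0n.
move=> y0 /andP[vm_le le_V] q1 q2 /andP[c1 c2].
have vv0 : 0 < vv := lt_le_trans vm0 vm_le.
have q3 : e ^+ 2 - 2 * y <= 1 - q ^+ 2.
  have [ye|ey] := leP y e.
    have : (e - y) * e <= (1 - q) * (1 + q) by apply: ler_pM; lra.
    have : e * y <= 1 * y by rewrite ler_pM2r// ltW.
    have -> : (1 - q) * (1 + q) = 1 - q ^+ 2 by ring.
    have -> : (e - y) * e = e ^+ 2 - e * y by ring.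
    lra.
  apply: le_trans q2; have : e ^+ 2 <= e by rewrite expr2 ger_pMl// ltW.
  lra.
have i1 : vv * (e ^+ 2 - 2 * y) <= vv * (1 - q ^+ 2) by rewrite ler_pM2l.
have i2 : vm * e ^+ 2 <= vv * e ^+ 2 by rewrite ler_pM2r// exprn_gt0.
have i3 : vv * y <= V * y by rewrite ler_pM2r.
have i4 : vv * q * y <= V * y.
  by apply: le_trans i3; rewrite ler_pM2r// ger_pMr.
have i5 : B * y <= (Lam - 1) * y ^+ 2 + P.
  rewrite /Lam addrK -subr_ge0 -(pmulr_rge0 _ P0).
  have -> : P * (B ^+ 2 / (4 * P) * y ^+ 2 + P - B * y) = (B * y / 2 - P) ^+ 2.
    by field; rewrite gt_eqF.
  exact: sqr_ge0.
have i6 : 0 < y ^+ 2 by rewrite exprn_gt0.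
have : 0 < y * (Lam * y ^+ 2 - 3 * mu * y - 6 * (vv * q * y) + 6 * (vv * (1 - q ^+ 2))).
  rewrite mulr_gt0//; move: i5; rewrite /B /P mulrBl mul1r; lra.
set l := (X in 0 < X -> _) => pos; rewrite -subr_gt0; set r := (X in 0 < X).
by have -> : r = l by rewrite /r /l; ring.
Qed.

Lemma barrier_contra (R : realType) (d l k a c q : R) :
  d - l = k * (a - c) - q ^+ 2 -> a < c -> 0 < k -> 0 <= d -> l <= 0 -> False.
Proof.
move=> E ac k0 d0 l0; have : 0 < k * (c - a) by rewrite mulr_gt0// subr_gt0.
have := sqr_ge0 q; lra.
Qed.

(** * Spreading of positive curvature *)

Section AncientFlow.
Context {R : realType} (p : bool -> sfun R).
Hypothesis p_gt0 : forall b z, z.2 < 0 -> 0 < p b z.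
Hypothesis flow : forall b, D DT (p b) =
  p b * (D DX (D DX (p b)) + D DY (D DY (p b))) - D DX (p b) ^+ 2 - D DY (p b) ^+ 2.
Hypothesis conf : conformal_pair p.
Implicit Types (x y t : R) (m : R * R * R).

Local Notation K b := (curv (p b)).
Local Notation v b := (press (p b)).
Local Notation cK := (compat_curv p_gt0 flow conf).
Local Notation cv := (compat_press conf).
Local Notation K_ge0 := (curv_ge0 p_gt0 flow conf).

Lemma bounded_slab F (s T : R) : compat F -> s <= T -> T < 0 ->
  exists M, forall b x y t, s <= t <= T -> F b (pt x y t) <= M.
Proof.
move=> cF sT T0; have [b [x [y [t [_ _ H]]]]] := max_sphere cF sT T0.
by exists (F b (pt x y t)) => b' x' y' t' /andP[st tT]; exact: H.
Qed.

Lemma press_slab (s T : R) : s <= T -> T < 0 ->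
  exists vm V, 0 < vm /\ forall b x y t, s <= t <= T -> vm <= v b (pt x y t) <= V.
Proof.
move=> sT T0; have [b [x [y [t [st tT H]]]]] := max_sphere (compat_opp cv) sT T0.
have [V HV] := bounded_slab cv sT T0.
exists (v b (pt x y t)), V; split.
  apply: press_gt0; first exact: p_gt0.
  by rewrite pt2; exact: le_lt_trans tT T0.
move=> b' x' y' t' /[dup] st' /andP[st1 tT1]; rewrite HV// andbT.
by have := H b' x' y' t' st1 tT1; rewrite !soppE lerN2.
Qed.

(* A cubic barrier supported where [height m > 1 - e - mu (tau - s)] pushes
   positivity of the curvature from a cap around [m] to all but the antipode. *)
Lemma barrier m (s T e : R) : unit3 m -> s < T -> T < 0 -> 0 < e < 1 ->
  (forall b x y, 1 - e < height m b (pt x y s) -> e <= K b (pt x y s)) ->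
  forall b x y, -1 + e < height m b (pt x y T) -> 0 < K b (pt x y T).
Proof.
move=> m1 sT T0 /andP[e0 e1] Hs b0 x0 y0 H0.
have [vm [V [vm0 HV]]] := press_slab (ltW sT) T0.
(* At this speed the threshold moves from [1 - e] at time [s] to [-1 + e] at time [T]. *)
pose mu : R := (2 - 2 * e) / (T - s).
have Ts : 0 < T - s by rewrite subr_gt0.
have muT : mu * (T - s) = 2 - 2 * e by rewrite /mu divfK// gt_eqF.
have mu0 : 0 < mu by rewrite divr_gt0//; lra.
pose P := 6 * vm * e ^+ 2.
have P0 : 0 < P by rewrite !mulr_gt0// ?exprn_gt0// ltr0n.
pose B := 3 * mu + 18 * V.
pose Lam := B ^+ 2 / (4 * P) + 1.
pose tau : sfun R := coord DT - scst s.
pose c : sfun R := scst (1 - e) - scst mu * tau.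
pose k : sfun R := scst e * sexpR (- scst Lam * tau).
pose h b : sfun R := height m b - c.
(* An odd power is negative where [h < 0], so that there [F <= 0] follows from [0 <= K]; the
   exponent is greater than 1 so that the Laplacian contains the positive gradient term. The
   exponential factor [k] supplies the damping [- Lam h^3]. *)
pose F b : sfun R := k * h b ^+ 3 - K b.
have ctau : compat (fun=> tau).
  by apply: compat_add; [exact: compat_time | apply: compat_opp; exact: compat_cst].
have ch : compat h.
  apply: compat_add; first exact: compat_height.
  apply: compat_opp; apply: compat_add; first exact: compat_cst.
  by apply: compat_opp; apply: compat_mul => //; exact: compat_cst.
have ck : compat (fun=> k).
  apply: compat_mul; first exact: compat_cst.
  apply: (compat_sexpR (F := fun=> - scst Lam * tau)).
  by apply: compat_mul => //; apply: compat_opp; exact: compat_cst.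
have cF : compat F.
  apply: compat_add; last by apply: compat_opp; exact: cK.
  by apply: compat_mul => //; exact: compat_exp.
have tauE x y t : t < 0 -> tau (pt x y t) = t - s.
  by move=> t0; rewrite /tau saddE soppE timeE// scstE ?pt2.
have hE b x y t : t < 0 ->
    h b (pt x y t) = height m b (pt x y t) - (1 - e - mu * (t - s)).
  move=> t0; rewrite /h (saddE (height m b)) (soppE c) /c saddE scstE ?pt2//.
  by rewrite soppE scalarE tauE.
have k_gt0 x y t : t < 0 -> 0 < k (pt x y t).
  by move=> t0; rewrite /k scalarE sexpRE ?pt2// mulr_gt0// expR_gt0.
have ks x y : k (pt x y s) = e.
  have s0 := lt_trans sT T0.
  rewrite /k scalarE sexpRE ?pt2// mulNr soppE scalarE tauE// subrr mulr0 oppr0.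
  by rewrite expR0 mulr1.
have FE b x y t : t < 0 -> F b (pt x y t) = k (pt x y t) * h b (pt x y t) ^+ 3 - K b (pt x y t).
  by move=> t0; rewrite /F (saddE (k * h b ^+ 3)) (soppE (K b)) (smulE k) sexpE ?pt2.
have Dk : (D DX k = 0) * (D DY k = 0) * (D DT k = - scst Lam * k).
  by rewrite /k /tau !(derE, D_sexpR, D_coord) /=; do !split; ring.
have Dh b i : D i (h b) = D i (height m b) + scst mu * D i (coord DT).
  by rewrite /h /c /tau (D_add i (height m b)) !(derE, D_coord); ring.
have DhT b : D DT (h b) = scst mu.
  by rewrite Dh /height !(D_den, D_X, D_Y, D_iden, @derE R) D_coord /=; ring.
have DhS b : (D DX (h b) = D DX (height m b)) * (D DY (h b) = D DY (height m b)).
  by rewrite !Dh !D_coord /= !mulr0 !addr0.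
clearbody k h.
have lapF b : conf_lap (p b) (F b) = k * (h b ^+ 2 * - (v b * height m b *+ 2) *+ 3
    + h b * (v b * (1 - height m b ^+ 2)) *+ 6) - conf_lap (p b) (K b).
  rewrite -(lap_height p m b) -gam_height// /F /conf_lap /conf_gam.
  move: (K b) => K'; rewrite !(derE, Dk, DhS).
  by move: (height m b) => hh; ring.
have DtF b : D DT (F b) = k * (scst mu * h b ^+ 2 *+ 3 - scst Lam * h b ^+ 3) - D DT (K b).
  rewrite /F; move: (K b) => K'; rewrite !(derE, Dk, DhT); ring.
have evo b : D DT (F b) - conf_lap (p b) (F b) = k * ((scst mu * h b ^+ 2 *+ 3 - scst Lam * h b ^+ 3)
    - (h b ^+ 2 * - (v b * height m b *+ 2) *+ 3
    + h b * (v b * (1 - height m b ^+ 2)) *+ 6)) - K b ^+ 2.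
  by rewrite DtF lapF (Dt_curv (@p_gt0 b) (@flow b)); ring.
have F_le0 b x y t : s <= t <= T -> F b (pt x y t) <= 0.
  have [b1 [x1 [y1 [t1 [[st1 t1T Fmax] [_ _ lapF0 DtF0]]]]]] := max_principle p_gt0 cF (ltW sT) T0.
  move=> /andP[st tT]; apply: le_trans (Fmax b x y t st tT) _.
  have t10 : t1 < 0 := le_lt_trans t1T T0.
  have [q2 q1] := height_le1 p_gt0 b1 x1 y1 m1 t10.
  have K0 : 0 <= K b1 (pt x1 y1 t1) by exact: K_ge0.
  rewrite leNgt; apply/negP => Fpos.
  have h3 : 0 < h b1 (pt x1 y1 t1) ^+ 3.
    move: Fpos; rewrite FE// subr_gt0 => /(le_lt_trans K0).
    by rewrite pmulr_rgt0// k_gt0.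
  have h0 : 0 < h b1 (pt x1 y1 t1).
    rewrite ltNge; apply/negP => h0; move: h3; rewrite ltNge => /negP; apply.
    by rewrite exprS mulr_le0_ge0// sqr_ge0.
  move: st1; rewrite le_eqVlt => /predU1P[E|lt_st1].
    subst t1; have hs := hE b1 x1 y1 s t10; rewrite subrr mulr0 subr0 in hs.
    move: Fpos; rewrite FE// ks subr_gt0 ltNge => /negP; apply.
    have h1 : h b1 (pt x1 y1 s) <= 1 by rewrite hs; lra.
    apply: le_trans (Hs b1 x1 y1 _); last by rewrite -subr_gt0 -hs.
    by rewrite ler_piMr ?(ltW e0)// exprn_ile1// ltW.
  have := congr1 (fun u : sfun R => u (pt x1 y1 t1)) (evo b1).
  have past := past_pt x1 y1 t10.
  rewrite (saddE (D DT (F b1))) soppE (saddE (k * _)) (soppE (K b1 ^+ 2)) sexpE// (smulE k).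
  rewrite (saddE (_ - _)) (saddE (scst mu * _ *+ 3)) (soppE (scst Lam * _)) (soppE (_ + _)).
  rewrite (saddE (_ *+ 3)) !snatE !scalarE !sexpE// (smulE (h b1 ^+ 2)) soppE snatE.
  rewrite (smulE (v b1)) (smulE (h b1)) (smulE (v b1)) (saddE 1) s1E// soppE !sexpE//.
  have br : -1 + e <= height m b1 (pt x1 y1 t1) - h b1 (pt x1 y1 t1) <= 1 - e.
    rewrite hE//.
    have : mu * (t1 - s) <= mu * (T - s) by rewrite ler_pM2l// lerB.
    have : 0 <= mu * (t1 - s) by rewrite mulr_ge0 ?ltW// subr_gt0.
    rewrite muT; move: (mu * _) (height _ _ _) => a q; lra.
  have HV1 : vm <= v b1 (pt x1 y1 t1) <= V by apply: HV; rewrite (ltW lt_st1).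
  have e01 : 0 < e < 1 by rewrite e0.
  have := barrier_bracket mu e01 vm0 h0 HV1 q1 q2 br.
  move=> br' E'; exact: (barrier_contra E' br' (k_gt0 x1 y1 t1 t10) (DtF0 lt_st1) lapF0).
have T00 := F_le0 b0 x0 y0 T; move: T00; rewrite (ltW sT) lexx => /(_ isT).
rewrite FE// subr_le0; apply: lt_le_trans.
rewrite mulr_gt0 ?k_gt0// exprn_gt0// hE// muT; lra.
Qed.

Lemma curv_spread b0 x0 y0 (s T : R) : s < T -> T < 0 -> 0 < K b0 (pt x0 y0 s) ->
  forall b x y, -1 < height (pole_of b0 x0 y0) b (pt x y T) -> 0 < K b (pt x y T).
Proof.
move=> sT T0 K0 b x y hT; set m := pole_of b0 x0 y0.
have s0 := lt_trans sT T0.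
have m1 : unit3 m := unit3_pole b0 x0 y0.
(* At time [s] this is negative everywhere: [height m <= 1] with equality only at the base point,
   where the curvature is positive, and [0 <= K] elsewhere. Its negative maximum bounds the
   curvature below on a whole cap. *)
pose G b : sfun R := height m b - K b - 1.
have cG : compat G.
  apply: compat_add; last by apply: compat_opp; exact: compat_cst.
  by apply: compat_add; [exact: compat_height | apply: compat_opp; exact: cK].
have GE b' x' y' : G b' (pt x' y' s) = height m b' (pt x' y' s) - K b' (pt x' y' s) - 1.
  rewrite /G (saddE (_ - _)) (saddE (height m b')) soppE soppE s1E ?pt2//.
have [b1 [x1 [y1 [t1 [st1 t1s Gmax]]]]] := max_sphere cG (lexx s) s0.
have Es : t1 = s by apply/le_anti; rewrite st1 t1s.
subst t1; have {}Gmax b' x' y' := Gmax b' x' y' s (lexx s) (lexx s).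
have G_lt0 : G b1 (pt x1 y1 s) < 0.
  rewrite GE; have K1 := K_ge0 b1 x1 y1 s0.
  have [_ h1] := height_le1 p_gt0 b1 x1 y1 m1 s0.
  rewrite lt_neqAle; apply/andP; split; last by lra.
  apply/eqP => E.
  have E1 : 1 - height m b1 (pt x1 y1 s) = 0 by lra.
  have E2 : K b1 (pt x1 y1 s) = 0 by lra.
  suff Kb x' y' : 1 - height m b0 (pt x' y' s) = 0 -> K b0 (pt x' y' s) != 0.
    case: (eqVneq b1 b0) => [Eb|nb].
      by move: E1 E2; rewrite Eb => /Kb /eqP.
    have Eb : b1 = ~~ b0 by case: (b1) (b0) nb => [] [].
    (* The centre of the other chart is the point from which the chart [b0] projects, so it cannot
       be the base point. *)
    have [r0|r0] := eqVneq (x1 ^+ 2 + y1 ^+ 2) 0.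
      move: (r0) => /eqP; rewrite paddr_eq0 ?sqr_ge0// !sqrf_eq0 => /andP[/eqP x10 /eqP y10].
      have d0 := den_neq0 x0 y0.
      have E3 : 1 - height m b1 (pt x1 y1 s) = 2 / (1 + x0 ^+ 2 + y0 ^+ 2).
        rewrite Eb height_pt// x10 y10 /m /pole_of /=.
        by case: (b0); rewrite ?expr0 ?expr1; field.
      by move: E1; rewrite E3 => /eqP; rewrite mulf_eq0 invr_eq0 (negbTE d0) pnatr_eq0.
    move: E1 E2; rewrite Eb (compat_neg b0 cK s0 r0) (compat_neg b0 (compat_height m) s0 r0).
    by move=> /Kb /eqP.
  have dd : (1 + x' ^+ 2 + y' ^+ 2) * (1 + x0 ^+ 2 + y0 ^+ 2) != 0.
    by rewrite mulf_neq0// den_neq0.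
  rewrite height_pole// => /eqP; rewrite mulf_eq0 invr_eq0 (negbTE dd) orbF.
  rewrite mulf_eq0 pnatr_eq0 /= paddr_eq0 ?sqr_ge0// !sqrf_eq0 !subr_eq0.
  by move=> /andP[/eqP -> /eqP ->]; rewrite gt_eqF.
move: G_lt0; set g := G b1 _ => G_lt0.
have Kge b' x' y' : - g - (1 - height m b' (pt x' y' s)) <= K b' (pt x' y' s).
  by have := Gmax b' x' y'; rewrite GE -/g; lra.
(* The three bounds make the curvature at least [e] on the initial cap, put the target point inside
   the final cap, and keep [e] below 1. *)
pose e := Num.min (- g / 2) (Num.min ((1 + height m b (pt x y T)) / 2) (1 / 2)).
have eg : e <= - g / 2 by rewrite ge_min lexx.
have eh : e <= (1 + height m b (pt x y T)) / 2 by rewrite !ge_min lexx orbT.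
have e12 : e <= 1 / 2 by rewrite !ge_min lexx !orbT.
have e0 : 0 < e by rewrite !lt_min; apply/and3P; split; lra.
apply: (@barrier m s T e m1 sT T0) => //; first by rewrite e0; lra.
  by move=> b' x' y' hb; apply: le_trans (Kge b' x' y'); lra.
by lra.
Qed.
End AncientFlow.

(** The equality case [<m, n> = -1] of Cauchy-Schwarz for unit vectors: with [s = 1 + x^2 + y^2] the
    sum of squares formed below is [s^2 |m + n|^2]. *)
Lemma antipode_coords (R : realType) (a b c x y : R) : a ^+ 2 + b ^+ 2 + c ^+ 2 = 1 ->
  a * (2 * x) + b * (2 * y) + c * (x ^+ 2 + y ^+ 2 - 1) = - (1 + x ^+ 2 + y ^+ 2) ->
  a * (1 + x ^+ 2 + y ^+ 2) = - (2 * x) /\ (c + 1) * (1 + x ^+ 2 + y ^+ 2) = 2.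
Proof.
move=> m1 E; set s := 1 + x ^+ 2 + y ^+ 2.
have : (a * s + 2 * x) ^+ 2 + (b * s + 2 * y) ^+ 2 + (c * s + (x ^+ 2 + y ^+ 2 - 1)) ^+ 2
    = s ^+ 2 * (a ^+ 2 + b ^+ 2 + c ^+ 2)
      + 2 * s * (a * (2 * x) + b * (2 * y) + c * (x ^+ 2 + y ^+ 2 - 1)) + s ^+ 2.
  by rewrite /s; ring.
rewrite m1 E -/s => H.
have {}H : (a * s + 2 * x) ^+ 2 + (b * s + 2 * y) ^+ 2 + (c * s + (x ^+ 2 + y ^+ 2 - 1)) ^+ 2 = 0.
  by rewrite H; ring.
move: H => /eqP; rewrite paddr_eq0 ?sqr_ge0 ?addr_ge0 ?sqr_ge0//.
rewrite paddr_eq0 ?sqr_ge0// !sqrf_eq0 => /andP[/andP[/eqP A _] /eqP C].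
by split; [lra | rewrite mulrDl mul1r; move: C; rewrite /s; lra].
Qed.

(** * Rigidity of ancient flows *)

Section AncientRigidity.
Context {R : realType} (p : bool -> sfun R).
Hypothesis p_gt0 : forall b z, z.2 < 0 -> 0 < p b z.
Hypothesis flow : forall b, D DT (p b) =
  p b * (D DX (D DX (p b)) + D DY (D DY (p b))) - D DX (p b) ^+ 2 - D DY (p b) ^+ 2.
Hypothesis conf : conformal_pair p.
Implicit Types (x y t : R) (m : R * R * R).

Local Notation K b := (curv (p b)).
Local Notation v b := (press (p b)).
Local Notation cK := (compat_curv p_gt0 flow conf).
Local Notation cv := (compat_press conf).
Local Notation K_ge0 := (curv_ge0 p_gt0 flow conf).

(** At a minimum of [w] the identity [lap w = K - 2 v] gives [K >= 2 v], so no integral over the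
    sphere is needed. *)
Lemma curv_pos_somewhere t : t < 0 -> exists b x y, 0 < K b (pt x y t).
Proof.
move=> t0; have cw := compat_opp (compat_log_press p_gt0 conf).
have [b [x [y [t1 [[st1 t1t Fmax] [_ _ l _]]]]]] := max_principle p_gt0 cw (lexx t) t0.
have Et : t1 = t by apply/le_anti; rewrite st1 t1t.
subst t1; exists b, x, y; have past := past_pt x y t0.
move: l; rewrite lapN (lap_log_press (@p_gt0 b)) soppE saddE soppE snatE.
have := press_gt0 (@p_gt0 b) past.
move: (press _ _) (curv _ _) => a c; lra.
Qed.

(** Spreading once misses only one antipode. At the intermediate time [S] either the given point or
    the point shifted by 1 in the chart has positive curvature, and as neither is antipodal to the
    given point, a second spreading reaches it. *)
Lemma curv_gt0 b z : z.2 < 0 -> 0 < K b z.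
Proof.
rewrite [z]ptE pt2; move: (z.1 0 0) (z.1 0 1) z.2 => x y T T0.
have [b0 [x0 [y0 K0]]] := curv_pos_somewhere (t := 2 * T) ltac:(lra).
pose S := 3 / 2 * T; have S0 : S < 0 by rewrite /S; lra.
have s1 : 2 * T < S by rewrite /S; lra.
have s2 : S < T by rewrite /S; lra.
have spread := curv_spread p_gt0 flow conf s1 S0 K0.
set m := pole_of b0 x0 y0.
have m1 : unit3 m := unit3_pole b0 x0 y0.
have lb x' y' : -1 <= height m b (pt x' y' S).
  have [h2 _] := height_le1 p_gt0 b x' y' m1 S0.
  have : `|height m b (pt x' y' S)| <= 1.
    by rewrite -(ler_pXn2r (n := 2)) ?nnegrE// real_normK ?num_real// expr1n -subr_ge0.
  by rewrite ler_norml => /andP[].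
have [h|h] := ltP (-1) (height m b (pt x y S)).
  have K1 := spread b x y h; apply: (curv_spread p_gt0 flow conf s2 T0 K1).
  have := height_pole b x y x y T0; rewrite !subrr expr0n /= addr0 mulr0 mul0r.
  by move: (height _ _ _) => q; lra.
have {}h : height m b (pt x y S) = -1 by apply/le_anti; rewrite h lb.
have h1 : -1 < height m b (pt (x + 1) y S).
  rewrite lt_neqAle lb andbT; apply/eqP => /esym h1.
  move: h h1 m1; rewrite !height_pt// /unit3.
  have d0 := den_neq0 x y; have d1 := den_neq0 (x + 1) y.
  have S2 : ((-1) ^+ b) ^+ 2 = 1 :> R by rewrite sqrr_sign.
  move: m.1.1 m.1.2 m.2 ((-1) ^+ b) S2 => a1 a2 a3 sg S2.
  move=> /(canRL (divfK d0)) h /(canRL (divfK d1)) h1 m1.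
  have m1' : a1 ^+ 2 + a2 ^+ 2 + (a3 * sg) ^+ 2 = 1 by rewrite exprMn S2 mulr1.
  rewrite mulN1r in h; rewrite mulN1r in h1.
  have [A C] := antipode_coords m1' h; have [A' C'] := antipode_coords m1' h1.
  have c0 : a3 * sg + 1 != 0.
    by apply/eqP => c0; move: C; rewrite c0 mul0r => /eqP; rewrite eq_sym pnatr_eq0.
  have E : 1 + x ^+ 2 + y ^+ 2 = 1 + (x + 1) ^+ 2 + y ^+ 2.
    by apply: (mulfI c0); rewrite C C'.
  by move: A; rewrite E A'; lra.
have K1 := spread b (x + 1) y h1.
apply: (curv_spread p_gt0 flow conf s2 T0 K1).
have := height_pole b (x + 1) y x y T0.
have e0 := den_gt0 x y; have e1 := den_gt0 (x + 1) y.
have -> : (x - (x + 1)) ^+ 2 + (y - y) ^+ 2 = 1 by ring.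
have ss : 1 < (1 + x ^+ 2 + y ^+ 2) * (1 + (x + 1) ^+ 2 + y ^+ 2).
  have q1 : 0 <= (x ^+ 2 + y ^+ 2) * ((x + 1) ^+ 2 + y ^+ 2).
    by rewrite mulr_ge0// addr_ge0// sqr_ge0.
  have q2 := sqr_ge0 (2 * x + 1); have q3 := sqr_ge0 y.
  lra.
move: (_ * _) ss => r r1.
have : 2 * 1 / r < 2 by rewrite mulr1 ltr_pdivrMr ?(lt_trans ltr01)// ltr_pMr.
by move: (height _ _ _) => q; lra.
Qed.

(** At a spatial critical point the gradient term of [Dt_harnack] vanishes and a Riccati inequality
    remains; the usual correction by the inverse of the elapsed time disappears on an ancient
    solution. *)
Lemma harnack_ge0 b x y t : t < 0 -> 0 <= harnack (p b) (pt x y t).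
Proof.
have cL : compat (fun b => log_curv (p b)) by apply: compat_sln cK; exact: curv_gt0.
have cH : compat (fun b => harnack (p b)) by apply: compat_add cK; exact: compat_lap.
apply: (ancient_riccati p_gt0 cH) => b' z z0 dX dY.
rewrite (Dt_harnack (@p_gt0 b') (@flow b') (@curv_gt0 b')).
rewrite (saddE (_ + _)) (saddE (_ + _)) (saddE (conf_lap _ _)) snatE gamE dX dY.
rewrite !mulr0 addr0 mulr0 mul0rn addr0 sexpE// lerDl saddE !sexpE//.
by rewrite addr_ge0 ?sqr_ge0.
Qed.

Lemma D_DT_nonneg_mono (F : sfun R) x y t T : t <= T -> T < 0 ->
  (forall t', t' < 0 -> 0 <= D DT F (pt x y t')) -> F (pt x y t) <= F (pt x y T).
Proof.
move=> tT T0 H; have [->//|nt] := eqVneq t T.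
have lt_tT : t < T by rewrite lt_neqAle nt.
have E h : h *: dvec DT + pt x y 0 = pt x y h by rewrite pt_addT addr0.
have [h|c] := @mvt_line _ F (pt x y 0) DT t T lt_tT _.
  by rewrite E pt2 in_itv => /andP[_ hT]; exact: le_lt_trans hT T0.
rewrite !E in_itv => /andP[tc cT] eq.
by rewrite -subr_ge0 eq mulr_ge0 ?subr_ge0// H// (lt_trans cT).
Qed.

Lemma press_mono b x y t T : t <= T -> T < 0 ->
  v b (pt x y t) <= v b (pt x y T).
Proof.
move=> tT T0; apply: D_DT_nonneg_mono => // t' t0.
rewrite (Dt_press (@p_gt0 b) (@flow b)) smulE mulr_ge0 ?K_ge0//.
by rewrite ltW// press_gt0 ?pt2//; exact: p_gt0.
Qed.

Lemma curv_grad2_mono b x y t T : t <= T -> T < 0 ->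
  (K b + grad2 (p b)) (pt x y t) <= (K b + grad2 (p b)) (pt x y T).
Proof.
move=> tT T0; apply: D_DT_nonneg_mono => // t' t0; have past := past_pt x y t0.
rewrite (Dt_curv_grad2 (@p_gt0 b) (@flow b) (@curv_gt0 b)) smulE mulr_ge0 ?K_ge0//.
rewrite saddE addr_ge0 ?harnack_ge0// gamE mulr_ge0 ?(ltW (p_gt0 _ _))//.
by rewrite -!expr2 addr_ge0 ?sqr_ge0.
Qed.

Lemma grad2_ge0 b z : z.2 < 0 -> 0 <= grad2 (p b) z.
Proof.
move=> z0; rewrite gamE mulr_ge0 ?(ltW (p_gt0 _ _))//.
by rewrite -!expr2 addr_ge0 ?sqr_ge0.
Qed.

Lemma backward_bounds : exists C, 0 < C /\ forall b x y t, t <= -1 ->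
  v b (pt x y t) <= C /\ grad2 (p b) (pt x y t) <= C.
Proof.
have N1 : -1 < 0 :> R by rewrite oppr_lt0.
have [C1 H1] := bounded_slab cv (lexx (-1)) N1.
have [C2 H2] := bounded_slab (compat_add cK (compat_grad2 p_gt0 conf)) (lexx (-1)) N1.
exists (Num.max 1 (Num.max C1 C2)); split; first by rewrite lt_max ltr01.
move=> b x y t t1; have t0 := le_lt_trans t1 N1.
have h1 : v b (pt x y t) <= C1.
  by apply: le_trans (press_mono b x y t1 N1) (H1 b x y (-1) _); rewrite lexx.
have h2 : (K b + grad2 (p b)) (pt x y t) <= C2.
  by apply: le_trans (curv_grad2_mono b x y t1 N1) (H2 b x y (-1) _); rewrite lexx.
have h3 : grad2 (p b) (pt x y t) <= C2.
  by apply: le_trans h2; rewrite saddE lerDr K_ge0.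
by split; rewrite !le_max ?h1 ?h3 ?orbT.
Qed.

(** By [schw1E] and [schw2E] the left side is the squared norm of a difference, at most twice the
    sum of the squared norms; the gradient part has norm [grad2]. *)
Lemma hess_schw b z : z.2 < 0 -> schw_norm (p b) z <=
  8 * (hess1 (p b) (log_press (p b)) z ^+ 2 + hess2 (p b) (log_press (p b)) z ^+ 2)
  + 2 * grad2 (p b) z ^+ 2.
Proof.
move=> z0; have p0 := @p_gt0 b.
have E : schw_norm (p b) = (p b * schw1 (p b)) ^+ 2 + (p b * schw2 (p b)) ^+ 2.
  by rewrite /schw_norm; ring.
rewrite E (schw1E p0) (schw2E p0).
set h1 := hess1 _ _; set h2 := hess2 _ _.
set wx := D DX _; set wy := D DY _.
have -> : grad2 (p b) z = p b z * (wx z ^+ 2 + wy z ^+ 2) by rewrite gamE -!expr2.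
rewrite saddE !sexpE// (saddE (h1 *+ 2)) (saddE (h2 *+ 2)) soppE soppE !snatE.
rewrite (smulE (p b)) (saddE (wx ^+ 2)) soppE !sexpE// (smulE (p b * wx)) (smulE (p b)).
move: (h1 z) (h2 z) (p b z) (wx z) (wy z) => a c q x y.
rewrite -subr_ge0.
have -> : 8 * (a ^+ 2 + c ^+ 2) + 2 * (q * (x ^+ 2 + y ^+ 2)) ^+ 2
  - ((a *+ 2 - q * (x ^+ 2 - y ^+ 2)) ^+ 2 + (c *+ 2 - q * x * y *+ 2) ^+ 2)
  = (a *+ 2 + q * (x ^+ 2 - y ^+ 2)) ^+ 2 + (c *+ 2 + q * x * y *+ 2) ^+ 2 by ring.
by rewrite addr_ge0 ?sqr_ge0.
Qed.

(** A smoothing estimate of Bernstein type on a time interval of length one. The time weight [t - s]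
    removes the unknown initial value of [schw_norm]; its derivative produces one copy of
    [schw_norm], which the Hessian squares in the evolution of [Z *+ 8] absorb through
    [hess_schw]. *)
Lemma schw_norm_bounded : exists C, forall b x y t, t <= -2 ->
  schw_norm (p b) (pt x y t) <= C.
Proof.
have [C [C0 HC]] := backward_bounds.
have cE := compat_schw_norm p_gt0 flow conf.
pose Z b := grad2 (p b) + v b *+ 4.
have cZ : compat Z := compat_add (compat_grad2 p_gt0 conf) (compat_nat 4 cv).
(* The first summand bounds [8 Z] at the initial time. The rest is the growth during a unit of time:
   [2 C^2] from [hess_schw] and [8 * 8 C^2] from the term [v ^+ 2 *+ 8]. *)
exists (8 * (C + 4 * C) + (2 * C ^+ 2 + 64 * C ^+ 2)) => b0 x0 y0 t t2.
pose s := t - 1; have t0 : t < 0 by lra.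
pose F b := (coord DT - scst s) * schw_norm (p b) + Z b *+ 8.
have cF : compat F.
  apply: compat_add; last exact: (compat_nat 8 cZ).
  apply: compat_mul => //; apply: compat_add; first exact: compat_time.
  by apply: compat_opp; exact: compat_cst.
have tauE z : z.2 < 0 -> (coord DT - scst s : sfun R) z = z.2 - s.
  by move=> z0; rewrite saddE soppE coordE// scstE.
have FE b z : z.2 < 0 -> F b z = (z.2 - s) * schw_norm (p b) z + 8 * Z b z.
  move=> z0; rewrite /F saddE snatE smulE tauE// -[_ *+ 8]mulr_natl //.
have ZE b z : Z b z = grad2 (p b) z + 4 * v b z.
  by rewrite /Z saddE snatE -[_ *+ 4]mulr_natl.
have growth b z : s <= z.2 <= t -> D DT (F b) z <= conf_lap (p b) (F b) z + (2 * C ^+ 2 + 64 * C ^+ 2).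
  move=> /andP[sz zt]; have z0 : z.2 < 0 := le_lt_trans zt t0.
  set h1 := hess1 (p b) (log_press (p b)); set h2 := hess2 (p b) (log_press (p b)).
  have evo : D DT (F b) - conf_lap (p b) (F b) = schw_norm (p b)
      - (coord DT - scst s) * (cubic_norm (p b) *+ 4 + conf_gam (p b) (K b) (K b) *+ 4)
      - ((K b - v b *+ 2) ^+ 2 + (h1 ^+ 2 + h2 ^+ 2) - v b ^+ 2 *+ 8) *+ 8.
    have EZ := Dt_grad2_press (@p_gt0 b) (@flow b); rewrite /= -/(Z b) -/h1 -/h2 in EZ.
    have EE := Dt_schw_norm (@p_gt0 b) (@flow b).
    have lapF : conf_lap (p b) (F b) = (coord DT - scst s) * conf_lap (p b) (schw_norm (p b))
        + conf_lap (p b) (Z b) *+ 8.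
      rewrite /F /conf_lap; move: (schw_norm (p b)) (Z b) => E' Z'.
      by rewrite !(derE, D_coord) /= ?derE; ring.
    have DtF : D DT (F b) = schw_norm (p b) + (coord DT - scst s) * D DT (schw_norm (p b))
        + D DT (Z b) *+ 8.
      rewrite /F; move: (schw_norm (p b)) (Z b) => E' Z'.
      by rewrite !(derE, D_coord) /=; ring.
    by rewrite DtF lapF EZ EE; ring.
  have := congr1 (fun u : sfun R => u z) evo.
  rewrite (saddE (D DT (F b))) soppE (saddE (_ - _)) (saddE (schw_norm (p b))) !soppE.
  rewrite (smulE (coord DT - scst s)) tauE// (saddE (cubic_norm _ *+ 4)) !snatE.
  rewrite (saddE (_ + _)) (saddE ((K b - v b *+ 2) ^+ 2)) soppE snatE !sexpE//.
  rewrite (saddE (h1 ^+ 2)) !sexpE// => E1.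
  have cub0 : 0 <= cubic_norm (p b) z.
    rewrite smulE mulr_ge0 ?(ltW (p_gt0 _ _))// saddE !sexpE//.
    by rewrite addr_ge0 ?sqr_ge0.
  have gam0 : 0 <= conf_gam (p b) (K b) (K b) z.
    rewrite gamE mulr_ge0 ?(ltW (p_gt0 _ _))//.
    by rewrite -!expr2 addr_ge0 ?sqr_ge0.
  have z1 : z.2 <= -1 by apply: (le_trans zt); lra.
  have [vC gC] := HC b (z.1 0 0) (z.1 0 1) z.2 z1; rewrite -ptE in vC gC.
  have v0 : 0 <= v b z by rewrite ltW// press_gt0//; exact: p_gt0.
  have g0 := grad2_ge0 b z0.
  have v2 : v b z ^+ 2 <= C ^+ 2 by rewrite ler_pXn2r// nnegrE ltW.
  have g2 : grad2 (p b) z ^+ 2 <= C ^+ 2 by rewrite ler_pXn2r// nnegrE ltW.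
  have := hess_schw b z0; rewrite -/h1 -/h2.
  have tau0 : 0 <= (z.2 - s) * (cubic_norm (p b) z *+ 4 + conf_gam (p b) (K b) (K b) z *+ 4).
    by rewrite mulr_ge0 ?subr_ge0// addr_ge0 ?mulrn_wge0.
  have K2 := sqr_ge0 ((K b - v b *+ 2) z).
  move: E1 tau0 K2 v2 g2.
  move: (D DT (F b) z) (conf_lap _ (F b) z) (schw_norm _ z) (_ * (_ *+ 4 + _ *+ 4)) ((K b - v b *+ 2) z ^+ 2)
    (h1 z ^+ 2) (h2 z ^+ 2) (v b z ^+ 2) (grad2 _ z ^+ 2) (C ^+ 2) => a1 a2 a3 a4 a5 a6 a7 a8 a9 a10.
  clear; lra.
have init b x y : F b (pt x y s) <= 8 * (C + 4 * C).
  have s0 : s < 0 by rewrite /s; lra.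
  have [vC gC] := HC b x y s ltac:(rewrite /s; lra).
  rewrite FE ?pt2// subrr mul0r add0r ZE; lra.
have st : s <= t by rewrite /s; lra.
have := max_growth p_gt0 cF st t0 growth init b0 x0 y0 (t := t).
rewrite st lexx => /(_ isT); rewrite FE ?pt2//.
have -> : t - s = 1 by rewrite /s; ring.
have [v1 g1] := HC b0 x0 y0 t ltac:(lra).
have : 0 <= Z b0 (pt x0 y0 t).
  by rewrite ZE addr_ge0 ?grad2_ge0 ?mulr_ge0 ?(ltW (press_gt0 _ _)) ?pt2//; exact: p_gt0.
rewrite mul1r mulr1; move: (Z b0 _) (schw_norm _ _) => z e; lra.
Qed.

Lemma cubic_norm_ge0 b z : z.2 < 0 -> 0 <= cubic_norm (p b) z.
Proof.
move=> z0; rewrite smulE mulr_ge0 ?(ltW (p_gt0 _ _))// saddE !sexpE//.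
by rewrite addr_ge0 ?sqr_ge0.
Qed.

Lemma schw_norm_ge0 b z : z.2 < 0 -> 0 <= schw_norm (p b) z.
Proof.
move=> z0; rewrite smulE sexpE// saddE !sexpE//.
by rewrite mulr_ge0 ?addr_ge0 ?sqr_ge0.
Qed.

Lemma cubic_norm_decay C b0 x0 y0 t s : s <= -2 -> s <= t -> t < 0 ->
  (forall b x y t, t <= -2 -> schw_norm (p b) (pt x y t) <= C) ->
  (t - s) * (cubic_norm (p b0) (pt x0 y0 t) *+ 4) <= C.
Proof.
move=> s2 st t0 HC; have s0 : s < 0 by lra.
have cE := compat_schw_norm p_gt0 flow conf.
have cQ := compat_cubic_norm p_gt0 flow conf.
pose F b := (coord DT - scst s) * (cubic_norm (p b) *+ 4) + schw_norm (p b).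
have cF : compat F.
  apply: compat_add => //; apply: compat_mul; last exact: (compat_nat 4 cQ).
  apply: compat_add; first exact: compat_time.
  by apply: compat_opp; exact: compat_cst.
have tauE z : z.2 < 0 -> (coord DT - scst s : sfun R) z = z.2 - s.
  by move=> z0; rewrite saddE soppE coordE// scstE.
have FE b z : z.2 < 0 ->
    F b z = (z.2 - s) * (cubic_norm (p b) z *+ 4) + schw_norm (p b) z.
  by move=> z0; rewrite /F saddE (smulE (coord DT - scst s)) snatE tauE.
have growth b z : s <= z.2 <= t -> D DT (F b) z <= conf_lap (p b) (F b) z + 0.
  move=> /andP[sz zt]; have z0 : z.2 < 0 := le_lt_trans zt t0.
  have EE := Dt_schw_norm (@p_gt0 b) (@flow b).
  have EQ := Dt_cubic_norm (@p_gt0 b) (@flow b).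
  set s1 := (X in _ = _ - _ - X ^+ 2 - _ - _ - _) in EQ.
  set s2' := (X in _ = _ - _ - _ - X ^+ 2 - _ - _) in EQ.
  set s3 := (X in _ = _ - _ - _ - _ - X ^+ 2 - _) in EQ.
  set s4 := (X in _ = _ - _ - _ - _ - _ - X ^+ 2) in EQ.
  have evo : D DT (F b) - conf_lap (p b) (F b) = - (conf_gam (p b) (K b) (K b) *+ 4)
      - (coord DT - scst s) * (K b * cubic_norm (p b) *+ 4
        + (s1 ^+ 2 + s2' ^+ 2 + s3 ^+ 2 + s4 ^+ 2)) *+ 4.
    clearbody s1 s2' s3 s4.
    have lapF : conf_lap (p b) (F b) = (coord DT - scst s) * conf_lap (p b) (cubic_norm (p b)) *+ 4
        + conf_lap (p b) (schw_norm (p b)).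
      rewrite /F /conf_lap; move: (schw_norm (p b)) (cubic_norm (p b)) => E' Z'.
      by rewrite !(derE, D_coord) /= ?derE; ring.
    have DtF : D DT (F b) = cubic_norm (p b) *+ 4
        + (coord DT - scst s) * D DT (cubic_norm (p b)) *+ 4 + D DT (schw_norm (p b)).
      rewrite /F; move: (schw_norm (p b)) (cubic_norm (p b)) => E' Z'.
      by rewrite !(derE, D_coord) /=; ring.
    by rewrite DtF lapF EE EQ; ring.
  have := congr1 (fun u : sfun R => u z) evo.
  rewrite (saddE (D DT (F b))) soppE (saddE (- _)) soppE soppE !snatE.
  rewrite (smulE (coord DT - scst s)) tauE// (saddE (K b * _ *+ 4)) snatE (smulE (K b)).
  rewrite (saddE (s1 ^+ 2 + s2' ^+ 2 + s3 ^+ 2)) (saddE (s1 ^+ 2 + s2' ^+ 2)) (saddE (s1 ^+ 2)) !sexpE// => E1.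
  have gam0 : 0 <= conf_gam (p b) (K b) (K b) z.
    rewrite gamE mulr_ge0 ?(ltW (p_gt0 _ _))//.
    by rewrite -!expr2 addr_ge0 ?sqr_ge0.
  have : 0 <= (z.2 - s) * (K b z * cubic_norm (p b) z *+ 4
        + (s1 z ^+ 2 + s2' z ^+ 2 + s3 z ^+ 2 + s4 z ^+ 2)).
    have K0 : 0 <= K b z by rewrite ltW// curv_gt0.
    by rewrite mulr_ge0 ?subr_ge0// addr_ge0 ?mulrn_wge0 ?mulr_ge0 ?cubic_norm_ge0// !addr_ge0 ?sqr_ge0.
  move: E1; rewrite addr0; move: (D DT (F b) z) (conf_lap _ (F b) z) (_ * _) => a1 a2 a3.
  by lra.
have init b x y : F b (pt x y s) <= C.
  by rewrite FE ?pt2// subrr mul0r add0r; exact: HC.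
have := max_growth p_gt0 cF st t0 growth init b0 x0 y0 (t := t).
rewrite st lexx => /(_ isT); rewrite FE ?pt2// mul0r addr0; apply: le_trans.
by rewrite lerDl schw_norm_ge0// pt2.
Qed.

Lemma cubic_norm_eq0 b : cubic_norm (p b) = 0.
Proof.
apply: sfun_eq => z; rewrite [z]ptE pt2 s0E; move: (z.1 0 0) (z.1 0 1) z.2 => x y t t0.
apply/le_anti; rewrite cubic_norm_ge0 ?pt2// andbT.
have [C HC] := schw_norm_bounded.
rewrite leNgt; apply/negP => q0.
set q := cubic_norm _ _ in q0.
have C0 : 0 <= C by apply: le_trans (HC b x y (-2) (lexx _)); rewrite schw_norm_ge0// pt2 oppr_lt0.
(* So early a start makes the left side of the decay estimate [8 q + 4 (C + 1)], larger than [C]. *)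
pose s := t - 2 - (C + 1) / q.
have Cq : 0 < (C + 1) / q by rewrite divr_gt0//; lra.
have := @cubic_norm_decay C b x y t s ltac:(rewrite /s; lra) ltac:(rewrite /s; lra) t0 HC.
rewrite -/q /s; have -> : t - (t - 2 - (C + 1) / q) = 2 + (C + 1) / q by ring.
have E : (C + 1) / q * q = C + 1 by rewrite divfK// gt_eqF.
have -> : (2 + (C + 1) / q) * (q *+ 4) = 8 * q + 4 * ((C + 1) / q * q) by ring.
rewrite E; lra.
Qed.

Lemma cubic_eq0 b : cubic1 (p b) = 0 /\ cubic2 (p b) = 0.
Proof.
have E := cubic_norm_eq0 b.
suff H z : z.2 < 0 -> cubic1 (p b) z = 0 /\ cubic2 (p b) z = 0.
  by split; apply: sfun_eq => z z0; have [? ?] := H z z0; rewrite s0E.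
move=> z0; have := congr1 (fun u : sfun R => u z) E.
rewrite smulE s0E saddE !sexpE// => /eqP.
rewrite mulf_eq0 gt_eqF ?p_gt0//= paddr_eq0 ?sqr_ge0// !sqrf_eq0.
by move=> /andP[/eqP ? /eqP ?].
Qed.
End AncientRigidity.

(** * Pressures that are quadratic on the sphere *)

Section PolynomialForm.
Context {R : realType}.
Implicit Types (F g : sfun R) (x y t : R).
Local Notation X := (coord DX : sfun R).
Local Notation Y := (coord DY : sfun R).

Definition flat g : Prop := D DX g = 0 /\ D DY g = 0.

Lemma flat_pt g x y t : flat g -> t < 0 -> g (pt x y t) = g (pt 0 0 t).
Proof.
move=> [gX gY] t0.
have -> : pt x y t = x *: dvec DX + pt 0 y t by rewrite pt_addX addr0.
rewrite (line_const (i := DX))// ?pt2//.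
have -> : pt 0 y t = y *: dvec DY + pt 0 0 t by rewrite pt_addY addr0.
by rewrite (line_const (i := DY))// pt2.
Qed.

Lemma flatD g h : flat g -> flat h -> flat (g + h).
Proof. by move=> [a b] [c d]; split; rewrite D_add ?a ?b ?c ?d addr0. Qed.
Lemma flatN g : flat g -> flat (- g).
Proof. by move=> [a b]; split; rewrite D_opp ?a ?b oppr0. Qed.
Lemma flatM g h : flat g -> flat h -> flat (g * h).
Proof. by move=> [a b] [c d]; split; rewrite D_mul ?a ?b ?c ?d mul0r mulr0 addr0. Qed.
Lemma flat_nat g n : flat g -> flat (g *+ n).
Proof. by move=> [a b]; split; rewrite D_nat ?a ?b mul0rn. Qed.
Lemma flat_cst c : flat (scst c). Proof. by split; rewrite D_cst. Qed.
Lemma flat_DT g : flat g -> flat (D DT g).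
Proof. by move=> [a b]; split; rewrite -D_comm ?a ?b D_0. Qed.

Lemma natmul_eq0 g n : g *+ n.+1 = 0 -> g = 0.
Proof.
move=> gn; apply: sfun_eq => z z0; have := congr1 (fun u : sfun R => u z) gn.
by rewrite snatE s0E => /eqP; rewrite mulrn_eq0 /= => /eqP.
Qed.

(* Four times the pressure in stereographic coordinates of the function
   [tr a - n . a n + 2 b . n] of the point [n] of the sphere. *)
Definition quad_press (a11 a22 a33 a12 a13 a23 b1 b2 b3 : sfun R) : sfun R :=
  let r2 := X ^+ 2 + Y ^+ 2 in
  (a22 + a33) * X ^+ 2 *+ 4 + (a11 + a33) * Y ^+ 2 *+ 4 + (a11 + a22) * (r2 - 1) ^+ 2
  - a12 * X * Y *+ 8 - a13 * X * (r2 - 1) *+ 4 - a23 * Y * (r2 - 1) *+ 4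
  + b1 * X * (r2 + 1) *+ 4 + b2 * Y * (r2 + 1) *+ 4 + b3 * (r2 ^+ 2 - 1) *+ 2.

Section Cubic.
Context (p : sfun R).
Hypothesis c1 : cubic1 p = 0.
Hypothesis c2 : cubic2 p = 0.

Lemma pxxx : D DX (D DX (D DX p)) = D DX (D DY (D DY p)) *+ 3.
Proof. by apply/eqP; rewrite -subr_eq0; apply/eqP. Qed.
Lemma pyyy : D DY (D DY (D DY p)) = D DX (D DX (D DY p)) *+ 3.
Proof. by apply/esym/eqP; rewrite -subr_eq0; apply/eqP. Qed.

(** Differentiating the two relations gives [p_xxxy = 3 p_xyyy] and [p_xyyy = 3 p_xxxy]. *)
Lemma pxyyy : D DX (D DY (D DY (D DY p))) = 0.
Proof.
have E1 := congr1 (D DY) pxxx; have E2 := congr1 (D DX) pyyy.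
rewrite !(D_nat, commE) in E1 E2; rewrite E1 in E2.
apply: (@natmul_eq0 _ 7).
have -> : D DX (D DY (D DY (D DY p))) *+ 8 =
  D DX (D DY (D DY (D DY p))) *+ 3 *+ 3 - D DX (D DY (D DY (D DY p))) by ring.
by rewrite -E2 subrr.
Qed.

Lemma pxxxy : D DX (D DX (D DX (D DY p))) = 0.
Proof.
have := congr1 (D DY) pxxx; rewrite !(D_nat, commE) => ->.
by rewrite pxyyy mul0rn.
Qed.

(* The coefficients of the quartic [p *+ 8], peeled off from the top degree down;
   [locked] keeps the derivation rules from matching inside them. *)
Definition qA := locked (D DX (D DX (D DY (D DY p)))).
Definition qB1 := locked (D DX (D DY (D DY p)) - qA * X).
Definition qB2 := locked (D DX (D DX (D DY p)) - qA * Y).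
Definition qC0 := locked (D DX (D DX p) + D DY (D DY p) - qA * (X ^+ 2 + Y ^+ 2) *+ 2
  - qB1 * X *+ 4 - qB2 * Y *+ 4).
Definition qC1 := locked (D DX (D DX p) - D DY (D DY p) - qA * (X ^+ 2 - Y ^+ 2)
  - qB1 * X *+ 2 + qB2 * Y *+ 2).
Definition qC2 := locked (D DX (D DY p) - qA * X * Y - qB1 * Y - qB2 * X).
Definition qE1 := locked (D DX p *+ 8 - (qA * X * (X ^+ 2 + Y ^+ 2) *+ 4
  + qB1 * (X ^+ 2 *+ 3 + Y ^+ 2) *+ 4 + qB2 * X * Y *+ 8 + qC0 * X *+ 4
  + qC1 * X *+ 4 + qC2 * Y *+ 8)).
Definition qE2 := locked (D DY p *+ 8 - (qA * Y * (X ^+ 2 + Y ^+ 2) *+ 4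
  + qB1 * X * Y *+ 8 + qB2 * (X ^+ 2 + Y ^+ 2 *+ 3) *+ 4 + qC0 * Y *+ 4
  - qC1 * Y *+ 4 + qC2 * X *+ 8)).
Definition qE0 := locked (p *+ 8 - (qA * (X ^+ 2 + Y ^+ 2) ^+ 2
  + qB1 * X * (X ^+ 2 + Y ^+ 2) *+ 4 + qB2 * Y * (X ^+ 2 + Y ^+ 2) *+ 4
  + qC0 * (X ^+ 2 + Y ^+ 2) *+ 2 + qC1 * (X ^+ 2 - Y ^+ 2) *+ 2 + qC2 * X * Y *+ 8
  + qE1 * X + qE2 * Y)).

Lemma D_XY : ((D DX X = 1) * (D DY X = 0)) * ((D DX Y = 0) * (D DY Y = 1)).
Proof. by rewrite !D_coord. Qed.

Lemma flat_qA : flat qA.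
Proof.
split; rewrite /qA -!lock.
  by have := congr1 (D DY) pxxxy; rewrite D_0 !commE.
by rewrite !commE pxyyy D_0.
Qed.

Lemma flat_qB1 : flat qB1.
Proof.
have [a1 a2] := flat_qA; rewrite /qB1 -!lock; split.
  by rewrite !(D_add, D_opp, D_mul) a1 !D_XY /qA -!lock; ring.
by rewrite !(D_add, D_opp, D_mul) a2 !D_XY !commE pxyyy; ring.
Qed.

Lemma flat_qB2 : flat qB2.
Proof.
have [a1 a2] := flat_qA; rewrite /qB2 -!lock; split.
  by rewrite !(D_add, D_opp, D_mul) a1 !D_XY pxxxy; ring.
by rewrite !(D_add, D_opp, D_mul) a2 !D_XY !commE /qA -!lock; ring.
Qed.

Lemma flat_qC0 : flat qC0.
Proof.
have [a1 a2] := flat_qA; have [b1 b2] := flat_qB1; have [b3 b4] := flat_qB2.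
rewrite /qC0 -!lock; split.
  rewrite !(D_nat, D_exp, D_mul, D_opp, D_add) a1 b1 b3 !D_XY pxxx.
  by rewrite /qB1 -!lock; ring.
rewrite !(D_nat, D_exp, D_mul, D_opp, D_add) a2 b2 b4 !D_XY !commE pyyy.
by rewrite /qB2 -!lock; ring.
Qed.

Lemma flat_qC1 : flat qC1.
Proof.
have [a1 a2] := flat_qA; have [b1 b2] := flat_qB1; have [b3 b4] := flat_qB2.
rewrite /qC1 -!lock; split.
  rewrite !(D_nat, D_exp, D_mul, D_opp, D_add) a1 b1 b3 !D_XY pxxx.
  by rewrite /qB1 -!lock; ring.
rewrite !(D_nat, D_exp, D_mul, D_opp, D_add) a2 b2 b4 !D_XY !commE pyyy.
by rewrite /qB2 -!lock; ring.
Qed.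

Lemma flat_qC2 : flat qC2.
Proof.
have [a1 a2] := flat_qA; have [b1 b2] := flat_qB1; have [b3 b4] := flat_qB2.
rewrite /qC2 -!lock; split.
  rewrite !(D_nat, D_exp, D_mul, D_opp, D_add) a1 b1 b3 !D_XY.
  by rewrite /qB2 -!lock; ring.
rewrite !(D_nat, D_exp, D_mul, D_opp, D_add) a2 b2 b4 !D_XY !commE.
by rewrite /qB1 -!lock; ring.
Qed.

Lemma flat_qE1 : flat qE1.
Proof.
have [a1 a2] := flat_qA; have [b1 b2] := flat_qB1; have [b3 b4] := flat_qB2.
have [d1 d2] := flat_qC0; have [e1 e2] := flat_qC1; have [f1 f2] := flat_qC2.
rewrite /qE1 -!lock; split.
  rewrite !(D_nat, D_exp, D_mul, D_opp, D_add) a1 b1 b3 d1 e1 f1 !D_XY.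
  by rewrite /qC0 /qC1 -!lock; ring.
rewrite !(D_nat, D_exp, D_mul, D_opp, D_add) a2 b2 b4 d2 e2 f2 !D_XY !commE.
by rewrite /qC2 -!lock; ring.
Qed.

Lemma flat_qE2 : flat qE2.
Proof.
have [a1 a2] := flat_qA; have [b1 b2] := flat_qB1; have [b3 b4] := flat_qB2.
have [d1 d2] := flat_qC0; have [e1 e2] := flat_qC1; have [f1 f2] := flat_qC2.
rewrite /qE2 -!lock; split.
  rewrite !(D_nat, D_exp, D_mul, D_opp, D_add) a1 b1 b3 d1 e1 f1 !D_XY.
  by rewrite /qC2 -!lock; ring.
rewrite !(D_nat, D_exp, D_mul, D_opp, D_add) a2 b2 b4 d2 e2 f2 !D_XY.
by rewrite /qC0 /qC1 -!lock; ring.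
Qed.

Lemma flat_qE0 : flat qE0.
Proof.
have [a1 a2] := flat_qA; have [b1 b2] := flat_qB1; have [b3 b4] := flat_qB2.
have [d1 d2] := flat_qC0; have [e1 e2] := flat_qC1; have [f1 f2] := flat_qC2.
have [g1 g2] := flat_qE1; have [h1 h2] := flat_qE2.
rewrite /qE0 -!lock; split.
  rewrite !(D_nat, D_exp, D_mul, D_opp, D_add) a1 b1 b3 d1 e1 f1 g1 h1 !D_XY.
  by rewrite /qE1 -!lock; ring.
rewrite !(D_nat, D_exp, D_mul, D_opp, D_add) a2 b2 b4 d2 e2 f2 g2 h2 !D_XY.
by rewrite /qE2 -!lock; ring.
Qed.

(** A real [p] with [p_zzz = 0] has degree at most two in [z] and in its conjugate. This leaves nine
    real coefficients, the dimension of the space of quadratic functions on the sphere; the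
    witnesses solve the linear system between the two bases. *)
Lemma quad_press_form : exists a11 a22 a33 a12 a13 a23 b1 b2 b3 : sfun R,
  [/\ flat a11, flat a22 & flat a33] /\ [/\ flat a12, flat a13 & flat a23] /\
  [/\ flat b1, flat b2 & flat b3] /\
  p *+ 4 = quad_press a11 a22 a33 a12 a13 a23 b1 b2 b3.
Proof.
have fA := flat_qA; have fB1 := flat_qB1; have fB2 := flat_qB2.
have fC0 := flat_qC0; have fC1 := flat_qC1; have fC2 := flat_qC2.
have fE1 := flat_qE1; have fE2 := flat_qE2; have fE0 := flat_qE0.
pose e : sfun R := scst (1 / 16).
have fe : flat e := flat_cst _.
have e16 : e *+ 16 = 1.
  apply: sfun_eq => z z0; rewrite snatE s1E// /e scstE//.
  by rewrite -[_ *+ 16]mulr_natr mul1r mulVf// pnatr_eq0.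
exists (e * (qA + qE0 - qC1 *+ 2) *+ 2), (e * (qA + qE0 + qC1 *+ 2) *+ 2),
  (e * qC0 *+ 4), (- (e * qC2 *+ 8)), (e * (qE1 - qB1 *+ 4)), (e * (qE2 - qB2 *+ 4)),
  (e * (qE1 + qB1 *+ 4)), (e * (qE2 + qB2 *+ 4)), (e * (qA - qE0) *+ 2).
split; first by split; do ?[apply: flat_nat|apply: flatM|apply: flatD|apply: flatN].
split; first by split; do ?[apply: flat_nat|apply: flatM|apply: flatD|apply: flatN].
split; first by split; do ?[apply: flat_nat|apply: flatM|apply: flatD|apply: flatN].
have -> : p *+ 4 = (e *+ 16) * p *+ 4 by rewrite e16 mul1r.
by rewrite /quad_press /qE0 -!lock; ring.
Qed.
End Cubic.

Lemma DT_quad_press a11 a22 a33 a12 a13 a23 b1 b2 b3 :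
  D DT (quad_press a11 a22 a33 a12 a13 a23 b1 b2 b3) =
  quad_press (D DT a11) (D DT a22) (D DT a33) (D DT a12) (D DT a13) (D DT a23)
    (D DT b1) (D DT b2) (D DT b3).
Proof. by rewrite /quad_press !derE !D_coord /=; ring. Qed.

Lemma quad_press_pt a11 a22 a33 a12 a13 a23 b1 b2 b3 x y t :
  [/\ flat a11, flat a22 & flat a33] -> [/\ flat a12, flat a13 & flat a23] ->
  [/\ flat b1, flat b2 & flat b3] -> t < 0 ->
  let ev (g : sfun R) := g (pt 0 0 t) in
  quad_press a11 a22 a33 a12 a13 a23 b1 b2 b3 (pt x y t) =
  (ev a22 + ev a33) * x ^+ 2 * 4 + (ev a11 + ev a33) * y ^+ 2 * 4
  + (ev a11 + ev a22) * (x ^+ 2 + y ^+ 2 - 1) ^+ 2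
  - ev a12 * x * y * 8 - ev a13 * x * (x ^+ 2 + y ^+ 2 - 1) * 4
  - ev a23 * y * (x ^+ 2 + y ^+ 2 - 1) * 4
  + ev b1 * x * (x ^+ 2 + y ^+ 2 + 1) * 4 + ev b2 * y * (x ^+ 2 + y ^+ 2 + 1) * 4
  + ev b3 * ((x ^+ 2 + y ^+ 2) ^+ 2 - 1) * 2.
Proof.
move=> [f1 f2 f3] [f4 f5 f6] [f7 f8 f9] t0 ev; have past := past_pt x y t0.
have E1 : (1 : sfun R) (pt x y t) = 1 by rewrite s1E.
rewrite /quad_press 8!saddE 3!soppE !snatE.
rewrite (smulE (a22 + a33)) (smulE (a11 + a33)) (smulE (a11 + a22)) (smulE (a12 * X)) (smulE a12).
rewrite (smulE (a13 * X)) (smulE a13) (smulE (a23 * Y)) (smulE a23) (smulE (b1 * X)) (smulE b1).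
rewrite (smulE (b2 * Y)) (smulE b2) (smulE b3) (saddE a22) (saddE a11) (saddE a11).
have Er : (X ^+ 2 + Y ^+ 2) (pt x y t) = x ^+ 2 + y ^+ 2.
  by rewrite (saddE (X ^+ 2)) !sexpE// !coord_pt.
have EN : (- 1 : sfun R) (pt x y t) = -1 by rewrite soppE E1.
rewrite !sexpE// (saddE (X ^+ 2 + Y ^+ 2) (- 1)) (saddE (X ^+ 2 + Y ^+ 2) 1).
rewrite (saddE ((X ^+ 2 + Y ^+ 2) ^+ 2) (- 1)) sexpE// !Er !E1 !EN !coord_pt//.
rewrite !(fun g f => @flat_pt g x y t f t0) //.
rewrite -/(ev a11) -/(ev a22) -/(ev a33) -/(ev a12) -/(ev a13) -/(ev a23) -/(ev b1) -/(ev b2) -/(ev b3).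
ring.
Qed.

(** The nine coefficients are determined by the values at ten sample points of the chart. This
    permits comparison of coefficients. *)
Lemma quad_press_eq0 a11 a22 a33 a12 a13 a23 b1 b2 b3 :
  [/\ flat a11, flat a22 & flat a33] -> [/\ flat a12, flat a13 & flat a23] ->
  [/\ flat b1, flat b2 & flat b3] ->
  quad_press a11 a22 a33 a12 a13 a23 b1 b2 b3 = 0 ->
  [/\ a11 = 0, a22 = 0 & a33 = 0] /\ [/\ a12 = 0, a13 = 0 & a23 = 0] /\
  [/\ b1 = 0, b2 = 0 & b3 = 0].
Proof.
move=> fa fb fc E.
suff H t : t < 0 -> [/\ a11 (pt 0 0 t) = 0, a22 (pt 0 0 t) = 0 & a33 (pt 0 0 t) = 0] /\
  [/\ a12 (pt 0 0 t) = 0, a13 (pt 0 0 t) = 0 & a23 (pt 0 0 t) = 0] /\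
  [/\ b1 (pt 0 0 t) = 0, b2 (pt 0 0 t) = 0 & b3 (pt 0 0 t) = 0].
  have [f1 f2 f3] := fa; have [f4 f5 f6] := fb; have [f7 f8 f9] := fc.
  have Z (g : sfun R) : flat g -> (forall t, t < 0 -> g (pt 0 0 t) = 0) -> g = 0.
    move=> fg g0; apply: sfun_eq => z; rewrite [z]ptE pt2 s0E => z0.
    by rewrite (flat_pt _ _ fg z0) g0.
  by split; [split|split; split]; apply: Z => // t /H [[? ? ?] [[? ? ?] [? ? ?]]].
move=> t0; have ev x y := quad_press_pt x y fa fb fc t0.
have e1 := ev 0 0; have e2 := ev 1 0; have e3 := ev (-1) 0; have e4 := ev 0 1.
have e5 := ev 0 (-1); have e6 := ev 1 1; have e7 := ev 2 0; have e8 := ev 0 2.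
have e9 := ev (-2) 0; have e10 := ev (-1) 1.
move: e1 e2 e3 e4 e5 e6 e7 e8 e9 e10 => /=; rewrite E !s0E; clear.
move: (a11 _) (a22 _) (a33 _) (a12 _) (a13 _) (a23 _) (b1 _) (b2 _) (b3 _).
move=> u1 u2 u3 u4 u5 u6 u7 u8 u9 e1 e2 e3 e4 e5 e6 e7 e8 e9 e10.
by split; [split|split; split]; lra.
Qed.

(** The right side of the flow, quadratic in [p], stays in the same nine-dimensional space, so the
    partial differential equation becomes a system for the coefficients. *)
Lemma quad_press_flow p a11 a22 a33 a12 a13 a23 b1 b2 b3 :
  [/\ flat a11, flat a22 & flat a33] -> [/\ flat a12, flat a13 & flat a23] ->
  [/\ flat b1, flat b2 & flat b3] ->
  p *+ 4 = quad_press a11 a22 a33 a12 a13 a23 b1 b2 b3 ->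
  D DT p = p * (D DX (D DX p) + D DY (D DY p)) - D DX p ^+ 2 - D DY p ^+ 2 ->
  [/\ D DT a11 = (a22 * a33 - a23 ^+ 2 - b1 ^+ 2) *+ 4,
      D DT a22 = (a11 * a33 - a13 ^+ 2 - b2 ^+ 2) *+ 4 &
      D DT a33 = (a11 * a22 - a12 ^+ 2 - b3 ^+ 2) *+ 4] /\
  [/\ D DT a12 = (a13 * a23 - a12 * a33 - b1 * b2) *+ 4,
      D DT a13 = (a12 * a23 - a13 * a22 - b1 * b3) *+ 4 &
      D DT a23 = (a12 * a13 - a11 * a23 - b2 * b3) *+ 4] /\
  [/\ D DT b1 = (a11 * b1 + a12 * b2 + a13 * b3) *+ 4,
      D DT b2 = (a12 * b1 + a22 * b2 + a23 * b3) *+ 4 &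
      D DT b3 = (a13 * b1 + a23 * b2 + a33 * b3) *+ 4].
Proof.
move=> fa fb fc E flow.
have [[f1 f1'] [f2 f2'] [f3 f3']] := fa; have [[f4 f4'] [f5 f5'] [f6 f6']] := fb.
have [[f7 f7'] [f8 f8'] [f9 f9']] := fc.
pose P := quad_press a11 a22 a33 a12 a13 a23 b1 b2 b3.
have EP : D DT P *+ 4 = P * (D DX (D DX P) + D DY (D DY P)) - D DX P ^+ 2 - D DY P ^+ 2.
  by rewrite /P -E !D_nat flow; ring.
rewrite /P DT_quad_press in EP.
have EQ : P * (D DX (D DX P) + D DY (D DY P)) - D DX P ^+ 2 - D DY P ^+ 2 =
  quad_press ((a22 * a33 - a23 ^+ 2 - b1 ^+ 2) *+ 4) ((a11 * a33 - a13 ^+ 2 - b2 ^+ 2) *+ 4)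
    ((a11 * a22 - a12 ^+ 2 - b3 ^+ 2) *+ 4) ((a13 * a23 - a12 * a33 - b1 * b2) *+ 4)
    ((a12 * a23 - a13 * a22 - b1 * b3) *+ 4) ((a12 * a13 - a11 * a23 - b2 * b3) *+ 4)
    ((a11 * b1 + a12 * b2 + a13 * b3) *+ 4) ((a12 * b1 + a22 * b2 + a23 * b3) *+ 4)
    ((a13 * b1 + a23 * b2 + a33 * b3) *+ 4) *+ 4.
  have D1X : (D DX X = 1 :> sfun R) * (D DY X = 0 :> sfun R) by rewrite !D_coord.
  have D1Y : (D DX Y = 0 :> sfun R) * (D DY Y = 1 :> sfun R) by rewrite !D_coord.
  pose q := X ^+ 2 + Y ^+ 2.
  have dq : (D DX q = X *+ 2) * (D DY q = Y *+ 2).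
    by rewrite /q !D_add !D_exp !D1X !D1Y; split; ring.
  have EX : D DX P = (a22 + a33) * X *+ 8 + (a11 + a22) * (q - 1) * X *+ 4 - a12 * Y *+ 8
      - a13 * (q - 1 + X * X *+ 2) *+ 4 - a23 * Y * X *+ 8
      + b1 * (q + 1 + X * X *+ 2) *+ 4 + b2 * Y * X *+ 8 + b3 * q * X *+ 8.
    rewrite /P /quad_press -/q; clearbody q.
    rewrite !(D_nat, D_exp, D_mul, D_opp, D_add, D_0, D_1, f1, f2, f3, f4, f5, f6, f7, f8, f9, D1X, D1Y, dq,
      mul0r, mulr0, add0r, addr0, mul0rn, oppr0); ring.
  have EY : D DY P = (a11 + a33) * Y *+ 8 + (a11 + a22) * (q - 1) * Y *+ 4 - a12 * X *+ 8
      - a13 * X * Y *+ 8 - a23 * (q - 1 + Y * Y *+ 2) *+ 4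
      + b1 * X * Y *+ 8 + b2 * (q + 1 + Y * Y *+ 2) *+ 4 + b3 * q * Y *+ 8.
    rewrite /P /quad_press -/q; clearbody q.
    rewrite !(D_nat, D_exp, D_mul, D_opp, D_add, D_0, D_1, f1', f2', f3', f4', f5', f6', f7', f8', f9', D1X, D1Y, dq,
      mul0r, mulr0, add0r, addr0, mul0rn, oppr0); ring.
  have EXX : D DX (D DX P) = (a22 + a33) *+ 8 + (a11 + a22) * (q - 1 + X * X *+ 2) *+ 4
      - a13 * X *+ 24 - a23 * Y *+ 8 + b1 * X *+ 24 + b2 * Y *+ 8 + b3 * (q + X * X *+ 2) *+ 8.
    rewrite EX; clear -dq D1X D1Y f1 f2 f3 f4 f5 f6 f7 f8 f9; clearbody q.
    rewrite !(D_nat, D_exp, D_mul, D_opp, D_add, D_0, D_1, f1, f2, f3, f4, f5, f6, f7, f8, f9, D1X, D1Y, dq,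
      mul0r, mulr0, add0r, addr0, mul0rn, oppr0); ring.
  have EYY : D DY (D DY P) = (a11 + a33) *+ 8 + (a11 + a22) * (q - 1 + Y * Y *+ 2) *+ 4
      - a13 * X *+ 8 - a23 * Y *+ 24 + b1 * X *+ 8 + b2 * Y *+ 24 + b3 * (q + Y * Y *+ 2) *+ 8.
    rewrite EY; clear -dq D1X D1Y f1' f2' f3' f4' f5' f6' f7' f8' f9'; clearbody q.
    rewrite !(D_nat, D_exp, D_mul, D_opp, D_add, D_0, D_1, f1', f2', f3', f4', f5', f6', f7', f8', f9', D1X, D1Y, dq,
      mul0r, mulr0, add0r, addr0, mul0rn, oppr0); ring.
  rewrite EXX EYY EX EY /P /quad_press /q; clear; move: X Y => x y.
  ring.
rewrite -/P EQ in EP.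
have {EP EQ} : quad_press
  (D DT a11 - (a22 * a33 - a23 ^+ 2 - b1 ^+ 2) *+ 4) (D DT a22 - (a11 * a33 - a13 ^+ 2 - b2 ^+ 2) *+ 4)
  (D DT a33 - (a11 * a22 - a12 ^+ 2 - b3 ^+ 2) *+ 4) (D DT a12 - (a13 * a23 - a12 * a33 - b1 * b2) *+ 4)
  (D DT a13 - (a12 * a23 - a13 * a22 - b1 * b3) *+ 4) (D DT a23 - (a12 * a13 - a11 * a23 - b2 * b3) *+ 4)
  (D DT b1 - (a11 * b1 + a12 * b2 + a13 * b3) *+ 4) (D DT b2 - (a12 * b1 + a22 * b2 + a23 * b3) *+ 4)
  (D DT b3 - (a13 * b1 + a23 * b2 + a33 * b3) *+ 4) = 0.
  apply: (@natmul_eq0 _ 3).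
  have lin u v : u *+ 4 = v *+ 4 -> (u - v) *+ 4 = 0 :> sfun R.
    by move=> uv; rewrite mulrnBl uv subrr.
  by rewrite -(lin _ _ EP) /quad_press; ring.
move=> /quad_press_eq0 H.
have {H} [|||[h1 h2 h3] [[h4 h5 h6] [h7 h8 h9]]] := H.
- by split; apply: flatD; do ?[exact: flat_DT|apply: flat_nat|apply: flatM|apply: flatD|apply: flatN|rewrite expr2].
- by split; apply: flatD; do ?[exact: flat_DT|apply: flat_nat|apply: flatM|apply: flatD|apply: flatN|rewrite expr2].
- by split; apply: flatD; do ?[exact: flat_DT|apply: flat_nat|apply: flatM|apply: flatD|apply: flatN|rewrite expr2].
have S u v : u - v = 0 :> sfun R -> u = v by move=> /eqP; rewrite subr_eq0 => /eqP.
by split; [split|split; split]; exact: S.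
Qed.
End PolynomialForm.

(** * Symmetric forms in three variables *)

Section SymmetricForms.
Context {R : realType}.
Implicit Types (x y z t : R).

Definition qform (a11 a22 a33 a12 a13 a23 : R) (x y z : R) : R :=
  a11 * x ^+ 2 + a22 * y ^+ 2 + a33 * z ^+ 2
  + 2 * (a12 * x * y + a13 * x * z + a23 * y * z).

Definition det_sym (a11 a22 a33 a12 a13 a23 : R) : R :=
  a11 * a22 * a33 + 2 * a12 * a13 * a23 - a11 * a23 ^+ 2 - a22 * a13 ^+ 2 - a33 * a12 ^+ 2.

Definition adj_form (a11 a22 a33 a12 a13 a23 : R) : R -> R -> R -> R :=
  qform (a22 * a33 - a23 ^+ 2) (a11 * a33 - a13 ^+ 2) (a11 * a22 - a12 ^+ 2)
    (a13 * a23 - a12 * a33) (a12 * a23 - a13 * a22) (a12 * a13 - a11 * a23).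

(* The defect is the value of the form at the cross product of [b] and [A b]. *)
Lemma det_le_qform_adj (a11 a22 a33 a12 a13 a23 x y z : R) :
  (forall u v w, 0 <= qform a11 a22 a33 a12 a13 a23 u v w) ->
  det_sym a11 a22 a33 a12 a13 a23 * (x ^+ 2 + y ^+ 2 + z ^+ 2) ^+ 2 <=
  qform a11 a22 a33 a12 a13 a23 x y z * adj_form a11 a22 a33 a12 a13 a23 x y z.
Proof.
move=> psd; pose ax := a11 * x + a12 * y + a13 * z.
pose ay := a12 * x + a22 * y + a23 * z; pose az := a13 * x + a23 * y + a33 * z.
rewrite -subr_ge0; set l := (X in 0 <= X).
have -> : l = qform a11 a22 a33 a12 a13 a23 (y * az - z * ay) (z * ax - x * az) (x * ay - y * ax).
  by rewrite /l /adj_form /qform /det_sym /ax /ay /az; ring.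
exact: psd.
Qed.

(* The defect is half the squared norm of the commutator of [A] with the
   antisymmetric matrix of [b]. *)
Lemma adj_form_le (a11 a22 a33 a12 a13 a23 x y z : R) :
  2 * adj_form a11 a22 a33 a12 a13 a23 x y z <=
  (x ^+ 2 + y ^+ 2 + z ^+ 2) * (a11 ^+ 2 + a22 ^+ 2 + a33 ^+ 2
     + 2 * (a12 ^+ 2 + a13 ^+ 2 + a23 ^+ 2))
  - ((a11 * x + a12 * y + a13 * z) ^+ 2 + (a12 * x + a22 * y + a23 * z) ^+ 2
     + (a13 * x + a23 * y + a33 * z) ^+ 2).
Proof.
rewrite -subr_ge0; set l := (X in 0 <= X).
have -> : l = 2 * ((a12 * z - a13 * y) ^+ 2 + (a23 * x - a12 * z) ^+ 2 + (a13 * y - a23 * x) ^+ 2)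
  + ((a22 - a11) * z + a13 * x - a23 * y) ^+ 2 + ((a11 - a33) * y - a12 * x + a23 * z) ^+ 2
  + ((a33 - a22) * x + a12 * y - a13 * z) ^+ 2.
  by rewrite /l /adj_form /qform; ring.
by do ?[exact: sqr_ge0 | apply: addr_ge0 | apply: mulr_ge0].
Qed.

(** Diagonal dominance: each variable occurs in two mixed terms, and each of these costs at most [c]
    times its square. *)
Lemma qform_psd (a11 a22 a33 a12 a13 a23 c : R) : 0 <= c ->
  3 * c <= a11 -> 3 * c <= a22 -> 3 * c <= a33 ->
  `|a12| <= c -> `|a13| <= c -> `|a23| <= c ->
  forall u v w, 0 <= qform a11 a22 a33 a12 a13 a23 u v w.
Proof.
move=> c0 h1 h2 h3 h4 h5 h6 u v w.
have off (a x y : R) : `|a| <= c -> - (c * (x ^+ 2 + y ^+ 2)) <= 2 * (a * x * y).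
  rewrite ler_norml => /andP[al au].
  have p1 : 0 <= (c + a) * (x + y) ^+ 2 by rewrite mulr_ge0 ?sqr_ge0//; lra.
  have p2 : 0 <= (c - a) * (x - y) ^+ 2 by rewrite mulr_ge0 ?sqr_ge0//; lra.
  by move: p1 p2; lra.
have := off _ u v h4; have := off _ u w h5; have := off _ v w h6.
have diag (a x : R) : 3 * c <= a -> 3 * c * x ^+ 2 <= a * x ^+ 2.
  by move=> ca; rewrite ler_wpM2r// sqr_ge0.
have := diag _ u h1; have := diag _ v h2; have := diag _ w h3.
have cu : 0 <= c * u ^+ 2 by rewrite mulr_ge0// sqr_ge0.
have cv : 0 <= c * v ^+ 2 by rewrite mulr_ge0// sqr_ge0.
have cw : 0 <= c * w ^+ 2 by rewrite mulr_ge0// sqr_ge0.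
rewrite /qform; lra.
Qed.

(* A symmetric matrix with diagonal square all of whose pairs of eigenvalues have a
   positive sum is diagonal. *)
Lemma square_diag_diag (d11 d22 d33 d12 d13 d23 : R) :
  d12 * (d11 + d22) + d13 * d23 = 0 ->
  d13 * (d11 + d33) + d12 * d23 = 0 ->
  d23 * (d22 + d33) + d12 * d13 = 0 ->
  (forall x y z, x ^+ 2 + y ^+ 2 + z ^+ 2 = 1 ->
    0 < d11 + d22 + d33 - qform d11 d22 d33 d12 d13 d23 x y z) ->
  [/\ d12 = 0, d13 = 0 & d23 = 0].
Proof.
move=> e12 e13 e23 pos.
have s1 : 0 < d22 + d33 by have := pos 1 0 0; rewrite /qform; lra.
have s2 : 0 < d11 + d33 by have := pos 0 1 0; rewrite /qform; lra.
have s3 : 0 < d11 + d22 by have := pos 0 0 1; rewrite /qform; lra.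
have [/eqP|r20] := eqVneq (d23 ^+ 2 + d13 ^+ 2) 0.
  rewrite paddr_eq0 ?sqr_ge0// !sqrf_eq0 => /andP[/eqP z23 /eqP z13]; split=> //.
  by move: e12 => /eqP; rewrite z13 mul0r addr0 mulf_eq0 (gt_eqF s3) orbF => /eqP.
exfalso; pose r := Num.sqrt (d23 ^+ 2 + d13 ^+ 2).
have r2_gt0 : 0 < d23 ^+ 2 + d13 ^+ 2 by rewrite lt_neqAle eq_sym r20 addr_ge0 ?sqr_ge0.
have r0 : 0 < r by rewrite sqrtr_gt0.
have rr : r ^+ 2 = d23 ^+ 2 + d13 ^+ 2 by rewrite sqr_sqrtr// ltW.
(* In the direction [(d23, - d13, 0)] the relations [e23] and [e13] make the trace minus the form
   vanish, against [pos]. *)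
have u1 : (d23 / r) ^+ 2 + (- d13 / r) ^+ 2 + 0 ^+ 2 = 1.
  by rewrite !expr_div_n sqrrN expr0n addr0 -mulrDl rr divff.
have := pos _ _ _ u1.
have -> : d11 + d22 + d33 - qform d11 d22 d33 d12 d13 d23 (d23 / r) (- d13 / r) 0
  = (d11 + d22 + d33) * (1 - ((d23 / r) ^+ 2 + (- d13 / r) ^+ 2 + 0 ^+ 2))
    + (d23 * (d23 * (d22 + d33) + d12 * d13) + d13 * (d13 * (d11 + d33) + d12 * d23)) / r ^+ 2.
  by rewrite /qform; field; exact: lt0r_neq0.
by rewrite u1 e13 e23 subrr !mulr0 addr0 mul0r addr0 ltxx.
Qed.
End SymmetricForms.

(** * The flow of quadratic pressures *)

Section QuadFlow.
Context {R : realType} (a11 a22 a33 a12 a13 a23 b1 b2 b3 : sfun R).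
Implicit Types (x y z t : R).
Local Notation ev g t := (sfun_fun g (pt 0 0 t)).

Definition quad_value t x y z : R := ev a11 t + ev a22 t + ev a33 t
  - qform (ev a11 t) (ev a22 t) (ev a33 t) (ev a12 t) (ev a13 t) (ev a23 t) x y z
  + 2 * (ev b1 t * x + ev b2 t * y + ev b3 t * z).

Hypothesis Da11 : D DT a11 = (a22 * a33 - a23 ^+ 2 - b1 ^+ 2) *+ 4.
Hypothesis Da22 : D DT a22 = (a11 * a33 - a13 ^+ 2 - b2 ^+ 2) *+ 4.
Hypothesis Da33 : D DT a33 = (a11 * a22 - a12 ^+ 2 - b3 ^+ 2) *+ 4.
Hypothesis Da12 : D DT a12 = (a13 * a23 - a12 * a33 - b1 * b2) *+ 4.
Hypothesis Da13 : D DT a13 = (a12 * a23 - a13 * a22 - b1 * b3) *+ 4.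
Hypothesis Da23 : D DT a23 = (a12 * a13 - a11 * a23 - b2 * b3) *+ 4.
Hypothesis Db1 : D DT b1 = (a11 * b1 + a12 * b2 + a13 * b3) *+ 4.
Hypothesis Db2 : D DT b2 = (a12 * b1 + a22 * b2 + a23 * b3) *+ 4.
Hypothesis Db3 : D DT b3 = (a13 * b1 + a23 * b2 + a33 * b3) *+ 4.

Hypothesis V_gt0 : forall t x y z, t < 0 -> x ^+ 2 + y ^+ 2 + z ^+ 2 = 1 ->
  0 < quad_value t x y z.
Hypothesis V_bounded : forall T, T < 0 -> exists C, forall t x y z, t <= T ->
  x ^+ 2 + y ^+ 2 + z ^+ 2 = 1 -> quad_value t x y z <= C.
Hypothesis V_limit : forall e : R, 0 < e -> exists2 d, 0 < d & forall t x y z,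
  - d < t < 0 -> x ^+ 2 + y ^+ 2 + z ^+ 2 = 1 ->
  `|2 * - t * quad_value t x y z - 1| <= e.

Definition Dall := (Da11, Da22, Da33, Da12, Da13, Da23, Db1, Db2, Db3).

Definition normb := b1 ^+ 2 + b2 ^+ 2 + b3 ^+ 2.
Definition bAb := a11 * b1 ^+ 2 + a22 * b2 ^+ 2 + a33 * b3 ^+ 2
  + (a12 * b1 * b2 + a13 * b1 * b3 + a23 * b2 * b3) *+ 2.
Definition trsq := a11 ^+ 2 + a22 ^+ 2 + a33 ^+ 2
  + (a12 ^+ 2 + a13 ^+ 2 + a23 ^+ 2) *+ 2 + normb.
Definition det_coef := a11 * a22 * a33 + a12 * a13 * a23 *+ 2 - a11 * a23 ^+ 2
  - a22 * a13 ^+ 2 - a33 * a12 ^+ 2.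

(** This and the next five are the entries of [A^2 + b b^T], whose trace is [trsq]. *)
Definition sq11 := a11 ^+ 2 + a12 ^+ 2 + a13 ^+ 2 + b1 ^+ 2.
Definition sq22 := a12 ^+ 2 + a22 ^+ 2 + a23 ^+ 2 + b2 ^+ 2.
Definition sq33 := a13 ^+ 2 + a23 ^+ 2 + a33 ^+ 2 + b3 ^+ 2.
Definition sq12 := a11 * a12 + a12 * a22 + a13 * a23 + b1 * b2.
Definition sq13 := a11 * a13 + a12 * a23 + a13 * a33 + b1 * b3.
Definition sq23 := a12 * a13 + a22 * a23 + a23 * a33 + b2 * b3.

Lemma Dt_normb : D DT normb = bAb *+ 8.
Proof. by rewrite /normb !(D_nat, D_exp, D_add, Dall) /bAb; ring. Qed.

Lemma Dt_trsq : D DT trsq = det_coef *+ 24.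
Proof. by rewrite /trsq /normb !(D_nat, D_exp, D_add, Dall) /det_coef; ring. Qed.

(** From [A' = 4 (adj A - b b^T)] and [b' = 4 A b] the derivative of [A^2 + b b^T] is [8 det A]
    times the identity: the contributions of [A b b^T] and [b b^T A] cancel. *)
Lemma Dt_sq : [/\ D DT sq12 = 0, D DT sq13 = 0 & D DT sq23 = 0] /\
  [/\ D DT (sq11 *+ 3 - trsq) = 0, D DT (sq22 *+ 3 - trsq) = 0
    & D DT (sq33 *+ 3 - trsq) = 0].
Proof.
rewrite /sq12 /sq13 /sq23 /sq11 /sq22 /sq33.
by split; split; rewrite !(D_nat, D_exp, D_mul, D_opp, D_add, Dall, Dt_trsq) /det_coef; ring.
Qed.

Lemma Dt_mono_on (F : sfun R) t T : t <= T -> T < 0 ->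
  (forall t', t <= t' <= T -> 0 <= ev (D DT F) t') -> ev F t <= ev F T.
Proof.
move=> tT T0 H; have [->//|nt] := eqVneq t T.
have lt_tT : t < T by rewrite lt_neqAle nt.
have E h : h *: dvec DT + pt 0 0 0 = pt 0 0 h :> 'rV[R]_2 * R by rewrite pt_addT addr0.
have [h|c] := @mvt_line _ F (pt 0 0 0) DT t T lt_tT _.
  by rewrite E pt2 in_itv => /andP[_ hT]; exact: le_lt_trans hT T0.
rewrite !E in_itv => /andP[tc cT] eq.
by rewrite -subr_ge0 eq mulr_ge0 ?subr_ge0// H// !ltW.
Qed.

Lemma Dt_const_ev (F : sfun R) (t t' : R) : (forall s, s < 0 -> ev (D DT F) s = 0) ->
  t < 0 -> t' < 0 -> ev F t = ev F t'.
Proof.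
move=> DF.
have half s s' : s <= s' -> s' < 0 -> ev F s = ev F s'.
  move=> ss s0; have neg u : u <= s' -> u < 0 by move=> us; exact: le_lt_trans us s0.
  apply/le_anti; rewrite Dt_mono_on//=; last by move=> u /andP[_ /neg/DF ->].
  have := @Dt_mono_on (- F) s s' ss s0; rewrite !soppE lerN2; apply.
  by move=> u /andP[_ /neg/DF]; rewrite D_opp soppE => ->; rewrite oppr0.
move=> t0 t0'; have [|/ltW] := leP t t'; first by move=> /half; exact.
by move=> /half -> .
Qed.

Lemma Dt_const (F : sfun R) t t' : D DT F = 0 -> t < 0 -> t' < 0 -> ev F t = ev F t'.
Proof. by move=> DF; apply: Dt_const_ev => s _; rewrite DF s0E. Qed.

Lemma near_bounds (e : R) : 0 < e -> exists2 d, 0 < d & forall t, - d < t < 0 ->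
  let s := 2 * - t in
  [/\ `|s * ev b1 t| <= e, `|s * ev b2 t| <= e & `|s * ev b3 t| <= e] /\
  [/\ `|s * ev a11 t - 1 / 2| <= 2 * e, `|s * ev a22 t - 1 / 2| <= 2 * e
    & `|s * ev a33 t - 1 / 2| <= 2 * e] /\
  [/\ `|s * ev a12 t| <= 5 * e, `|s * ev a13 t| <= 5 * e & `|s * ev a23 t| <= 5 * e].
Proof.
move=> e0; have [d d0 H] := V_limit e0; exists d => // t td s.
have {}H x y z := H t x y z td.
pose A11 := s * ev a11 t; pose A22 := s * ev a22 t; pose A33 := s * ev a33 t.
pose A12 := s * ev a12 t; pose A13 := s * ev a13 t; pose A23 := s * ev a23 t.
pose B1 := s * ev b1 t; pose B2 := s * ev b2 t; pose B3 := s * ev b3 t.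
have {}H x y z : x ^+ 2 + y ^+ 2 + z ^+ 2 = 1 -> - e <= A11 + A22 + A33
    - qform A11 A22 A33 A12 A13 A23 x y z + 2 * (B1 * x + B2 * y + B3 * z) - 1 <= e.
  move=> /H; rewrite -ler_norml; congr (`|_ - 1| <= e).
  by rewrite /quad_value /qform /A11 /A22 /A33 /A12 /A13 /A23 /B1 /B2 /B3 -/s; ring.
rewrite -!/A11 -!/A22 -!/A33 -!/A12 -!/A13 -!/A23 -!/B1 -!/B2 -!/B3.
move: A11 A22 A33 A12 A13 A23 B1 B2 B3 H => A11 A22 A33 A12 A13 A23 B1 B2 B3 H.
have even x y z : x ^+ 2 + y ^+ 2 + z ^+ 2 = 1 -> - e <= A11 + A22 + A33
    - qform A11 A22 A33 A12 A13 A23 x y z - 1 <= e /\ `|B1 * x + B2 * y + B3 * z| <= e.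
  move=> u; have /andP[h1 h2] := H _ _ _ u.
  have /andP[] : - e <= A11 + A22 + A33 - qform A11 A22 A33 A12 A13 A23 x y z
      - 2 * (B1 * x + B2 * y + B3 * z) - 1 <= e.
    have u' : (- x) ^+ 2 + (- y) ^+ 2 + (- z) ^+ 2 = 1 by rewrite !sqrrN.
    have := H _ _ _ u'; congr (- e <= _ - 1 <= e); rewrite /qform; ring.
  move: (qform _ _ _ _ _ _ _ _ _) (B1 * x + _ + _) h1 h2 => q l.
  by move=> *; rewrite ler_norml; split; apply/andP; split; lra.
have u1 : 1 ^+ 2 + 0 ^+ 2 + 0 ^+ 2 = 1 :> R by ring.
have u2 : 0 ^+ 2 + 1 ^+ 2 + 0 ^+ 2 = 1 :> R by ring.
have u3 : 0 ^+ 2 + 0 ^+ 2 + 1 ^+ 2 = 1 :> R by ring.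
(* Rational unit vectors with two nonzero coordinates, each of which isolates one off-diagonal
   coefficient. *)
have w3 : (3 / 5) ^+ 2 + (4 / 5) ^+ 2 + 0 ^+ 2 = 1 :> R by field.
have w2 : (3 / 5) ^+ 2 + 0 ^+ 2 + (4 / 5) ^+ 2 = 1 :> R by field.
have w1 : 0 ^+ 2 + (3 / 5) ^+ 2 + (4 / 5) ^+ 2 = 1 :> R by field.
have [d1 l1] := even _ _ _ u1; have [d2 l2] := even _ _ _ u2; have [d3 l3] := even _ _ _ u3.
have [q1 _] := even _ _ _ w1; have [q2 _] := even _ _ _ w2; have [q3 _] := even _ _ _ w3.
split.
  split; [move: l1|move: l2|move: l3]; by rewrite !mulr0 mulr1 ?addr0 ?add0r.
have d1' : - e <= A22 + A33 - 1 <= e by move: d1; rewrite /qform; congr (- e <= _ <= e); ring.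
have d2' : - e <= A11 + A33 - 1 <= e by move: d2; rewrite /qform; congr (- e <= _ <= e); ring.
have d3' : - e <= A11 + A22 - 1 <= e by move: d3; rewrite /qform; congr (- e <= _ <= e); ring.
have q1' : - e <= A11 + (16 * A22 + 9 * A33 - 24 * A23) / 25 - 1 <= e.
  by move: q1; rewrite /qform; congr (- e <= _ <= e); field.
have q2' : - e <= A22 + (16 * A11 + 9 * A33 - 24 * A13) / 25 - 1 <= e.
  by move: q2; rewrite /qform; congr (- e <= _ <= e); field.
have q3' : - e <= A33 + (16 * A11 + 9 * A22 - 24 * A12) / 25 - 1 <= e.
  by move: q3; rewrite /qform; congr (- e <= _ <= e); field.
have [c11 c22 c33] : [/\ `|A11 - 1 / 2| <= 2 * e, `|A22 - 1 / 2| <= 2 * e & `|A33 - 1 / 2| <= 2 * e].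
  move: d1' d2' d3' => /andP[? ?] /andP[? ?] /andP[? ?].
  by rewrite !ler_norml; split; apply/andP; split; lra.
split=> //; move: d1' d2' d3' q1' q2' q3'.
clear H even d1 l1 d2 l2 d3 l3 q1 q2 q3 c11 c22 c33 u1 u2 u3 w1 w2 w3.
move=> /andP[? ?] /andP[? ?] /andP[? ?] q1 q2 q3; rewrite !ler_norml; split.
- by case/andP: q3 => ? ?; apply/andP; split; lra.
- by case/andP: q2 => ? ?; apply/andP; split; lra.
- by case/andP: q1 => ? ?; apply/andP; split; lra.
Qed.
End QuadFlow.

(** * Vanishing of the linear part of the pressure *)

Section RatioAlgebra.
Context {R : realType}.

Lemma sum3_sqr_eq0 (x y z : R) : x ^+ 2 + y ^+ 2 + z ^+ 2 = 0 -> [/\ x = 0, y = 0 & z = 0].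
Proof.
move=> /eqP; rewrite paddr_eq0 ?addr_ge0 ?sqr_ge0// paddr_eq0 ?sqr_ge0// !sqrf_eq0.
by move=> /andP[/andP[/eqP-> /eqP->] /eqP->].
Qed.

Lemma quad_off (c x y : R) : - (`|c| * (x ^+ 2 + y ^+ 2)) <= 2 * (c * x * y).
Proof.
have := ler_norm c; have := ler_norm (- c); rewrite normrN => h1 h2.
have p1 : 0 <= (`|c| + c) * (x + y) ^+ 2 by rewrite mulr_ge0 ?sqr_ge0//; lra.
have p2 : 0 <= (`|c| - c) * (x - y) ^+ 2 by rewrite mulr_ge0 ?sqr_ge0//; lra.
by move: p1 p2; lra.
Qed.

Lemma quad_diag (c x : R) : - (`|c| * x ^+ 2) <= c * x ^+ 2.
Proof.
have := ler_norm (- c); rewrite normrN => h.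
have : 0 <= (`|c| + c) * x ^+ 2 by rewrite mulr_ge0 ?sqr_ge0//; lra.
lra.
Qed.

(** Here [X = |b|^2], [A = <A b, b>], [d = det A] and [J = <adj A b, b>]. In the bound on [J] the
    term [|A b|^2] is expressed through the trace-free part of [A^2 + b b^T], whose entries are the
    [n]; their contribution is at most [nu * X], so [6 J <= X (2 T + nu)], which combines with
    [d X^2 <= A J]. *)
Lemma ratio_algebra (A11 A22 A33 A12 A13 A23 B1 B2 B3 n11 n22 n33 n12 n13 n23 A d T X J : R) :
  let nu := 1 + `|n11| + `|n22| + `|n33| + 3 * (`|n12| + `|n13| + `|n23|) in
  n12 = A11 * A12 + A12 * A22 + A13 * A23 + B1 * B2 ->
  n13 = A11 * A13 + A12 * A23 + A13 * A33 + B1 * B3 ->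
  n23 = A12 * A13 + A22 * A23 + A23 * A33 + B2 * B3 ->
  n11 = 3 * (A11 ^+ 2 + A12 ^+ 2 + A13 ^+ 2 + B1 ^+ 2) - T ->
  n22 = 3 * (A12 ^+ 2 + A22 ^+ 2 + A23 ^+ 2 + B2 ^+ 2) - T ->
  n33 = 3 * (A13 ^+ 2 + A23 ^+ 2 + A33 ^+ 2 + B3 ^+ 2) - T ->
  T = A11 ^+ 2 + A22 ^+ 2 + A33 ^+ 2 + 2 * (A12 ^+ 2 + A13 ^+ 2 + A23 ^+ 2) + X ->
  X = B1 ^+ 2 + B2 ^+ 2 + B3 ^+ 2 -> 0 <= A -> 0 <= T -> d * X ^+ 2 <= A * J ->
  2 * J <= (B1 ^+ 2 + B2 ^+ 2 + B3 ^+ 2) * (A11 ^+ 2 + A22 ^+ 2 + A33 ^+ 2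
     + 2 * (A12 ^+ 2 + A13 ^+ 2 + A23 ^+ 2))
  - ((A11 * B1 + A12 * B2 + A13 * B3) ^+ 2 + (A12 * B1 + A22 * B2 + A23 * B3) ^+ 2
     + (A13 * B1 + A23 * B2 + A33 * B3) ^+ 2) ->
  3 * (X * d) <= A * (T + nu / 2).
Proof.
move=> nu' E12 E13 E23 E11 E22 E33 tr nb al0 tr0 H1 H2.
have nu'1 : 1 <= nu' by rewrite /nu' -!addrA lerDl !addr_ge0// mulr_ge0// !addr_ge0.
have nB : - (nu' * X) <= n11 * B1 ^+ 2 + n22 * B2 ^+ 2 + n33 * B3 ^+ 2
   + 3 * (2 * (n12 * B1 * B2) + 2 * (n13 * B1 * B3) + 2 * (n23 * B2 * B3)).
  have := quad_diag n11 B1; have := quad_diag n22 B2; have := quad_diag n33 B3.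
  have := quad_off n12 B1 B2; have := quad_off n13 B1 B3; have := quad_off n23 B2 B3.
  rewrite /nu' nb.
  have pos (c x : R) : 0 <= `|c| * x ^+ 2 by rewrite mulr_ge0 ?sqr_ge0.
  have := sqr_ge0 B1; have := sqr_ge0 B2; have := sqr_ge0 B3.
  have := pos n11 B2; have := pos n11 B3; have := pos n22 B1; have := pos n22 B3.
  have := pos n33 B1; have := pos n33 B2; have := pos n12 B3; have := pos n13 B2.
  have := pos n23 B1.
  move: (n12 * B1 * B2) (n13 * B1 * B3) (n23 * B2 * B3) => o12 o13 o23.
  move: (n11 * B1 ^+ 2) (n22 * B2 ^+ 2) (n33 * B3 ^+ 2) => p1 p2 p3.
  move: `|n11| `|n22| `|n33| `|n12| `|n13| `|n23| => m11 m22 m33 m12 m13 m23.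
  lra.
have J6 : 6 * J <= X * (2 * T + nu').
  have eq : 3 * (X * (A11 ^+ 2 + A22 ^+ 2 + A33 ^+ 2 + 2 * (A12 ^+ 2 + A13 ^+ 2 + A23 ^+ 2))
    - ((A11 * B1 + A12 * B2 + A13 * B3) ^+ 2 + (A12 * B1 + A22 * B2 + A23 * B3) ^+ 2
       + (A13 * B1 + A23 * B2 + A33 * B3) ^+ 2)) = 2 * X * T
    - (n11 * B1 ^+ 2 + n22 * B2 ^+ 2 + n33 * B3 ^+ 2
   + 3 * (2 * (n12 * B1 * B2) + 2 * (n13 * B1 * B3) + 2 * (n23 * B2 * B3))).
    by rewrite E11 E22 E33 E12 E13 E23 tr nb; ring.
  rewrite -nb in H2.
  move: H2; rewrite -(ler_pM2l (x := 3)) ?ltr0n// eq; move: nB.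
  move: (n11 * _ + _ + _ + _) => n; clearbody nu'; lra.
have X0 : 0 <= X by rewrite nb !addr_ge0 ?sqr_ge0.
have [X00|Xn0] := eqVneq X 0.
  by rewrite X00 mul0r mulr0 mulr_ge0// addr_ge0// divr_ge0// (le_trans ler01).
have Xp : 0 < X by rewrite lt_neqAle eq_sym Xn0.
have s1 : A * (6 * J) <= A * (X * (2 * T + nu')) by rewrite ler_wpM2l.
have s2 : X * (6 * (X * d)) <= X * (A * (2 * T + nu')).
  by move: s1 H1; lra.
move: s2; rewrite ler_pM2l//; lra.
Qed.
End RatioAlgebra.

Section RatioMono.
Local Notation ev g t := (sfun_fun g (pt 0 0 t)).

Lemma Dt_ratio_mono {R : realType} (F G : sfun R) (t T : R) : (forall z : 'rV[R]_2 * R, z.2 < 0 -> 0 < G z) -> t <= T -> T < 0 ->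
  (forall t', t <= t' <= T -> 0 <= ev (D DT F) t' * ev G t' - ev F t' * ev (D DT G) t') ->
  ev F t * ev G T <= ev F T * ev G t.
Proof.
move=> G0 tT T0 H; have G0' (z : 'rV[R]_2 * R) : z.2 < 0 -> G z != 0 by move/G0/lt0r_neq0.
have GS := mul_sinv G0'; have t0 := le_lt_trans tT T0.
have DS : D DT (sinv G) = - (D DT G * sinv G ^+ 2).
  have : sinv G * D DT (G * sinv G) = 0 by rewrite GS D_1 mulr0.
  rewrite D_mul mulrDr !mulrA [sinv G * G]mulrC GS mul1r => /eqP.
  by rewrite addrC addr_eq0 => /eqP ->; congr (- _); ring.
have DQ : D DT (F * sinv G) = (D DT F * G - F * D DT G) * sinv G ^+ 2.
  rewrite D_mul DS -[X in X * sinv G + _]mulr1 -GS; ring.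
have := @Dt_mono_on R (F * sinv G) t T tT T0; rewrite !smulE !sinvE ?pt2//.
rewrite ler_pdivrMr ?G0 ?pt2// mulrAC ler_pdivlMr ?G0 ?pt2//; apply => t' tt'.
have t'0 : t' < 0 by case/andP: tt' => _ /le_lt_trans; apply.
rewrite DQ smulE sexpE ?pt2// mulr_ge0 ?sqr_ge0// (saddE (_ * _)) soppE !smulE.
exact: H.
Qed.

End RatioMono.

Section BVanish.
Context {R : realType} (a11 a22 a33 a12 a13 a23 b1 b2 b3 : sfun R).
Implicit Types (x y z t : R).
Local Notation ev g t := (sfun_fun g (pt 0 0 t)).
Local Notation V := (quad_value a11 a22 a33 a12 a13 a23 b1 b2 b3).
Hypothesis Da11 : D DT a11 = (a22 * a33 - a23 ^+ 2 - b1 ^+ 2) *+ 4.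
Hypothesis Da22 : D DT a22 = (a11 * a33 - a13 ^+ 2 - b2 ^+ 2) *+ 4.
Hypothesis Da33 : D DT a33 = (a11 * a22 - a12 ^+ 2 - b3 ^+ 2) *+ 4.
Hypothesis Da12 : D DT a12 = (a13 * a23 - a12 * a33 - b1 * b2) *+ 4.
Hypothesis Da13 : D DT a13 = (a12 * a23 - a13 * a22 - b1 * b3) *+ 4.
Hypothesis Da23 : D DT a23 = (a12 * a13 - a11 * a23 - b2 * b3) *+ 4.
Hypothesis Db1 : D DT b1 = (a11 * b1 + a12 * b2 + a13 * b3) *+ 4.
Hypothesis Db2 : D DT b2 = (a12 * b1 + a22 * b2 + a23 * b3) *+ 4.
Hypothesis Db3 : D DT b3 = (a13 * b1 + a23 * b2 + a33 * b3) *+ 4.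

Hypothesis V_gt0 : forall t x y z, t < 0 -> x ^+ 2 + y ^+ 2 + z ^+ 2 = 1 ->
  0 < V t x y z.
Hypothesis V_bounded : forall T, T < 0 -> exists C, forall t x y z, t <= T ->
  x ^+ 2 + y ^+ 2 + z ^+ 2 = 1 -> V t x y z <= C.
Hypothesis V_limit : forall e : R, 0 < e -> exists2 d, 0 < d & forall t x y z,
  - d < t < 0 -> x ^+ 2 + y ^+ 2 + z ^+ 2 = 1 ->
  `|2 * - t * V t x y z - 1| <= e.


Local Notation normb := (normb b1 b2 b3).
Local Notation bAb := (bAb a11 a22 a33 a12 a13 a23 b1 b2 b3).
Local Notation trsq := (trsq a11 a22 a33 a12 a13 a23 b1 b2 b3).
Local Notation detA := (det_coef a11 a22 a33 a12 a13 a23).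
Local Notation sq11 := (sq11 a11 a12 a13 b1).
Local Notation sq22 := (sq22 a22 a12 a23 b2).
Local Notation sq33 := (sq33 a33 a13 a23 b3).
Local Notation sq12 := (sq12 a11 a22 a12 a13 a23 b1 b2).
Local Notation sq13 := (sq13 a11 a33 a12 a13 a23 b1 b3).
Local Notation sq23 := (sq23 a22 a33 a12 a13 a23 b2 b3).

Lemma normbE t : t < 0 -> ev normb t = ev b1 t ^+ 2 + ev b2 t ^+ 2 + ev b3 t ^+ 2.
Proof. by move=> t0; rewrite (saddE (_ + _)) (saddE (b1 ^+ 2)) !sexpE ?pt2. Qed.

Lemma bAbE t : t < 0 -> ev bAb t = qform (ev a11 t) (ev a22 t) (ev a33 t)
  (ev a12 t) (ev a13 t) (ev a23 t) (ev b1 t) (ev b2 t) (ev b3 t).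
Proof.
move=> t0; rewrite (saddE (_ + _)) (saddE (_ + _)) (saddE (a11 * _)) snatE.
rewrite (saddE (_ + _)) (saddE (a12 * _ * _)) (smulE a11) (smulE a22) (smulE a33).
rewrite (smulE (a12 * _)) (smulE a12) (smulE (a13 * _)) (smulE a13) (smulE (a23 * _)) (smulE a23).
by rewrite !sexpE ?pt2// /qform; ring.
Qed.

Lemma trsqE t : t < 0 -> ev trsq t = ev a11 t ^+ 2 + ev a22 t ^+ 2 + ev a33 t ^+ 2
  + 2 * (ev a12 t ^+ 2 + ev a13 t ^+ 2 + ev a23 t ^+ 2) + ev normb t.
Proof.
move=> t0; rewrite (saddE (_ + _)) (saddE (_ + _)) (saddE (_ + _)) (saddE (a11 ^+ 2)) snatE.
by rewrite (saddE (_ + _)) (saddE (a12 ^+ 2)) !sexpE ?pt2// mulr_natl.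
Qed.

Lemma detAE t : t < 0 -> ev detA t = det_sym (ev a11 t) (ev a22 t) (ev a33 t)
  (ev a12 t) (ev a13 t) (ev a23 t).
Proof.
move=> t0; rewrite /det_coef (saddE (_ - _)) (saddE (_ - _)) (saddE (_ + _)) (saddE (a11 * _ * _)).
rewrite snatE !soppE (smulE (a11 * a22)) (smulE a11) (smulE (a12 * a13)) (smulE a12).
by rewrite (smulE a11) (smulE a22) (smulE a33) !sexpE ?pt2// /det_sym; ring.
Qed.

Lemma sqE t : t < 0 ->
  [/\ ev sq12 t = ev a11 t * ev a12 t + ev a12 t * ev a22 t + ev a13 t * ev a23 t + ev b1 t * ev b2 t,
   ev sq13 t = ev a11 t * ev a13 t + ev a12 t * ev a23 t + ev a13 t * ev a33 t + ev b1 t * ev b3 t &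
   ev sq23 t = ev a12 t * ev a13 t + ev a22 t * ev a23 t + ev a23 t * ev a33 t + ev b2 t * ev b3 t] /\
  [/\ ev (sq11 *+ 3 - trsq) t = 3 * (ev a11 t ^+ 2 + ev a12 t ^+ 2 + ev a13 t ^+ 2 + ev b1 t ^+ 2) - ev trsq t,
   ev (sq22 *+ 3 - trsq) t = 3 * (ev a12 t ^+ 2 + ev a22 t ^+ 2 + ev a23 t ^+ 2 + ev b2 t ^+ 2) - ev trsq t &
   ev (sq33 *+ 3 - trsq) t = 3 * (ev a13 t ^+ 2 + ev a23 t ^+ 2 + ev a33 t ^+ 2 + ev b3 t ^+ 2) - ev trsq t].
Proof.
move=> t0; split; split.
1-3: by rewrite (saddE (_ + _)) (saddE (_ + _)) (saddE (_ * _)) !smulE.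
all: rewrite (saddE (_ *+ 3)) soppE snatE (saddE (_ + _)) (saddE (_ + _)) (saddE (_ ^+ 2)).
all: by rewrite !sexpE ?pt2// mulr_natl.
Qed.

Let nu : R := 1 + `|ev (sq11 *+ 3 - trsq) (-1)| + `|ev (sq22 *+ 3 - trsq) (-1)|
  + `|ev (sq33 *+ 3 - trsq) (-1)| + 3 * (`|ev sq12 (-1)| + `|ev sq13 (-1)| + `|ev sq23 (-1)|).

Let nu1 : 1 <= nu.
Proof. by rewrite /nu -!addrA lerDl !addr_ge0// mulr_ge0// !addr_ge0. Qed.

(** By [Dt_normb] and [Dt_trsq] this inequality is the nonnegativity of the derivative of the ratio
    of [normb] to [trsq + nu / 2]. The constant [nu] can be evaluated at time -1 because [Dt_sq]
    makes its ingredients constant. *)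
Lemma ratio_step t : t < 0 ->
  (forall u v w, 0 <= qform (ev a11 t) (ev a22 t) (ev a33 t) (ev a12 t) (ev a13 t) (ev a23 t) u v w) ->
  3 * (ev normb t * ev detA t) <= ev bAb t * (ev trsq t + nu / 2).
Proof.
move=> t0 psd; have t1 : -1 < 0 :> R by rewrite oppr_lt0.
have [[D12 D13 D23] [D11 D22 D33]] := Dt_sq Da11 Da22 Da33 Da12 Da13 Da23 Db1 Db2 Db3.
have [[E12 E13 E23] [E11 E22 E33]] := sqE t0.
have c12 := Dt_const D12 t1 t0; have c13 := Dt_const D13 t1 t0; have c23 := Dt_const D23 t1 t0.
have c11 := Dt_const D11 t1 t0; have c22 := Dt_const D22 t1 t0; have c33 := Dt_const D33 t1 t0.
have := nu1; rewrite /nu c12 c13 c23 c11 c22 c33.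
set n12 := ev sq12 t in E12 *; set n13 := ev sq13 t in E13 *; set n23 := ev sq23 t in E23 *.
set n11 := ev _ t in E11 *; set n22 := ev (sq22 *+ 3 - _) t in E22 *.
set n33 := ev (sq33 *+ 3 - _) t in E33 *.
set nu' := 1 + _ + _ + _ + _ => nu'1.
have tr := trsqE t0; have nb := normbE t0.
have al := bAbE t0; have dA := detAE t0.
have H1 := det_le_qform_adj (ev b1 t) (ev b2 t) (ev b3 t) psd.
have H2 := adj_form_le (ev a11 t) (ev a22 t) (ev a33 t) (ev a12 t) (ev a13 t) (ev a23 t)
  (ev b1 t) (ev b2 t) (ev b3 t).
have al0 : 0 <= ev bAb t by rewrite al; exact: psd.
have tr0 : 0 <= ev trsq t.
  rewrite tr nb; by do ?[exact: sqr_ge0 | apply: addr_ge0 | apply: mulr_ge0].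
rewrite -al -dA -nb in H1.
exact: ratio_algebra E12 E13 E23 E11 E22 E33 tr nb al0 tr0 H1 H2.
Qed.

Let MS := trsq + scst (nu / 2).

Let MS_gt0 (z : 'rV[R]_2 * R) : z.2 < 0 -> 0 < MS z.
Proof.
move=> z0; rewrite (saddE trsq) scstE// ltr_wpDl//; last by rewrite divr_gt0// (lt_le_trans ltr01).
rewrite (saddE (_ + _)) (saddE (_ + _)) (saddE (_ + _)) (saddE (a11 ^+ 2)) snatE.
rewrite (saddE (_ + _)) (saddE (a12 ^+ 2)) (saddE (_ + _)) (saddE (b1 ^+ 2)) !sexpE//.
by rewrite !(addr_ge0, mulrn_wge0, sqr_ge0).
Qed.

Lemma normb_eq0_near : exists2 d, 0 < d & forall t, - d < t < 0 -> ev normb t = 0.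
Proof.
have e0 : 0 < 1 / 100 :> R by rewrite divr_gt0.
have [d d0 H] := near_bounds V_limit e0; exists d => // t1 td1.
(* Multiplied by [2 (- t)], the form is close to half the identity; an error of 1/100 leaves it
   diagonally dominant. *)
have psd t : - d < t < 0 -> forall u v w,
  0 <= qform (ev a11 t) (ev a22 t) (ev a33 t) (ev a12 t) (ev a13 t) (ev a23 t) u v w.
  move=> td u v w; have [_ [[h11 h22 h33] [h12 h13 h23]]] := H t td.
  have s0 : 0 < 2 * - t by rewrite mulr_gt0// oppr_gt0; case/andP: td.
  have := @qform_psd R (2 * - t * ev a11 t) (2 * - t * ev a22 t) (2 * - t * ev a33 t)
    (2 * - t * ev a12 t) (2 * - t * ev a13 t) (2 * - t * ev a23 t) (5 / 100) _ _ _ _ _ _ _ u v w.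
  have -> : qform (2 * - t * ev a11 t) (2 * - t * ev a22 t) (2 * - t * ev a33 t)
    (2 * - t * ev a12 t) (2 * - t * ev a13 t) (2 * - t * ev a23 t) u v w =
    2 * - t * qform (ev a11 t) (ev a22 t) (ev a33 t) (ev a12 t) (ev a13 t) (ev a23 t) u v w.
    by rewrite /qform; ring.
  rewrite (pmulr_rge0 _ s0); apply; first by rewrite divr_ge0.
  - by move: h11; rewrite ler_norml => /andP[h _]; lra.
  - by move: h22; rewrite ler_norml => /andP[h _]; lra.
  - by move: h33; rewrite ler_norml => /andP[h _]; lra.
  - by apply: le_trans h12 _; lra.
  - by apply: le_trans h13 _; lra.
  - by apply: le_trans h23 _; lra.
have t10 : t1 < 0 by case/andP: td1.
have mono t : t1 <= t -> t < 0 -> ev normb t1 * ev MS t <= ev normb t * ev MS t1.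
  move=> tt t0; apply: Dt_ratio_mono => // t' /andP[t1t' t't].
  have t'0 := le_lt_trans t't t0.
  have r := @ratio_step t' t'0 (psd t' _).
  have Db := Dt_normb Db1 Db2 Db3.
  have Dtr := Dt_trsq Da11 Da22 Da33 Da12 Da13 Da23 Db1 Db2 Db3.
  have {Dtr}DM : D DT MS = detA *+ 24 by rewrite /MS (D_add _ trsq) D_cst addr0 Dtr.
  rewrite Db DM !snatE (saddE trsq) scstE ?pt2//.
  have {}r := r _; rewrite subr_ge0.
  move: (r); rewrite (_ : - d < t' < 0); last by rewrite t'0 (lt_le_trans _ t1t')//; case/andP: td1.
  move=> /(_ isT).
  move: (ev normb t') (ev detA t') (ev bAb t') (ev trsq t' + nu / 2) => N X Y Z.
  rewrite -(mulr_natl Y) -(mulr_natl X); lra.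
have nb0 t : t < 0 -> 0 <= ev normb t by move=> t0; rewrite normbE// !addr_ge0// sqr_ge0.
have M0 : 0 < ev MS t1 by apply: MS_gt0; rewrite pt2.
apply/eqP; rewrite eq_le nb0// andbT leNgt; apply/negP => N0.
(* With this [e] the ratio of [normb] to [MS] close to time 0 would be smaller than at [t1], against
   its monotonicity. *)
pose e := Num.min (1 / 100) (ev normb t1 / (ev MS t1 * 30)).
have ep : 0 < e by rewrite lt_min e0 divr_gt0// mulr_gt0.
have e1 : e <= 1 / 100 by rewrite ge_min lexx.
have e2 : e * (ev MS t1 * 30) <= ev normb t1.
  by rewrite -ler_pdivlMr ?mulr_gt0// ge_min lexx orbT.
have [d' d'0 H'] := near_bounds V_limit ep.
pose t := Num.max t1 (- d' / 2).
have t0 : t < 0 by rewrite gt_max t10 ltr_pdivrMr// mul0r oppr_lt0.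
have tt : t1 <= t by rewrite le_max lexx.
have td : - d' < t < 0.
  by rewrite t0 andbT lt_max; apply/orP; right; rewrite ltr_pdivlMr//; lra.
have := mono t tt t0.
have [[hb1 hb2 hb3] [[h11 _ _] _]] := H' t td.
have sq (x : R) : `|x| <= e -> x ^+ 2 <= e ^+ 2.
  by move=> xe; rewrite -real_normK ?num_real// lerXn2r// ?nnegrE// ltW.
have s0 : 0 < 2 * - t by rewrite mulr_gt0// oppr_gt0.
have nbt : (2 * - t) ^+ 2 * ev normb t <= 3 * e ^+ 2.
  rewrite normbE//; move: (sq _ hb1) (sq _ hb2) (sq _ hb3); rewrite !exprMn; lra.
have Mt : 1 / 5 <= (2 * - t) ^+ 2 * ev MS t.
  have aM : ev a11 t ^+ 2 <= ev MS t.
    rewrite (saddE trsq) scstE ?pt2// trsqE//.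
    have : 0 <= nu / 2 by rewrite divr_ge0// (le_trans ler01).
    have := nb0 t t0; have := sqr_ge0 (ev a22 t); have := sqr_ge0 (ev a33 t).
    have := sqr_ge0 (ev a12 t); have := sqr_ge0 (ev a13 t); have := sqr_ge0 (ev a23 t).
    move: (ev a11 t ^+ 2) (ev a22 t ^+ 2) (ev a33 t ^+ 2) (ev a12 t ^+ 2) (ev a13 t ^+ 2) (ev a23 t ^+ 2).
    move: (ev normb t) (nu / 2) => *; lra.
  apply: le_trans (ler_wpM2l (sqr_ge0 _) aM); rewrite -exprMn.
  have h : 48 / 100 <= 2 * - t * ev a11 t.
    by move: h11; rewrite ler_norml => /andP[h _]; lra.
  apply: (@le_trans _ _ ((48 / 100) ^+ 2)); first by lra.
  by rewrite lerXn2r// ?nnegrE ?divr_ge0// (le_trans _ h)// divr_ge0.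
rewrite -(ler_pM2l (exprn_gt0 2 s0)) => h.
have {Mt}h1 := ler_wpM2l (ltW N0) Mt.
have {nbt}h2 := ler_wpM2r (ltW M0) nbt.
have h3 : e ^+ 2 * ev MS t1 <= e * (1 / 100) * ev MS t1.
  by rewrite ler_wpM2r ?(ltW M0)// expr2 ler_wpM2l// ltW.
move: h h1 h2 h3 e2 N0.
move: (ev normb t1) (ev MS t1) (ev normb t) (ev MS t) ((2 * - t) ^+ 2) => *; lra.
Qed.

(** Adding the upper bounds of [V] at [n] and [- n] removes the linear part; as the trace is
    nonnegative, the form is at least [- C] on unit vectors. *)
Lemma bAb_ge T : T < 0 -> exists C, forall t, t <= T -> - (C * ev normb t) <= ev bAb t.
Proof.
move=> T0; have [C H] := V_bounded T0; exists C => t tT.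
have t0 := le_lt_trans tT T0.
have lower x y z : x ^+ 2 + y ^+ 2 + z ^+ 2 = 1 ->
    - C <= qform (ev a11 t) (ev a22 t) (ev a33 t) (ev a12 t) (ev a13 t) (ev a23 t) x y z.
  move=> u; have u' : (- x) ^+ 2 + (- y) ^+ 2 + (- z) ^+ 2 = 1 by rewrite !sqrrN.
  have := H t _ _ _ tT u; have := H t _ _ _ tT u'; rewrite /quad_value.
  have tr : 0 <= ev a11 t + ev a22 t + ev a33 t.
    have u1 : 1 ^+ 2 + 0 ^+ 2 + 0 ^+ 2 = 1 :> R by ring.
    have u2 : 0 ^+ 2 + 1 ^+ 2 + 0 ^+ 2 = 1 :> R by ring.
    have u3 : 0 ^+ 2 + 0 ^+ 2 + 1 ^+ 2 = 1 :> R by ring.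
    have v1 : (-1) ^+ 2 + 0 ^+ 2 + 0 ^+ 2 = 1 :> R by ring.
    have v2 : 0 ^+ 2 + (-1) ^+ 2 + 0 ^+ 2 = 1 :> R by ring.
    have v3 : 0 ^+ 2 + 0 ^+ 2 + (-1) ^+ 2 = 1 :> R by ring.
    move: (V_gt0 t0 u1) (V_gt0 t0 u2) (V_gt0 t0 u3) (V_gt0 t0 v1) (V_gt0 t0 v2) (V_gt0 t0 v3).
    rewrite /quad_value /qform.
    move: (ev a11 t) (ev a22 t) (ev a33 t) (ev a12 t) (ev a13 t) (ev a23 t) (ev b1 t) (ev b2 t) (ev b3 t).
    move=> *; lra.
  have -> : forall c1 c2 c3 c4 c5 c6, qform c1 c2 c3 c4 c5 c6 (- x) (- y) (- z) =
    qform c1 c2 c3 c4 c5 c6 x y z by move=> *; rewrite /qform; ring.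
  move: (qform _ _ _ _ _ _ _ _ _) => q; move: tr.
  move: (ev a11 t + _ + _) => *; lra.
have n0 : 0 <= ev normb t by rewrite normbE// !addr_ge0// sqr_ge0.
have [nz|nz] := eqVneq (ev normb t) 0.
  rewrite nz mulr0 oppr0 bAbE//; move: nz; rewrite normbE// => /sum3_sqr_eq0[-> -> ->].
  by rewrite /qform !(expr0n, mulr0, addr0).
pose r := Num.sqrt (ev normb t).
have r2 : r ^+ 2 = ev normb t by rewrite sqr_sqrtr.
have r0 : r != 0 by rewrite sqrtr_eq0 -ltNge lt_neqAle eq_sym nz.
have := @lower (ev b1 t / r) (ev b2 t / r) (ev b3 t / r).
rewrite !exprMn -!mulrDl -normbE// exprVn r2 divff// => /(_ erefl).
have -> : forall c1 c2 c3 c4 c5 c6 x y z, qform c1 c2 c3 c4 c5 c6 (x / r) (y / r) (z / r) =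
   qform c1 c2 c3 c4 c5 c6 x y z / r ^+ 2 by move=> *; rewrite /qform; field.
rewrite -bAbE// r2 ler_pdivlMr ?mulNr// lt_neqAle eq_sym nz//.
Qed.

(** Gronwall backward in time: by [bAb_ge] the product of [normb] and [exp (8 C t)] is nondecreasing
    up to a time where it vanishes. *)
Lemma normb_eq0 t : t < 0 -> ev normb t = 0.
Proof.
move=> t0; have [d d0 H] := normb_eq0_near; pose T := Num.max t (- d / 2).
have T0 : T < 0 by rewrite gt_max t0 ltr_pdivrMr// mul0r oppr_lt0.
have tT : t <= T by rewrite le_max lexx.
have NT : ev normb T = 0.
  by apply: H; rewrite T0 andbT lt_max; apply/orP; right; rewrite ltr_pdivlMr//; lra.
have [C HC] := bAb_ge T0.
have := @Dt_mono_on R (normb * sexpR (scst (8 * C) * coord DT)) t T tT T0.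
rewrite !smulE NT mul0r => le0; apply/eqP.
rewrite eq_le normbE// !addr_ge0 ?sqr_ge0// andbT -normbE//.
rewrite -(@pmulr_lle0 _ (ev (sexpR (scst (8 * C) * coord DT)) t)) ?sexpRE ?pt2 ?expR_gt0//.
rewrite -sexpRE ?pt2//; apply: le0 => t' /andP[tt' t'T].
have t'0 : t' < 0 := le_lt_trans t'T T0.
have Db := Dt_normb Db1 Db2 Db3.
rewrite (D_mul _ normb) D_sexpR Db D_mul D_cst mul0r add0r D_coord mulr1 mulrA.
rewrite -mulrDl smulE mulr_ge0//; last by rewrite sexpRE ?pt2// ltW// expR_gt0.
rewrite (saddE (_ *+ 8)) snatE smulE scstE ?pt2// -mulr_natl.
have := HC t' t'T; lra.
Qed.

Lemma b_eq0 t : t < 0 -> [/\ ev b1 t = 0, ev b2 t = 0 & ev b3 t = 0].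
Proof.
by move=> t0; have := normb_eq0 t0; rewrite normbE// => /sum3_sqr_eq0.
Qed.
End BVanish.

(** * Orthonormal frames in dimension three *)

Section Spectral.
Context {R : realType}.
Implicit Types (Q S : 'M[R]_3) (q : 'rV[R]_3).

Definition rows3 (v0 v1 v2 : 'rV[R]_3) : 'M[R]_3 :=
  \matrix_(i, j) [:: v0 0 j; v1 0 j; v2 0 j]`_i.

Definition vec3 (x y z : R) : 'rV[R]_3 := \row_i [:: x; y; z]`_i.

Definition dot3 (v w : 'rV[R]_3) : R := v 0 0 * w 0 0 + v 0 1 * w 0 1 + v 0 2 * w 0 2.

Lemma sum3 (M : nmodType) (F : 'I_3 -> M) : \sum_i F i = F 0 + F 1 + F 2.
Proof.
rewrite !big_ord_recr big_ord0 /= add0r.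
by congr (F _ + F _ + F _); apply: val_inj.
Qed.

Lemma ord3P (P : 'I_3 -> Prop) : P 0 -> P 1 -> P 2 -> forall i, P i.
Proof.
move=> P0 P1 P2 [[|[|[|//]]] i]; [move: P0|move: P1|move: P2];
by congr P; apply: val_inj.
Qed.

Lemma mulmx_trE Q Q' i j : (Q *m Q'^T) i j = dot3 (row i Q) (row j Q').
Proof. by rewrite !mxE sum3 /dot3 !mxE. Qed.

Lemma dot3_row (v w : 'rV[R]_3) : dot3 v w = (v *m w^T) 0 0.
Proof. by rewrite !mxE sum3 /dot3 !mxE. Qed.

Lemma dot3_orthogonal Q (v w : 'rV[R]_3) : Q *m Q^T = 1%:M ->
  dot3 (v *m Q) (w *m Q) = dot3 v w.
Proof. by move=> QQ; rewrite !dot3_row trmx_mul -mulmxA (mulmxA Q) QQ mul1mx. Qed.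

Lemma frame3 q : dot3 q q = 1 -> exists P : 'M[R]_3, P *m P^T = 1%:M /\ row 2 P = q.
Proof.
move=> q1; pose x := q 0 0; pose y := q 0 1; pose z := q 0 2.
have q1' : x ^+ 2 + y ^+ 2 + z ^+ 2 = 1 by rewrite -q1 /dot3 -!expr2.
pose r := Num.sqrt (x ^+ 2 + y ^+ 2).
have r2 : r ^+ 2 = x ^+ 2 + y ^+ 2 by rewrite sqr_sqrtr// addr_ge0// sqr_ge0.
have rowq v0 v1 : row 2 (rows3 v0 v1 q) = q by apply/rowP => j; rewrite !mxE.
have [rz|r0] := eqVneq r 0.
  exists (rows3 (vec3 1 0 0) (vec3 0 1 0) q); split => //.
  move: r2; rewrite rz expr0n => /esym/eqP.
  rewrite paddr_eq0 ?sqr_ge0// !sqrf_eq0 => /andP[/eqP x0 /eqP y0].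
  by apply/matrixP; apply: ord3P; apply: ord3P; rewrite mulmx_trE /dot3 !mxE /=;
    move: x0 y0 q1; rewrite /dot3 -?/x -?/y -?/z => -> ->; lra.
pose a := x / r; pose b := y / r.
have xE : x = a * r by rewrite /a divfK.
have yE : y = b * r by rewrite /b divfK.
have ab1 : a ^+ 2 + b ^+ 2 = 1.
  apply: (mulIf (expf_neq0 2 r0)); rewrite mul1r [RHS]r2 xE yE; ring.
have rz1 : r ^+ 2 + z ^+ 2 = 1 by rewrite r2.
(* The first two rows are the unit tangents to the parallel and to the meridian through [q]. *)
exists (rows3 (vec3 (- b) a 0) (vec3 (- a * z) (- b * z) r) q); split => //.
have key (P : 'M[R]_3) : P = P^T ->
  [/\ P 0 0 = 1, P 1 1 = 1, P 2 2 = 1 & [/\ P 0 1 = 0, P 0 2 = 0 & P 1 2 = 0]] -> P = 1%:M.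
  move=> tP [h00 h11 h22 [h01 h02 h12]].
  have h10 : P 1 0 = 0 by rewrite tP mxE.
  have h20 : P 2 0 = 0 by rewrite tP mxE.
  have h21 : P 2 1 = 0 by rewrite tP mxE.
  by apply/matrixP; apply: ord3P; apply: ord3P; rewrite mxE.
apply: key; first by rewrite trmx_mul trmxK.
rewrite !mulmx_trE /dot3 !mxE /= -/x -/y -/z xE yE.
split; [| | |split].
- by rewrite -ab1; ring.
- have -> : - a * z * (- a * z) + - b * z * (- b * z) + r * r
    = z ^+ 2 * (a ^+ 2 + b ^+ 2) + r ^+ 2 by ring.
  by rewrite ab1; lra.
- have -> : a * r * (a * r) + b * r * (b * r) + z * z
    = r ^+ 2 * (a ^+ 2 + b ^+ 2) + z ^+ 2 by ring.
  by rewrite ab1; lra.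
- ring.
- ring.
- have -> : - a * z * (a * r) + - b * z * (b * r) + r * z
    = r * z * (1 - (a ^+ 2 + b ^+ 2)) by ring.
  by rewrite ab1; ring.
Qed.

Lemma rotation2 (p r s : R) : exists c d : R, c ^+ 2 + d ^+ 2 = 1 /\
  (r - p) * c * d + s * (c ^+ 2 - d ^+ 2) = 0.
Proof.
have [->|s0] := eqVneq s 0; first by exists 1, 0; split; ring.
pose w := Num.sqrt ((p - r) ^+ 2 + 4 * s ^+ 2).
have w2 : w ^+ 2 = (p - r) ^+ 2 + 4 * s ^+ 2.
  by rewrite sqr_sqrtr//; have := sqr_ge0 (p - r); have := sqr_ge0 s; lra.
(* The vector [(s, l)] is an eigenvector, for the eigenvalue [p + l], of the symmetric matrix with
   diagonal [p], [r] and off-diagonal entry [s]. *)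
pose l := (r - p + w) / 2.
have ll : l ^+ 2 = (r - p) * l + s ^+ 2.
  by move: w2; rewrite /l; lra.
clearbody l.
have m0 : 0 < s ^+ 2 + l ^+ 2 by rewrite ltr_wpDr ?sqr_ge0// exprn_even_gt0.
pose m := Num.sqrt (s ^+ 2 + l ^+ 2).
have m2 : m ^+ 2 = s ^+ 2 + l ^+ 2 by rewrite sqr_sqrtr// ltW.
have mn0 : m != 0 by rewrite gt_eqF// sqrtr_gt0.
exists (s / m), (l / m); split.
  by rewrite !expr_div_n -mulrDl -m2 divff// expf_neq0.
have -> : (r - p) * (s / m) * (l / m) + s * ((s / m) ^+ 2 - (l / m) ^+ 2)
   = s * ((r - p) * l + s ^+ 2 - l ^+ 2) / m ^+ 2 by field.
by rewrite -ll subrr mulr0 mul0r.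
Qed.

(** The characteristic polynomial has odd degree, hence a real root. A frame completing an
    eigenvector leaves a block of order two, diagonalized by [rotation2]. *)
Lemma spectral3 S : S^T = S -> exists Q, Q *m Q^T = 1%:M /\
  forall i j, i != j -> (Q *m S *m Q^T) i j = 0.
Proof.
move=> symS; have [|l] := @odd_poly_root R (char_poly S); first by rewrite size_char_poly.
rewrite -eigenvalue_root_char => /eigenvalueP[v vS v0].
pose m := Num.sqrt (dot3 v v).
have vv : 0 < dot3 v v.
  rewrite /dot3 -!expr2 lt_neqAle !addr_ge0 ?sqr_ge0// andbT eq_sym.
  apply: contra v0 => /eqP /sum3_sqr_eq0[h0 h1 h2].
  by apply/eqP/rowP; apply: ord3P; rewrite mxE.
have m2 : m ^+ 2 = dot3 v v by rewrite sqr_sqrtr// ltW.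
have mn0 : m != 0 by rewrite gt_eqF// sqrtr_gt0.
have [|P [PP rP]] := @frame3 (m^-1 *: v).
  have -> : dot3 (m^-1 *: v) (m^-1 *: v) = dot3 v v / m ^+ 2 by rewrite /dot3 !mxE; field.
  by rewrite -m2 divff// expf_neq0.
pose N := P *m S *m P^T.
have tN : N^T = N by rewrite /N !trmx_mul trmxK symS mulmxA.
have rN : row 2 N = l *: row 2 1%:M.
  by rewrite /N !row_mul rP -scalemxAl vS scalerA mulrC -scalerA -rP -scalemxAl -row_mul PP.
have N20 : N 2 0 = 0 by move/rowP/(_ 0): rN; rewrite !mxE mulr0.
have N21 : N 2 1 = 0 by move/rowP/(_ 1): rN; rewrite !mxE mulr0.
have N02 : N 0 2 = 0 by rewrite -tN mxE.
have N12 : N 1 2 = 0 by rewrite -tN mxE.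
have N10 : N 1 0 = N 0 1 by rewrite -{1}tN mxE.
have [c [d [cd cdN]]] := rotation2 (N 0 0) (N 1 1) (N 0 1).
pose G := rows3 (vec3 c d 0) (vec3 (- d) c 0) (vec3 0 0 1).
have GG : G *m G^T = 1%:M.
  apply/matrixP; apply: ord3P; apply: ord3P; rewrite mulmx_trE /dot3 !mxE /=; lra.
exists (G *m P); split; first by rewrite trmx_mul -mulmxA (mulmxA P) PP mul1mx.
rewrite trmx_mul !mulmxA -2!(mulmxA G) -/N.
clear rN; clearbody N.
have E i j : (G *m N *m G^T) i j = \sum_k (\sum_h G i h * N h k) * G j k.
  by rewrite !mxE; apply: eq_bigr => k _; rewrite !mxE.
have : (G *m N *m G^T) 0 1 = 0 /\ (G *m N *m G^T) 0 2 = 0 /\ (G *m N *m G^T) 1 2 = 0.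
  rewrite !E !sum3 !mxE /= N20 N21 N02 N12 N10; split; last by split; ring.
  by move: cdN; lra.
have tG : (G *m N *m G^T)^T = G *m N *m G^T by rewrite !trmx_mul trmxK tN mulmxA.
move: tG; move: (G *m N *m G^T) => K tK [K01 [K02 K12]].
have K10 : K 1 0 = 0 by rewrite -tK mxE.
have K20 : K 2 0 = 0 by rewrite -tK mxE.
have K21 : K 2 1 = 0 by rewrite -tK mxE.
by apply: ord3P; apply: ord3P.
Qed.
End Spectral.

(** * The diagonal flow *)

Section DiagonalFlow.
Context {R : realType}.
Local Notation ev g t := (sfun_fun g (pt 0 0 t)).

Section Triple.
Variables f g h : sfun R.
Hypothesis Df : forall t, t < 0 -> ev (D DT f) t = 4 * (ev g t * ev h t).
Hypothesis Dg : forall t, t < 0 -> ev (D DT g) t = 4 * (ev f t * ev h t).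
Hypothesis Dh : forall t, t < 0 -> ev (D DT h) t = 4 * (ev f t * ev g t).
Hypothesis fg0 : forall t, t < 0 -> 0 < ev f t + ev g t.
Hypothesis fh0 : forall t, t < 0 -> 0 < ev f t + ev h t.
Hypothesis gh0 : forall t, t < 0 -> 0 < ev g t + ev h t.
Hypothesis bounded : forall T, T < 0 -> exists C, forall t, t <= T ->
  [/\ ev f t + ev g t <= C, ev f t + ev h t <= C & ev g t + ev h t <= C].
Hypothesis ord : ev h (-1) <= ev g (-1) <= ev f (-1).

Let m1 : -1 < 0 :> R. Proof. by rewrite oppr_lt0. Qed.

Lemma diff_sqr_const (F G H : sfun R) (t : R) :
  (forall t, t < 0 -> ev (D DT F) t = 4 * (ev G t * ev H t)) ->
  (forall t, t < 0 -> ev (D DT G) t = 4 * (ev F t * ev H t)) ->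
  t < 0 -> ev F t ^+ 2 - ev G t ^+ 2 = ev F (-1) ^+ 2 - ev G (-1) ^+ 2.
Proof.
move=> DF DG t0; have := @Dt_const_ev R (F ^+ 2 - G ^+ 2) t (-1) _ t0 m1.
rewrite !(saddE (F ^+ 2)) !soppE !sexpE ?pt2//; apply => s s0.
rewrite (D_add _ (F ^+ 2)) D_opp !D_exp (saddE (_ *+ 2)) soppE !snatE !smulE DF// DG//.
rewrite !sexpE ?pt2//; ring.
Qed.

(** The difference of two of the functions has the sign of its product with their positive sum, and
    that product is constant. *)
Lemma order_preserved t : t < 0 -> ev h t <= ev g t <= ev f t.
Proof.
move=> t0; have /andP[hg gf] := ord.
have E1 := diff_sqr_const Df Dg t0.
have Dg' s : s < 0 -> ev (D DT g) s = 4 * (ev h s * ev f s) by move=> s0; rewrite Dg// [_ * ev f s]mulrC.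
have Dh' s : s < 0 -> ev (D DT h) s = 4 * (ev g s * ev f s) by move=> s0; rewrite Dh// [_ * ev f s]mulrC.
have E2 := diff_sqr_const Dg' Dh' t0.
apply/andP; split; rewrite -subr_ge0.
  by rewrite -(pmulr_lge0 _ (gh0 t0)) -subr_sqr E2 subr_sqr mulr_ge0 ?subr_ge0// ltW// gh0.
by rewrite -(pmulr_lge0 _ (fg0 t0)) -subr_sqr E1 subr_sqr mulr_ge0 ?subr_ge0// ltW// fg0.
Qed.

(* If g > h, then g - h grows at a definite rate backward in time, since the
   product (g - h) (g + h) is constant, contradicting boundedness. *)
Lemma smallest_equal t : t < 0 -> ev h t = ev g t.
Proof.
have Dg' s : s < 0 -> ev (D DT g) s = 4 * (ev h s * ev f s) by move=> s0; rewrite Dg// [_ * ev f s]mulrC.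
have Dh' s : s < 0 -> ev (D DT h) s = 4 * (ev g s * ev f s) by move=> s0; rewrite Dh// [_ * ev f s]mulrC.
pose c := ev g (-1) ^+ 2 - ev h (-1) ^+ 2.
have cE s : s < 0 -> (ev g s - ev h s) * (ev g s + ev h s) = c.
  by move=> s0; rewrite -subr_sqr (diff_sqr_const Dg' Dh').
suff c0 : c = 0.
  move=> t0; have := cE _ t0; rewrite c0 => /eqP.
  by rewrite mulf_eq0 (gt_eqF (gh0 t0)) orbF subr_eq0 => /eqP ->.
apply/eqP; rewrite eq_le andbC -{1}(cE _ m1) mulr_ge0 ?(ltW (gh0 m1))//=; last first.
  by rewrite subr_ge0; case/andP: ord.
rewrite leNgt; apply/negP => c0.
have [C HC] := bounded m1.
have C0 : 0 < C by have [_ _ ?] := HC _ (lexx (-1)); apply: lt_le_trans (gh0 m1) _.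
have gap s : s <= -1 -> c / C <= ev g s - ev h s.
  move=> s1; have s0 := le_lt_trans s1 m1; have [_ _ le] := HC _ s1.
  rewrite ler_pdivrMr// -(cE _ s0) ler_wpM2l// subr_ge0.
  by case/andP: (order_preserved s0).
have cC : 0 < c / C by rewrite divr_gt0.
(* From [g - h >= q] and [g + h > 0] follows [f >= g >= q / 2], so [g - h], whose derivative is
   [- 4 f (g - h)], decreases at a rate of at least [k]. *)
move: (c / C) cC gap => q cC gap; pose k := 4 * (q / 2) * q.
have k0 : 0 < k by rewrite mulr_gt0// mulr_gt0// divr_gt0.
(* At this time [g - h] would be at least [C + 1], while [f + g <= C] and [f + h > 0] give
   [g - h < C]. *)
pose s := - (1 + (C + 1) / k).
have s1 : s <= -1 by rewrite lerN2 lerDl divr_ge0 ?addr_ge0// ltW.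
have s0 := le_lt_trans s1 m1.
have := @Dt_mono_on R (- g + h - scst k * coord DT) s (-1) s1 m1.
rewrite !(saddE (_ + h)) !(saddE (- g)) !soppE !smulE !scstE ?pt2// !coordE ?pt2//.
rewrite /coord_fun !pt2 => mono.
have {mono}/mono : forall t', s <= t' <= -1 -> 0 <= ev (D DT (- g + h - scst k * coord DT)) t'.
  move=> t' /andP[st' t'1]; have t'0 := le_lt_trans t'1 m1.
  rewrite (D_add _ (- g + h)) (D_add _ (- g)) !D_opp D_mul D_cst mul0r add0r D_coord mulr1.
  rewrite (saddE (_ + _)) (saddE (- _)) !soppE scstE ?pt2// Dg// Dh//.
  have gp := gap _ t'1; have /andP[_ gf] := order_preserved t'0.
  have gh := gh0 t'0.
  have fd : q / 2 <= ev f t' by lra.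
  have : k <= 4 * ev f t' * (ev g t' - ev h t').
    rewrite /k; apply: ler_pM => //; last by rewrite ler_pM2l.
      by rewrite mulr_ge0// divr_ge0// ltW.
    exact: ltW.
  lra.
have [_ Cfh _] := HC _ s1; have [Cfg _ _] := HC _ s1; have := fh0 (le_lt_trans s1 m1).
have /andP[hg _] := ord.
have sk : s * k = - k - (C + 1) by rewrite /s; field; exact: lt0r_neq0.
rewrite [k * s]mulrC sk; lra.
Qed.
End Triple.
End DiagonalFlow.

(** * Explicit solution of the axially symmetric flow *)

Section AxialFlow.
Context {R : realType}.
Local Notation ev g t := (sfun_fun g (pt 0 0 t)).

Lemma Dt_ratio_const (F G : sfun R) (t T : R) :
  (forall z : 'rV[R]_2 * R, z.2 < 0 -> 0 < G z) -> t < 0 -> T < 0 ->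
  (forall s, s < 0 -> ev (D DT F) s * ev G s = ev F s * ev (D DT G) s) ->
  ev F t * ev G T = ev F T * ev G t.
Proof.
move=> G0 t0 T0 H.
have half s s' : s <= s' -> s' < 0 -> ev F s * ev G s' = ev F s' * ev G s.
  move=> ss s0; have neg u : u <= s' -> u < 0 by move=> us; exact: le_lt_trans us s0.
  apply/le_anti; rewrite Dt_ratio_mono//=; last first.
    by move=> u /andP[_ /neg u0]; rewrite H// subrr.
  have := @Dt_ratio_mono R (- F) G s s' G0 ss s0; rewrite !soppE !mulNr lerN2; apply.
  by move=> u /andP[_ /neg u0]; rewrite D_opp !soppE !mulNr H// subrr.
by have [/half->//|/ltW/half->] := leP t T.
Qed.

Variables f l : sfun R.
Hypotheses (flat_f : flat f) (flat_l : flat l).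
Hypothesis Df : forall t, t < 0 -> ev (D DT f) t = 4 * ev l t ^+ 2.
Hypothesis Dl : forall t, t < 0 -> ev (D DT l) t = 4 * (ev f t * ev l t).
Hypothesis l0 : forall t, t < 0 -> 0 < ev l t.
Hypothesis lf : forall t, t < 0 -> ev l t <= ev f t.
Hypothesis lim : forall e : R, 0 < e -> exists2 d, 0 < d & forall t,
  - d < t < 0 -> `|2 * - t * (ev f t + ev l t) - 1| <= e.

Let a := f + l.
Let c := ev f (-1) ^+ 2 - ev l (-1) ^+ 2.

Let m1 : -1 < 0 :> R. Proof. by rewrite oppr_lt0. Qed.

Let aE z : a z = f z + l z. Proof. exact: saddE. Qed.

Let a0 (z : 'rV[R]_2 * R) : z.2 < 0 -> 0 < a z.
Proof.
rewrite [z]ptE; move: (z.1 0 0) (z.1 0 1) z.2 => x y t; rewrite pt2 aE => t0.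
rewrite !flat_pt//.
by rewrite addr_gt0// ?l0// (lt_le_trans (l0 t0))// lf.
Qed.

Let cE t : t < 0 -> ev f t ^+ 2 - ev l t ^+ 2 = c.
Proof.
move=> t0; have := @Dt_const_ev R (f ^+ 2 - l ^+ 2) t (-1) _ t0 m1.
rewrite !(saddE (f ^+ 2)) !soppE !sexpE ?pt2//; apply => s s0.
rewrite (D_add _ (f ^+ 2)) D_opp !D_exp (saddE (_ *+ 2)) soppE !snatE !smulE Df// Dl//.
rewrite !sexpE ?pt2//; ring.
Qed.

Let Da t : t < 0 -> ev (D DT a) t = 2 * (ev a t ^+ 2 - c).
Proof.
move=> t0; rewrite D_add saddE Df// Dl// aE -(cE t0); ring.
Qed.

Let a_lim : (2 * - t * ev a t) @[t --> (0 : R)^'-] --> (1 : R).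
Proof.
apply/cvgrPdist_le => e e0; have [d d0 H] := lim e0.
near=> t; rewrite distrC aE; apply: H; apply/andP; split; near: t.
  by apply: nbhs_left_gt; rewrite oppr_lt0.
exact: nbhs_left_lt.
Unshelve. all: by end_near. Qed.

Let t_lim : (2 * - t) @[t --> (0 : R)^'-] --> (0 : R).
Proof.
have : (2 * - t) @[t --> (0 : R)^'-] --> 2 * - (0 : R).
  apply: cvg_at_left_filter; apply: cvgM; first exact: cvg_cst.
  by apply: cvgN; exact: cvg_id.
by rewrite oppr0 mulr0.
Qed.

Lemma contracting_axial : c = 0 ->
  forall t, t < 0 -> ev f t + ev l t = (2 * - t)^-1 /\ ev f t - ev l t = 0.
Proof.
move=> cz.
have fl t : t < 0 -> ev f t = ev l t.
  move=> t0; have /eqP := cE t0; rewrite cz subr_sqr mulf_eq0 -aE (gt_eqF (a0 _)) ?pt2// orbF.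
  by rewrite subr_eq0 => /eqP.
pose k := (1 - 2 * ev a (-1)) / ev a (-1).
have am : ev a (-1) != 0 by rewrite gt_eqF// a0// pt2.
(* 1 / a + 2 t is constant. *)
have kE t : t < 0 -> 1 - 2 * - t * ev a t = k * ev a t.
  move=> t0; have := @Dt_ratio_const (1 + (coord DT * a) *+ 2) a t (-1) a0 t0 m1 _.
  rewrite !(saddE 1) !snatE !smulE !s1E ?pt2// !coordE ?pt2// /coord_fun !pt2 => H.
  apply: (mulIf am); rewrite [RHS](_ : _ = (1 - 2 * ev a (-1)) * ev a t);
    last by rewrite /k; field.
  have -> : 1 - 2 * ev a (-1) = 1 + (-1 * ev a (-1)) *+ 2 by ring.
  rewrite -H; last first.
    move=> s s0; rewrite (D_add _ 1) D_1 add0r D_nat D_mul D_coord mul1r !snatE (saddE a) smulE.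
    rewrite (saddE 1) !snatE s1E ?pt2// !smulE coordE ?pt2// /coord_fun pt2 Da// cz; ring.
  ring.
(* The relation [kE] is multiplied by [2 (- t)] and [t] tends to 0: the left side tends to 0 and the
   right side to [k]. *)
have k0 : k = 0.
  have h1 : (2 * - t * (1 - 2 * - t * ev a t)) @[t --> (0 : R)^'-] --> (0 * (1 - 1) : R).
    by apply: cvgM => //; apply: cvgB => //; exact: cvg_cst.
  have h2 : (k * (2 * - t * ev a t)) @[t --> (0 : R)^'-] --> (k * 1 : R).
    by apply: cvgM => //; exact: cvg_cst.
  have : (k * (2 * - t * ev a t)) @[t --> (0 : R)^'-] --> (0 * (1 - 1) : R).
    apply: cvg_trans h1; apply: near_eq_cvg; near=> t.
    by rewrite kE; [ring | near: t; exact: nbhs_left_lt].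
  move/(cvg_unique _ h2); rewrite mulr1 mul0r; exact.
move=> t t0; split; last by rewrite fl// subrr.
have /eqP := kE _ t0; rewrite k0 mul0r subr_eq0 -aE => /eqP E.
have n0 : 2 * - t != 0 by rewrite mulf_neq0// oppr_eq0 lt_eqF.
by apply: (mulfI n0); rewrite divff// -E.
Unshelve. all: by end_near. Qed.

(** The sum [a = f + l] solves the Riccati equation [a' = 2 (a^2 - mu^2)] with [mu^2 = f^2 - l^2].
    The integration constant is fixed by [2 (- t) a -> 1], and then [f - l = mu^2 / a]. *)
Lemma king_rosenau_axial : 0 < c -> exists2 mu : R, 0 < mu & forall t, t < 0 ->
  ev f t + ev l t = - mu * coth (2 * mu * t) /\ ev f t - ev l t = - mu * tanh (2 * mu * t).
Proof.
move=> c0; pose mu := Num.sqrt c; have mu0 : 0 < mu by rewrite sqrtr_gt0.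
have mu2 : mu ^+ 2 = c by rewrite sqr_sqrtr// ltW.
exists mu => //.
pose G := a + scst mu; pose F := (a - scst mu) * sexpR (scst (- (4 * mu)) * coord DT).
have FE t : t < 0 -> ev F t = (ev a t - mu) * expR (- (4 * mu) * t).
  move=> t0; rewrite smulE (saddE a) soppE scstE ?pt2// sexpRE ?pt2// smulE scstE ?pt2//.
  by rewrite coordE ?pt2// /coord_fun pt2.
have GE t : t < 0 -> ev G t = ev a t + mu by move=> t0; rewrite (saddE a) scstE ?pt2.
have G0 (z : 'rV[R]_2 * R) : z.2 < 0 -> 0 < G z.
  by move=> z0; rewrite (saddE a) scstE// addr_gt0// a0.
pose k := ev F (-1) / ev G (-1).
have Gm : ev G (-1) != 0 by rewrite gt_eqF// G0// pt2.
(* (a - mu) e^(-4 mu t) / (a + mu) is constant *)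
have kE t : t < 0 -> (ev a t - mu) * expR (- (4 * mu) * t) = k * (ev a t + mu).
  move=> t0; rewrite -FE// -GE//; apply: (mulIf Gm); rewrite [RHS]mulrAC divfK//.
  apply: Dt_ratio_const => // s s0.
  rewrite D_mul D_sexpR D_mul D_cst mul0r add0r D_coord mulr1.
  rewrite (D_add _ a) D_opp !D_cst oppr0 addr0 (saddE (_ * _)) !smulE.
  rewrite (D_add _ a) D_cst addr0 GE// (saddE a) soppE scstE ?pt2// scstE ?pt2//.
  rewrite Da// -mu2; ring.
have e_lim : expR (- (4 * mu) * t) @[t --> (0 : R)^'-] --> (1 : R).
  have : expR (- (4 * mu) * t) @[t --> (0 : R)^'-] --> expR (- (4 * mu) * 0).
    apply: cvg_at_left_filter.
    apply: (@continuous_cvg _ _ _ _ _ (fun t => - (4 * mu) * t) (@expR R)).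
      exact: continuous_expR.
    by apply: cvgM; [exact: cvg_cst | exact: cvg_id].
  by rewrite mulr0 expR0.
have k1 : k = 1.
  have smu : (2 * - t * mu) @[t --> (0 : R)^'-] --> (0 * mu : R).
    by apply: cvgM => //; exact: cvg_cst.
  have h1 : ((2 * - t * ev a t - 2 * - t * mu) * expR (- (4 * mu) * t))
      @[t --> (0 : R)^'-] --> ((1 - 0 * mu) * 1 : R).
    by apply: cvgM => //; apply: cvgB.
  have h2 : (k * (2 * - t * ev a t + 2 * - t * mu)) @[t --> (0 : R)^'-] --> (k * (1 + 0 * mu) : R).
    by apply: cvgM => //; [exact: cvg_cst | apply: cvgD].
  have : (k * (2 * - t * ev a t + 2 * - t * mu)) @[t --> (0 : R)^'-] --> ((1 - 0 * mu) * 1 : R).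
    apply: cvg_trans h1; apply: near_eq_cvg; near=> t.
    rewrite -!mulrBr -!mulrDr mulrCA -kE ?mulrA//; near: t; exact: nbhs_left_lt.
  move/(cvg_unique _ h2); rewrite !mul0r addr0 subr0 !mulr1; exact.
move=> t t0.
have at0 : 0 < ev a t by rewrite a0// pt2.
have : (ev a t - mu) * expR (- (2 * mu * t)) = (ev a t + mu) * expR (2 * mu * t).
  have := kE t t0; rewrite k1 mul1r => <-; rewrite -[RHS]mulrA -expRD; congr (_ * expR _); ring.
have : expR (2 * mu * t) < expR (- (2 * mu * t)).
  have : 2 * mu * t < 0 by rewrite pmulr_rlt0// mulr_gt0.
  by rewrite ltr_expR; lra.
have := cE t0; rewrite -mu2 subr_sqr mulrC -aE /coth /tanh.
have := expR_gt0 (2 * mu * t).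
move: (expR (2 * mu * t)) (expR (- (2 * mu * t))) => p q p0 ab pq E.
have aq : ev a t = - mu * ((p + q) / (p - q)).
  have pq0 : p - q != 0 by rewrite lt_eqF// subr_lt0.
  by apply: (mulIf pq0); rewrite -mulrA divfK//; move: E; lra.
split=> //.
apply: (mulfI (x := ev a t)); first exact: lt0r_neq0.
have q0 := lt_trans p0 pq.
have n1 : p - q != 0 by rewrite lt_eqF// subr_lt0.
have n2 : p + q != 0 by rewrite gt_eqF// addr_gt0.
by rewrite ab aq; field; rewrite n1 n2.
Unshelve. all: by end_near. Qed.
End AxialFlow.

(** * Symmetric matrices of order three *)

Section SymmetricMatrix.
Context {R : realType}.

Lemma mulmx3E (m n : nat) (M : 'M[R]_(m, 3)) (N : 'M[R]_(3, n)) i j :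
  (M *m N) i j = M i 0 * N 0 j + M i 1 * N 1 j + M i 2 * N 2 j.
Proof. by rewrite mxE sum3. Qed.

Implicit Types (a b c : R).

Lemma sum3_uniq (F : 'I_3 -> R) i j k : uniq [:: i; j; k] -> F 0 + F 1 + F 2 = F i + F j + F k.
Proof. by move: i j k; apply: ord3P; apply: ord3P; apply: ord3P => // _; ring. Qed.

Lemma vec3_form (M : 'M[R]_3) (x y z : R) : (vec3 x y z *m M *m (vec3 x y z)^T) 0 0 =
  (x * M 0 0 + y * M 1 0 + z * M 2 0) * x + (x * M 0 1 + y * M 1 1 + z * M 2 1) * y
  + (x * M 0 2 + y * M 1 2 + z * M 2 2) * z.
Proof. by rewrite !mulmx3E !mxE. Qed.

Definition symmx a11 a22 a33 a12 a13 a23 : 'M[R]_3 :=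
  rows3 (vec3 a11 a12 a13) (vec3 a12 a22 a23) (vec3 a13 a23 a33).

Lemma tr_symmx a11 a22 a33 a12 a13 a23 :
  (symmx a11 a22 a33 a12 a13 a23)^T = symmx a11 a22 a33 a12 a13 a23.
Proof. by apply/matrixP; apply: ord3P; apply: ord3P; rewrite !mxE. Qed.

Lemma symmxD a11 a22 a33 a12 a13 a23 b11 b22 b33 b12 b13 b23 :
  symmx a11 a22 a33 a12 a13 a23 + symmx b11 b22 b33 b12 b13 b23 =
  symmx (a11 + b11) (a22 + b22) (a33 + b33) (a12 + b12) (a13 + b13) (a23 + b23).
Proof. by apply/matrixP; apply: ord3P; apply: ord3P; rewrite !mxE. Qed.

Lemma symmxZ c a11 a22 a33 a12 a13 a23 : c *: symmx a11 a22 a33 a12 a13 a23 =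
  symmx (c * a11) (c * a22) (c * a33) (c * a12) (c * a13) (c * a23).
Proof. by apply/matrixP; apply: ord3P; apply: ord3P; rewrite !mxE. Qed.

Lemma scalar_symmx c : c%:M = symmx c c c 0 0 0.
Proof. by apply/matrixP; apply: ord3P; apply: ord3P; rewrite !mxE. Qed.

Lemma mxtrace_symmx a11 a22 a33 a12 a13 a23 :
  \tr (symmx a11 a22 a33 a12 a13 a23) = a11 + a22 + a33.
Proof. by rewrite /mxtrace sum3 !mxE. Qed.

Lemma symmx_sqr a11 a22 a33 a12 a13 a23 :
  symmx a11 a22 a33 a12 a13 a23 *m symmx a11 a22 a33 a12 a13 a23 =
  symmx (a11 ^+ 2 + a12 ^+ 2 + a13 ^+ 2) (a12 ^+ 2 + a22 ^+ 2 + a23 ^+ 2)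
    (a13 ^+ 2 + a23 ^+ 2 + a33 ^+ 2) (a11 * a12 + a12 * a22 + a13 * a23)
    (a11 * a13 + a12 * a23 + a13 * a33) (a12 * a13 + a22 * a23 + a23 * a33).
Proof.
rewrite -{2}[symmx _ _ _ _ _ _]tr_symmx.
apply/matrixP; apply: ord3P; apply: ord3P; rewrite mulmx_trE /dot3 !mxE /=; ring.
Qed.

Lemma qform_symmx a11 a22 a33 a12 a13 a23 (n : 'rV[R]_3) :
  (n *m symmx a11 a22 a33 a12 a13 a23 *m n^T) 0 0 =
  qform a11 a22 a33 a12 a13 a23 (n 0 0) (n 0 1) (n 0 2).
Proof. by rewrite !mxE !sum3 !mxE !sum3 !mxE /= /qform; ring. Qed.
(** The adjugate is written as a polynomial in the matrix and traces, a form that conjugation by an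
    orthogonal matrix visibly preserves. *)
Lemma adj_diagmx (M : 'M[R]_3) i j k : (forall p q, p != q -> M p q = 0) ->
  uniq [:: i; j; k] ->
  (M *m M - \tr M *: M + ((\tr M ^+ 2 - \tr (M *m M)) / 2)%:M) i i = M j j * M k k.
Proof.
move=> off.
have trE : \tr (M *m M) = M 0 0 ^+ 2 + M 1 1 ^+ 2 + M 2 2 ^+ 2.
  rewrite /mxtrace sum3 !mulmx3E (off 0 1)// (off 0 2)// (off 1 2)//.
  by rewrite (off 1 0)// (off 2 0)// (off 2 1)//; ring.
have -> : (M *m M - \tr M *: M + ((\tr M ^+ 2 - \tr (M *m M)) / 2)%:M) i i =
    M i i ^+ 2 - \tr M * M i i + (\tr M ^+ 2 - \tr (M *m M)) / 2.
  have : (M *m M) i i = M i i ^+ 2.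
    rewrite mxE (bigD1 i)//= big1 ?addr0 ?expr2// => r ri.
    by rewrite off ?mul0r// eq_sym.
  by move: (M *m M) => N <-; rewrite !mxE eqxx mulr1n.
rewrite trE /mxtrace sum3; move: i j k; clear.
by apply: ord3P; apply: ord3P; apply: ord3P => // _; field.
Qed.
End SymmetricMatrix.

(** * Classification of the quadratic pressures *)

Section QuadClassification.
Context {R : realType} (a11 a22 a33 a12 a13 a23 b1 b2 b3 : sfun R).
Implicit Types (x y z t : R).
Local Notation ev g t := (sfun_fun g (pt 0 0 t)).
Local Notation V := (quad_value a11 a22 a33 a12 a13 a23 b1 b2 b3).
Hypotheses (flat11 : flat a11) (flat22 : flat a22) (flat33 : flat a33)
  (flat12 : flat a12) (flat13 : flat a13) (flat23 : flat a23).
Hypothesis Da11 : D DT a11 = (a22 * a33 - a23 ^+ 2 - b1 ^+ 2) *+ 4.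
Hypothesis Da22 : D DT a22 = (a11 * a33 - a13 ^+ 2 - b2 ^+ 2) *+ 4.
Hypothesis Da33 : D DT a33 = (a11 * a22 - a12 ^+ 2 - b3 ^+ 2) *+ 4.
Hypothesis Da12 : D DT a12 = (a13 * a23 - a12 * a33 - b1 * b2) *+ 4.
Hypothesis Da13 : D DT a13 = (a12 * a23 - a13 * a22 - b1 * b3) *+ 4.
Hypothesis Da23 : D DT a23 = (a12 * a13 - a11 * a23 - b2 * b3) *+ 4.
Hypothesis Db1 : D DT b1 = (a11 * b1 + a12 * b2 + a13 * b3) *+ 4.
Hypothesis Db2 : D DT b2 = (a12 * b1 + a22 * b2 + a23 * b3) *+ 4.
Hypothesis Db3 : D DT b3 = (a13 * b1 + a23 * b2 + a33 * b3) *+ 4.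

Hypothesis V_gt0 : forall t x y z, t < 0 -> x ^+ 2 + y ^+ 2 + z ^+ 2 = 1 ->
  0 < V t x y z.
Hypothesis V_bounded : forall T, T < 0 -> exists C, forall t x y z, t <= T ->
  x ^+ 2 + y ^+ 2 + z ^+ 2 = 1 -> V t x y z <= C.
Hypothesis V_limit : forall e : R, 0 < e -> exists2 d, 0 < d & forall t x y z,
  - d < t < 0 -> x ^+ 2 + y ^+ 2 + z ^+ 2 = 1 ->
  `|2 * - t * V t x y z - 1| <= e.

Let bz t : t < 0 -> [/\ ev b1 t = 0, ev b2 t = 0 & ev b3 t = 0].
Proof. exact: (b_eq0 Da11 Da22 Da33 Da12 Da13 Da23 Db1 Db2 Db3 V_gt0 V_bounded V_limit). Qed.

Definition coef (i j : 'I_3) : sfun R :=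
  nth 0 (nth [::] [:: [:: a11; a12; a13]; [:: a12; a22; a23]; [:: a13; a23; a33]] i) j.

Definition coefmx t : 'M[R]_3 :=
  symmx (ev a11 t) (ev a22 t) (ev a33 t) (ev a12 t) (ev a13 t) (ev a23 t).

Let A := coefmx.

Let coefE i j t : ev (coef i j) t = A t i j.
Proof. by move: i j; apply: ord3P; apply: ord3P; rewrite !mxE. Qed.

Let V_A t (n : 'rV[R]_3) : t < 0 ->
  V t (n 0 0) (n 0 1) (n 0 2) = \tr (A t) - (n *m A t *m n^T) 0 0.
Proof.
move=> t0; have [z1 z2 z3] := bz t0; rewrite /quad_value z1 z2 z3.
rewrite mxtrace_symmx qform_symmx; ring.
Qed.

Let m1 : -1 < 0 :> R. Proof. by rewrite oppr_lt0. Qed.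

Let A_sqr t : t < 0 -> exists k, A t *m A t = A (-1) *m A (-1) + k%:M.
Proof.
move=> t0; have [[D12 D13 D23] [D11 D22 D33]] := Dt_sq Da11 Da22 Da33 Da12 Da13 Da23 Db1 Db2 Db3.
have c12 := Dt_const D12 t0 m1; have c13 := Dt_const D13 t0 m1; have c23 := Dt_const D23 t0 m1.
have c11 := Dt_const D11 t0 m1; have c22 := Dt_const D22 t0 m1; have c33 := Dt_const D33 t0 m1.
pose tq s := ev (trsq a11 a22 a33 a12 a13 a23 b1 b2 b3) s.
exists ((tq t - tq (-1)) / 3).
move: c12 c13 c23 c11 c22 c33.
have [[-> -> ->] [-> -> ->]] := sqE a11 a22 a33 a12 a13 a23 b1 b2 b3 t0.
have [[-> -> ->] [-> -> ->]] := sqE a11 a22 a33 a12 a13 a23 b1 b2 b3 m1.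
have [z1 z2 z3] := bz t0; have [w1 w2 w3] := bz m1.
rewrite z1 z2 z3 w1 w2 w3 -/(tq t) -/(tq (-1)) !symmx_sqr scalar_symmx symmxD.
move: (tq t) (tq (-1)) => p q c12 c13 c23 c11 c22 c33.
by congr symmx; lra.
Qed.

Let B t : 'M[R]_3 := A t *m A t - \tr (A t) *: A t
  + ((\tr (A t) ^+ 2 - \tr (A t *m A t)) / 2)%:M.

(* By Cayley-Hamilton, [B t] is the adjugate of [A t]. *)
Let D_coef i j t : t < 0 -> ev (D DT (coef i j)) t = 4 * B t i j.
Proof.
move=> t0; have [z1 z2 z3] := bz t0.
rewrite /B scalar_symmx symmx_sqr !mxtrace_symmx -scaleNr symmxZ !symmxD.
move: i j; apply: ord3P; apply: ord3P.
all: rewrite !mxE /coef /= ?Da11 ?Da22 ?Da33 ?Da12 ?Da13 ?Da23.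
all: by rewrite snatE (saddE (_ - _)) (saddE (_ * _)) !soppE ?smulE ?sexpE ?pt2// ?z1 ?z2 ?z3; field.
Qed.

Lemma dot3_sqr (v : 'rV[R]_3) : dot3 v v = v 0 0 ^+ 2 + v 0 1 ^+ 2 + v 0 2 ^+ 2.
Proof. by rewrite /dot3 !expr2. Qed.

Let flat_coef i j : flat (coef i j).
Proof. by move: i j; apply: ord3P; apply: ord3P. Qed.

Section Diagonalized.
Variable Q : 'M[R]_3.
Hypothesis QQ : Q *m Q^T = 1%:M.
Hypothesis diagQ : forall i j, i != j -> (Q *m (A (-1) *m A (-1)) *m Q^T) i j = 0.

Let QQ' : Q^T *m Q = 1%:M. Proof. exact: mulmx1C. Qed.

Let C t := Q *m A t *m Q^T.

Let trQ M : \tr (Q *m M *m Q^T) = \tr M.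
Proof. by rewrite mxtrace_mulC mulmxA QQ' mul1mx. Qed.

Let V_C t (w : 'rV[R]_3) : t < 0 -> let n := w *m Q in
  V t (n 0 0) (n 0 1) (n 0 2) = \tr (C t) - (w *m C t *m w^T) 0 0.
Proof.
move=> t0 n; rewrite V_A// /C trQ; congr (_ - _).
by rewrite /n trmx_mul !mulmxA.
Qed.

Let C_sym t : (C t)^T = C t.
Proof. by rewrite /C !trmx_mul trmxK /A tr_symmx mulmxA. Qed.

Let C_sqr t : C t *m C t = Q *m (A t *m A t) *m Q^T.
Proof. by rewrite /C !mulmxA -(mulmxA _ Q^T) QQ' mulmx1. Qed.

(** A diagonal square still allows off-diagonal entries when two eigenvalues are opposite;
    positivity of the pressure excludes this, since it makes the sum of any two eigenvalues
    positive. *)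
Let C_diag t : t < 0 -> [/\ C t 0 1 = 0, C t 0 2 = 0 & C t 1 2 = 0].
Proof.
move=> t0; have off i j : i != j -> (C t *m C t) i j = 0.
  move=> ij; rewrite C_sqr; have [k ->] := A_sqr t0.
  rewrite mulmxDr mulmxDl mxE diagQ// add0r mul_mx_scalar -scalemxAl QQ.
  by rewrite !mxE (negbTE ij) mulr0.
have C10 : C t 1 0 = C t 0 1 by rewrite -{1}C_sym mxE.
have C20 : C t 2 0 = C t 0 2 by rewrite -{1}C_sym mxE.
have C21 : C t 2 1 = C t 1 2 by rewrite -{1}C_sym mxE.
apply: (@square_diag_diag R (C t 0 0) (C t 1 1) (C t 2 2)).
- by have := off 0 1 isT; rewrite mulmx3E C21; lra.
- by have := off 0 2 isT; rewrite mulmx3E; lra.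
- by have := off 1 2 isT; rewrite mulmx3E C10; lra.
move=> x y z u; have := @V_C t (vec3 x y z) t0.
rewrite /mxtrace sum3 (vec3_form (C t)) C10 C20 C21.
set n := vec3 x y z *m Q => E.
have <- : V t (n 0 0) (n 0 1) (n 0 2) = C t 0 0 + C t 1 1 + C t 2 2 -
  qform (C t 0 0) (C t 1 1) (C t 2 2) (C t 0 1) (C t 0 2) (C t 1 2) x y z.
  by rewrite E /qform; ring.
apply: V_gt0 => //; rewrite -dot3_sqr (dot3_orthogonal _ _ QQ) dot3_sqr !mxE; exact: u.
Qed.

Let C_off t i j : t < 0 -> i != j -> C t i j = 0.
Proof.
move=> t0; have [h01 h02 h12] := C_diag t0.
by move: i j; apply: ord3P; apply: ord3P => // _; rewrite // -C_sym mxE.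
Qed.

(** The diagonal entries of [C t] as smooth functions of time: the frame [Q] does not depend on
    time, so only the coefficients get differentiated. *)
Let d k : sfun R := \sum_i \sum_j scst (Q k i * Q k j) * coef i j.

Let conjE (M : 'M[R]_3) k : (Q *m M *m Q^T) k k = \sum_i \sum_j Q k i * Q k j * M i j.
Proof.
rewrite exchange_big mxE; apply: eq_bigr => j _; rewrite !mxE mulr_suml.
by apply: eq_bigr => i _; rewrite mulrAC.
Qed.

Let ev_sum (F : 'I_3 -> sfun R) t : ev (\sum_i F i) t = \sum_i ev (F i) t.
Proof. by rewrite !sum3 (saddE (F 0 + F 1)) saddE. Qed.

Let dE k t : ev (d k) t = C t k k.
Proof.
rewrite /C conjE /d ev_sum; apply: eq_bigr => i _; rewrite ev_sum.
by apply: eq_bigr => j _; rewrite scalarE coefE.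
Qed.

Let D_sum i (F : 'I_3 -> sfun R) : D i (\sum_k F k) = \sum_k D i (F k).
Proof. by rewrite !sum3 !(D_add _ (F 0 + F 1)) !D_add. Qed.

Let flat_d k : flat (d k).
Proof.
have e i j : flat (scst (Q k i * Q k j) * coef i j) := flatM (flat_cst _) (flat_coef i j).
by split; rewrite D_sum big1// => i _; rewrite D_sum big1// => j _; have [] := e i j.
Qed.

Let D_d i j k t : t < 0 -> uniq [:: i; j; k] ->
  ev (D DT (d i)) t = 4 * (ev (d j) t * ev (d k) t).
Proof.
move=> t0 ijk; have -> : ev (D DT (d i)) t = 4 * (Q *m B t *m Q^T) i i.
  rewrite conjE D_sum ev_sum mulr_sumr; apply: eq_bigr => p _.
  rewrite D_sum ev_sum mulr_sumr; apply: eq_bigr => q _.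
  by rewrite D_mul D_cst mul0r add0r scalarE D_coef// mulrCA.
have trC : \tr (A t) = \tr (C t) by rewrite /C trQ.
have trCC : \tr (A t *m A t) = \tr (C t *m C t).
  by rewrite C_sqr trQ.
have -> : Q *m B t *m Q^T = C t *m C t - \tr (C t) *: C t
    + ((\tr (C t) ^+ 2 - \tr (C t *m C t)) / 2)%:M.
  rewrite /B -trC -trCC mulmxDr mulmxDl mulmxBr mulmxBl C_sqr.
  by rewrite mul_mx_scalar -scalemxAl QQ scalemx1 -scalemxAr -scalemxAl.
rewrite !dE.
by rewrite (adj_diagmx _ ijk)// => p q pq; exact: C_off.
Qed.

Let V_axis i j k t : t < 0 -> uniq [:: i; j; k] -> let n := row k Q in
  V t (n 0 0) (n 0 1) (n 0 2) = ev (d i) t + ev (d j) t.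
Proof.
move=> t0 ijk n; have := @V_C t (delta_mx 0 k) t0; rewrite -rowE -/n => ->.
have -> : ((delta_mx 0 k : 'rV_3) *m C t *m (delta_mx 0 k : 'rV_3)^T) 0 0 = C t k k.
  move: (C t) => M; rewrite !mulmx3E !mxE; move: {ijk n} k.
  by apply: ord3P; rewrite /=; ring.
rewrite /mxtrace sum3 !dE; move: i j k ijk {n}; move: (C t) => M.
by apply: ord3P; apply: ord3P; apply: ord3P => // _; ring.
Qed.

Let unit_axis k : let n := row k Q in n 0 0 ^+ 2 + n 0 1 ^+ 2 + n 0 2 ^+ 2 = 1.
Proof. by move=> n; rewrite -dot3_sqr -mulmx_trE QQ mxE eqxx. Qed.

Let pair_gt0 i j k t : t < 0 -> uniq [:: i; j; k] -> 0 < ev (d i) t + ev (d j) t.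
Proof. by move=> t0 ijk; rewrite -(V_axis t0 ijk) V_gt0// unit_axis. Qed.

Let sorted_axes : exists i j k, uniq [:: i; j; k] /\
  ev (d k) (-1) <= ev (d j) (-1) <= ev (d i) (-1).
Proof.
have [h01|/ltW h10] := leP (ev (d 0) (-1)) (ev (d 1) (-1));
have [h02|/ltW h20] := leP (ev (d 0) (-1)) (ev (d 2) (-1));
have [h12|/ltW h21] := leP (ev (d 1) (-1)) (ev (d 2) (-1)).
- by exists 2, 1, 0; rewrite h01 h12.
- by exists 1, 2, 0; rewrite h02 h21.
- by exists 2, 1, 0; rewrite h01 h12.
- by exists 1, 0, 2; rewrite h20 h01.
- by exists 2, 0, 1; rewrite h10 h02.
- by exists 2, 0, 1; rewrite h10 h02.
- by exists 0, 2, 1; rewrite h12 h20.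
- by exists 0, 1, 2; rewrite h21 h10.
Qed.

Lemma diagonalized_classification : exists2 q : 'rV[R]_3, dot3 q q = 1 &
  (forall t n, t < 0 -> dot3 n n = 1 -> V t (n 0 0) (n 0 1) (n 0 2) = (2 * - t)^-1) \/
  exists2 mu : R, 0 < mu & forall t n, t < 0 -> dot3 n n = 1 ->
    V t (n 0 0) (n 0 1) (n 0 2) =
    - mu * coth (2 * mu * t) - - mu * tanh (2 * mu * t) * dot3 n q ^+ 2.
Proof.
have [i [j [k [ijk ord]]]] := sorted_axes.
have ikj : uniq [:: i; k; j] by move: ijk; rewrite /= !inE !negb_or [k == j]eq_sym; case: (i == j); case: (i == k); case: (j == k).
have jik : uniq [:: j; i; k] by move: ijk; rewrite /= !inE !negb_or [j == i]eq_sym; case: (i == j); case: (i == k); case: (j == k).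
have kij : uniq [:: k; i; j] by move: ijk; rewrite /= !inE !negb_or ![k == _]eq_sym; case: (i == j); case: (i == k); case: (j == k).
have jki : uniq [:: j; k; i] by move: ijk; rewrite /= !inE !negb_or ![_ == i]eq_sym; case: (i == j); case: (i == k); case: (j == k).
have Di t : t < 0 -> ev (D DT (d i)) t = 4 * (ev (d j) t * ev (d k) t) by move=> t0; exact: D_d.
have Dj t : t < 0 -> ev (D DT (d j)) t = 4 * (ev (d i) t * ev (d k) t) by move=> t0; exact: D_d.
have Dk t : t < 0 -> ev (D DT (d k)) t = 4 * (ev (d i) t * ev (d j) t) by move=> t0; exact: D_d.
have ij0 t : t < 0 -> 0 < ev (d i) t + ev (d j) t by move=> t0; exact: pair_gt0 ijk.
have ik0 t : t < 0 -> 0 < ev (d i) t + ev (d k) t by move=> t0; exact: pair_gt0 ikj.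
have jk0 t : t < 0 -> 0 < ev (d j) t + ev (d k) t by move=> t0; exact: pair_gt0 jki.
have bnd T : T < 0 -> exists M, forall t, t <= T -> [/\ ev (d i) t + ev (d j) t <= M,
    ev (d i) t + ev (d k) t <= M & ev (d j) t + ev (d k) t <= M].
  move=> T0; have [M HM] := V_bounded T0; exists M => t tT; have t0 := le_lt_trans tT T0.
  split; rewrite -?(V_axis t0 ijk) -?(V_axis t0 ikj) -?(V_axis t0 jki); exact: HM (unit_axis _).
have kj t : t < 0 -> ev (d k) t = ev (d j) t.
  by move=> t0; exact: (smallest_equal Di Dj Dk ij0 ik0 jk0 bnd ord).
have ji t : t < 0 -> ev (d j) t <= ev (d i) t.
  by move=> t0; have /andP[] := order_preserved Di Dj Dk ij0 jk0 ord t0.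
have Di' t : t < 0 -> ev (D DT (d i)) t = 4 * ev (d j) t ^+ 2.
  by move=> t0; rewrite Di// kj// expr2.
have Dj' t : t < 0 -> ev (D DT (d j)) t = 4 * (ev (d i) t * ev (d j) t).
  by move=> t0; rewrite Dj// kj.
have j0 t : t < 0 -> 0 < ev (d j) t by move=> t0; have := jk0 t t0; rewrite kj//; lra.
have lim e : 0 < e -> exists2 r, 0 < r & forall t, - r < t < 0 ->
    `|2 * - t * (ev (d i) t + ev (d j) t) - 1| <= e.
  move=> e0; have [r r0 H] := V_limit e0; exists r => // t tr.
  by have /andP[_ t0] := tr; rewrite -(V_axis t0 ijk); exact: H (unit_axis _).
exists (row i Q); first by rewrite dot3_sqr; exact: unit_axis.
(* With equal eigenvalues on the axes [j] and [k], the form at a unit vector is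
   [d_i n_i^2 + d_j (1 - n_i^2)], where [n_i] is the component along the axis [i]. *)
have VE t n : t < 0 -> dot3 n n = 1 -> V t (n 0 0) (n 0 1) (n 0 2) =
    (ev (d i) t + ev (d j) t) - (ev (d i) t - ev (d j) t) * dot3 n (row i Q) ^+ 2.
  move=> t0 n1; pose w := n *m Q^T; have nE : n = w *m Q by rewrite /w -mulmxA QQ' mulmx1.
  have w1 : w 0 0 ^+ 2 + w 0 1 ^+ 2 + w 0 2 ^+ 2 = 1 by rewrite -dot3_sqr -(dot3_orthogonal _ _ QQ) -nE.
  have -> : dot3 n (row i Q) = w 0 i by rewrite dot3_row !mxE; apply: eq_bigr => p _; rewrite !mxE.
  rewrite nE V_C//.
  move: (dE i t) (dE j t) (dE k t) (@C_off t 0 1 t0 isT) (@C_off t 0 2 t0 isT) (@C_off t 1 2 t0 isT).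
  move: (@C_off t 1 0 t0 isT) (@C_off t 2 0 t0 isT) (@C_off t 2 1 t0 isT) (kj t t0).
  move: (C t) (ev (d i) t) (ev (d j) t) (ev (d k) t).
  move=> M di dj dk h10 h20 h21 kj' ei ej ek h01 h02 h12; rewrite {}kj' in ek.
  rewrite mulmx3E !(mulmx3E w) /mxtrace sum3 ![w^T _ _]mxE h01 h02 h12 h10 h20 h21.
  rewrite !(mulr0, addr0, add0r).
  have -> : M 0 0 + M 1 1 + M 2 2 = di + dj + dj.
    by rewrite (sum3_uniq (fun p => M p p) ijk) -ei -ej -ek.
  have -> : w 0 0 * M 0 0 * w 0 0 + w 0 1 * M 1 1 * w 0 1 + w 0 2 * M 2 2 * w 0 2 =
      di * w 0 i ^+ 2 + dj * (1 - w 0 i ^+ 2).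
    have -> : dj * (1 - w 0 i ^+ 2) = dj * w 0 j ^+ 2 + dj * w 0 k ^+ 2.
      by rewrite -w1 (sum3_uniq (fun p => w 0 p ^+ 2) ijk); ring.
    rewrite (sum3_uniq (fun p => w 0 p * M p p * w 0 p) ijk) -ei -ej -ek; ring.
  ring.
have [c0|c0] := eqVneq (ev (d i) (-1) ^+ 2 - ev (d j) (-1) ^+ 2) 0.
  left=> t n t0 n1; rewrite VE//.
  have [-> ->] := contracting_axial (flat_d i) (flat_d j) Di' Dj' j0 ji lim c0 t0.
  by rewrite mul0r subr0.
right; have [|mu mu0 H] := king_rosenau_axial (flat_d i) (flat_d j) Di' Dj' j0 ji lim _.
  rewrite lt_neqAle eq_sym c0 subr_sqr mulr_ge0// ?subr_ge0 ?ji// ltW// ij0//.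
exists mu => // t n t0 n1; rewrite VE//; have [-> ->] := H t t0.
by [].
Qed.
End Diagonalized.

Lemma quad_classification : exists2 q : 'rV[R]_3, dot3 q q = 1 &
  (forall t n, t < 0 -> dot3 n n = 1 -> V t (n 0 0) (n 0 1) (n 0 2) = (2 * - t)^-1) \/
  exists2 mu : R, 0 < mu & forall t n, t < 0 -> dot3 n n = 1 ->
    V t (n 0 0) (n 0 1) (n 0 2) =
    - mu * coth (2 * mu * t) - - mu * tanh (2 * mu * t) * dot3 n q ^+ 2.
Proof.
have [|Q [QQ dQ]] := @spectral3 R (A (-1) *m A (-1)); first by rewrite trmx_mul /A tr_symmx.
exact: diagonalized_classification QQ dQ.
Qed.
End QuadClassification.

(** * Ricci flow in stereographic coordinates *)

Section Slices.
Context {R : realType}.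
Implicit Types (F G : sfun R) (x : 'rV[R]_2) (t : R).

Definition axis (i : 'I_2) : dir := if i == 0 then DX else DY.

Lemma axis_dvec i : @dvec R (axis i) = (delta_mx 0 i, 0).
Proof. by case: (ord2P i) => ->. Qed.

Lemma pderiv_slice i F x t : t < 0 -> pderiv i (fun y => F (y, t)) x = D (axis i) F (x, t).
Proof.
move=> t0; rewrite DE//= axis_dvec /pderiv /derive; congr (lim _).
have -> // : (fun h : R => h^-1 *: (((fun y => F (y, t)) \o shift x) (h *: delta_mx 0 i) - F (x, t)))
  = (fun h : R => h^-1 *: ((F \o shift (x, t)) (h *: (delta_mx 0 i, 0)) - F (x, t))).
by apply/funext => h /=; congr (_ *: (F _ - _)); rewrite /= -[RHS]/(_, h *: 0 + t) scaler0 add0r.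
Qed.

Definition stereo_sfun (b : bool) (k : 'I_3) : sfun R :=
  nth 0 [:: coord DX * iden *+ 2; coord DY * iden *+ 2;
    (-1) ^+ b * ((coord DX ^+ 2 + coord DY ^+ 2 - 1) * iden)] k.

Lemma stereo_sfunE b k x t : t < 0 -> stereo b x 0 k = stereo_sfun b k (x, t).
Proof.
move=> t0; have d0 := den_neq0 (x 0 0) (x 0 1).
have E : (x, t) = pt (x 0 0) (x 0 1) t by rewrite [LHS]ptE.
have s1 : ((-1) ^+ b : sfun R) (x, t) = (-1) ^+ b by rewrite sexpE// soppE s1E.
rewrite /stereo !mxE addrA; move: k; apply: ord3P; rewrite /stereo_sfun /=.
- by rewrite snatE smulE E iden_pt// coord_pt//; field.
- by rewrite snatE smulE E iden_pt// coord_pt//; field.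
rewrite smulE s1 smulE (saddE (_ + _)) soppE s1E// (saddE (_ ^+ 2)) !sexpE// E iden_pt// !coord_pt//.
by field.
Qed.

Lemma pderiv_stereo b k i x t : t < 0 ->
  pderiv i (fun y => stereo b y 0 k) x = D (axis i) (stereo_sfun b k) (x, t).
Proof.
move=> t0; rewrite -pderiv_slice//; congr (pderiv i _ x).
by apply/funext => y; exact: stereo_sfunE.
Qed.

Lemma sign_sqr (b : bool) : (-1) ^+ b * (-1) ^+ b = 1 :> sfun R.
Proof. by case: b; rewrite ?expr0 ?expr1 ?mulrNN mulr1. Qed.

Lemma D_sign i (b : bool) : D i ((-1) ^+ b) = 0 :> sfun R.
Proof. by case: b; rewrite ?expr0 ?expr1 ?D_opp D_1 ?oppr0. Qed.

Lemma induced_stereo b x :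
  induced_metric (stereo b) x = (4 / (1 + x 0 0 ^+ 2 + x 0 1 ^+ 2) ^+ 2)%:M.
Proof.
have t0 : -1 < 0 :> R by rewrite oppr_lt0.
have d0 := den_neq0 (x 0 0) (x 0 1).
have E : (x, -1) = pt (x 0 0) (x 0 1) (-1) by rewrite [LHS]ptE.
have DS i : [/\ D i (stereo_sfun b 0) = (D i (coord DX) * iden - coord DX * (D i sphere_den * iden ^+ 2)) *+ 2,
    D i (stereo_sfun b 1) = (D i (coord DY) * iden - coord DY * (D i sphere_den * iden ^+ 2)) *+ 2 &
    D i (stereo_sfun b 2) = (-1) ^+ b * (D i sphere_den * iden
       - (coord DX ^+ 2 + coord DY ^+ 2 - 1) * (D i sphere_den * iden ^+ 2))].
  rewrite /stereo_sfun /=; split; rewrite !(D_nat, D_mul, D_sign, D_iden) ?mulrN//.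
  rewrite mul0r add0r; congr (_ * (_ * iden + _)).
  rewrite /sphere_den !(D_nat, D_exp, D_opp, D_add, D_1); ring.
apply/matrixP => i j; rewrite !mxE sum3 !(pderiv_stereo _ _ _ _ t0).
have [-> -> ->] := DS (axis i); have [-> -> ->] := DS (axis j).
have Ds k : D (axis k) sphere_den = coord (axis k) *+ 2 :> sfun R.
  rewrite /sphere_den !(D_exp, D_add, D_1, D_coord) /axis.
  by case: (ord2P k) => -> /=; ring.
rewrite !Ds -!smulE -!saddE.
have -> : forall a c : sfun R, (-1) ^+ b * a * ((-1) ^+ b * c) = a * c.
  by move=> a c; rewrite mulrACA sign_sqr mul1r.
rewrite !D_coord; have past : (x, -1 : R).2 < 0 by [].
have Xz : coord DX (x, -1) = x 0 0 :> R by rewrite coordE.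
have Yz : coord DY (x, -1) = x 0 1 :> R by rewrite coordE.
have Iz : iden (x, -1) = (1 + x 0 0 ^+ 2 + x 0 1 ^+ 2)^-1 :> R by rewrite E iden_pt.
have O : (1 : sfun R) (x, -1) = 1 by rewrite s1E.
case: (ord2P i) => ->; case: (ord2P j) => ->; rewrite /= ?mul1r ?mul0r ?add0r ?sub0r.
all: rewrite !(saddE, soppE, smulE, snatE) ?sexpE// ?(saddE, soppE, smulE, snatE) ?sexpE//.
all: by rewrite ?Xz ?Yz ?Iz ?O ?mulr1n ?mulr0n; field.
Qed.
End Slices.

(** * Ricci tensor of a conformally flat metric *)

Section ConformalRicci.
Context {R : realType} (p : sfun R).
Implicit Types (x : 'rV[R]_2) (t : R).
Hypothesis p_gt0 : forall z : 'rV[R]_2 * R, z.2 < 0 -> 0 < p z.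

Local Notation L := (sln p).

Let p_neq0 (z : 'rV[R]_2 * R) : z.2 < 0 -> p z != 0.
Proof. by move=> z0; rewrite gt_eqF// p_gt0. Qed.

Definition conf_metric t x : 'M[R]_2 := (p (x, t))^-1%:M.

(** The metric is [exp (- L) |dx|^2], whence the factor [- 1 / 2]. *)
Definition conf_christoffel (k i j : 'I_2) : sfun R :=
  scst (- 2^-1) * (D (axis i) L *+ (j == k) + D (axis j) L *+ (i == k) - D (axis k) L *+ (i == j)).

Lemma D_sinv i : D i (sinv p) = - (D i L * sinv p).
Proof.
have pI := mul_sinv p_neq0.
have := congr1 (fun f => sinv p * D i f) pI; rewrite D_mul D_1 (D_sln _ p_gt0) mulr0.
have -> : sinv p * (p * D i L * sinv p + p * D i (sinv p)) =
    (p * sinv p) * (D i L * sinv p + D i (sinv p)) by ring.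
by rewrite pI mul1r addrC => /eqP; rewrite addr_eq0 => /eqP.
Qed.

Lemma christoffel_conf t k i j x : t < 0 ->
  christoffel (conf_metric t) k i j x = conf_christoffel k i j (x, t).
Proof.
move=> t0; have pz : p (x, t) != 0 by rewrite p_neq0.
have slice a b : (fun y => conf_metric t y a b) = (fun y => (sinv p *+ (a == b)) (y, t)).
  by apply/funext => y; rewrite !mxE snatE sinvE.
rewrite /christoffel {1}/conf_metric invmx_scalar invrK.
under eq_bigr do rewrite !slice !pderiv_slice// !D_nat !snatE !D_sinv !soppE !smulE sinvE// mxE.
rewrite (bigD1 k)//= big1 ?addr0 => [|l lk]; last by rewrite eq_sym (negbTE lk) mulr0n mul0r.
rewrite eqxx mulr1n /conf_christoffel scalarE (saddE (_ + _)) saddE soppE !snatE.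
by case: eqP; case: eqP; case: eqP => _ _ _; rewrite ?mulr0n ?mulr1n; field.
Qed.

(** In dimension two the Ricci tensor is half the scalar curvature times the metric; the factor [p]
    of the curvature cancels against the entry [1 / p]. *)
Lemma ricci_conf t x : t < 0 ->
  ricci (conf_metric t) 0 0 x = (D DX (D DX L) + D DY (D DY L)) (x, t) / 2.
Proof.
move=> t0; have slice k i j : christoffel (conf_metric t) k i j = fun y => conf_christoffel k i j (y, t).
  by apply/funext => y; exact: christoffel_conf.
rewrite /ricci !big_ord_recr !big_ord0 /= !add0r.
have e1 : ord_max = 1 :> 'I_2 by apply: val_inj.
have e0 : widen_ord (leqnSn 1) ord_max = 0 :> 'I_2 by apply: val_inj.
rewrite e1 e0 !slice !pderiv_slice// /conf_christoffel /axis /= !mulr0n !mulr1n.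
rewrite !(D_add, D_opp, D_mul, D_cst, D_0) !(mul0r, add0r, addr0, subr0, oppr0) !scalarE.
by rewrite !(saddE, soppE, s0E); field.
Qed.
End ConformalRicci.

(** * Chart pressures of a solution *)

Section AncientSolution.
Context {R : realType} (u : 'rV[R]_3 -> R -> R).
Implicit Types (x y z t : R).
Hypothesis smooth_u : smooth_conformal_factor u.
Hypothesis flow_u : ricci_flow u.

Lemma sphere_stereo b (x : 'rV[R]_2) : sphere (stereo b x).
Proof.
have d0 := den_neq0 (x 0 0) (x 0 1).
rewrite /sphere/= sum3 /stereo !mxE /= addrA.
have -> : ((1 + x 0 0 ^+ 2 + x 0 1 ^+ 2)^-1 * ((-1) ^+ b * (x 0 0 ^+ 2 + x 0 1 ^+ 2 - 1))) ^+ 2 =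
  ((1 + x 0 0 ^+ 2 + x 0 1 ^+ 2)^-1 * (x 0 0 ^+ 2 + x 0 1 ^+ 2 - 1)) ^+ 2.
  by case: b; rewrite ?expr1 ?mulN1r ?mulrN ?sqrrN ?expr0 ?mul1r.
by field.
Qed.

Definition vec2 x y : 'rV[R]_2 := \row_k (if k == 0 then x else y).

Lemma pt_vec2 x y t : pt x y t = (vec2 x y, t).
Proof. by rewrite [LHS]surjective_pairing pt2 pt1. Qed.

Definition chart_factor b : sfun R := Sfun (trunc_spec (smooth_on_Sm (smooth_u.2 b))).

Lemma chart_factorE b (z : 'rV[R]_2 * R) : z.2 < 0 -> chart_factor b z = u (stereo b z.1) z.2.
Proof. by move=> z0; rewrite /= /trunc z0. Qed.

Let U_gt0 b (z : 'rV[R]_2 * R) : z.2 < 0 -> 0 < chart_factor b z.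
Proof. by move=> z0; rewrite chart_factorE// smooth_u.1//; exact: sphere_stereo. Qed.

Let U_neq0 b (z : 'rV[R]_2 * R) : z.2 < 0 -> chart_factor b z != 0.
Proof. by move=> z0; rewrite gt_eqF// U_gt0. Qed.

(** The function [p] for which [u g_{S^2} = |dx|^2 / p], the round metric being [4 |dx|^2 / s^2]. *)
Definition chart_press b : sfun R :=
  scst 4^-1 * (sphere_den ^+ 2 * sinv (chart_factor b)).

Lemma chart_pressE b (x : 'rV[R]_2) t : t < 0 -> chart_press b (x, t) =
  (1 + x 0 0 ^+ 2 + x 0 1 ^+ 2) ^+ 2 / (4 * u (stereo b x) t).
Proof.
move=> t0; rewrite scalarE smulE sexpE// sphere_denE// sinvE//; last exact: U_neq0.
by rewrite chart_factorE// invfM mulrCA.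
Qed.

Lemma chart_press_pt b x y t : t < 0 ->
  chart_press b (pt x y t) = (1 + x ^+ 2 + y ^+ 2) ^+ 2 / (4 * u (stereo b (vec2 x y)) t).
Proof. by move=> t0; rewrite pt_vec2 chart_pressE// !mxE. Qed.

Lemma chart_press_gt0 b (z : 'rV[R]_2 * R) : z.2 < 0 -> 0 < chart_press b z.
Proof.
case: z => x t t0; rewrite chart_pressE// divr_gt0 ?exprn_gt0 ?den_gt0//.
rewrite mulr_gt0// smooth_u.1//; exact: sphere_stereo.
Qed.

Lemma press_chart b x y t : t < 0 ->
  press (chart_press b) (pt x y t) = pressure u (stereo b (vec2 x y)) t.
Proof.
move=> t0; rewrite press_pt// chart_press_pt//.
have := den_neq0 x y; have : u (stereo b (vec2 x y)) t != 0.
  by rewrite gt_eqF// smooth_u.1//; exact: sphere_stereo.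
by rewrite /pressure; move: (u _ _) => v v0 d0; field; rewrite v0 d0.
Qed.

Lemma conformal_chart : conformal_pair chart_press.
Proof.
move=> x y t t0 r0; rewrite !chart_press_pt//.
have -> : stereo true (vec2 x y) = stereo false (vec2 (x * inv2 x y) (y * inv2 x y)).
  have d0 := den_neq0 x y.
  have e : 1 + ((x * inv2 x y) ^+ 2 + (y * inv2 x y) ^+ 2) = (1 + x ^+ 2 + y ^+ 2) / (x ^+ 2 + y ^+ 2).
    by rewrite /inv2; field.
  by apply/rowP; apply: ord3P; rewrite /stereo !mxE /= e /inv2 ?expr1 ?expr0 addrA;
    field; rewrite d0 r0.
have -> : 1 + (x * inv2 x y) ^+ 2 + (y * inv2 x y) ^+ 2 = (1 + x ^+ 2 + y ^+ 2) / (x ^+ 2 + y ^+ 2).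
  by rewrite /inv2; field.
have := smooth_u.1 _ t (@sphere_stereo false (vec2 (x * inv2 x y) (y * inv2 x y))) t0.
by move=> /lt0r_neq0; move: (u _ _) => v v0; field; rewrite v0 r0.
Qed.

Let metricE b t (x : 'rV[R]_2) : t < 0 -> conformal_metric u b t x = conf_metric (chart_press b) t x.
Proof.
move=> t0; rewrite /conformal_metric induced_stereo /conf_metric chart_pressE// scale_scalar_mx.
by rewrite invf_div; congr (_%:M); rewrite mulrA [u _ _ * 4]mulrC.
Qed.

Lemma chart_flow b : D DT (chart_press b) =
  chart_press b * (D DX (D DX (chart_press b)) + D DY (D DY (chart_press b)))
  - D DX (chart_press b) ^+ 2 - D DY (chart_press b) ^+ 2.
Proof.
pose p := chart_press b; rewrite -/p; have p0 := @chart_press_gt0 b; rewrite -/p in p0.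
have pn0 (z : 'rV[R]_2 * R) : z.2 < 0 -> p z != 0 by move=> /p0/lt0r_neq0.
have E : sinv p * D DT (sln p) = D DX (D DX (sln p)) + D DY (D DY (sln p)).
  apply: sfun_eq => z z0; rewrite [z]ptE; move: z0; move: (z.1 0 0) (z.1 0 1) z.2 => x y t t0.
  have m := flow_u b (vec2 x y) 0 0 t0.
  have q := is_derive_DT (sinv p) x y t0.
  have ri : ricci (conformal_metric u b t) 0 0 (vec2 x y) =
      (D DX (D DX (sln p)) + D DY (D DY (sln p))) (pt x y t) / 2.
    have -> : conformal_metric u b t = conf_metric p t by apply/funext => w; exact: metricE.
    by rewrite ricci_conf// pt_vec2.
  rewrite {}ri in m.
  have : D DT (sinv p) (pt x y t) = - 2 * ((D DX (D DX (sln p)) + D DY (D DY (sln p))) (pt x y t) / 2).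
    apply: (derive_uniq_near q m).
    near=> s; have s0 : s < 0 by near: s; exact: lt_nbhsl.
    by rewrite metricE// /conf_metric !mxE eqxx mulr1n sinvE ?pt2// pt_vec2.
  rewrite D_sinv// soppE !smulE => h; rewrite mulrC; apply: oppr_inj; by rewrite {}h; field.
have Dp i : D i p = p * D i (sln p) by apply: D_sln.
have Dtp : D DT p = p ^+ 2 * (sinv p * D DT (sln p)).
  have -> : p ^+ 2 * (sinv p * D DT (sln p)) = (p * sinv p) * (p * D DT (sln p)) by ring.
  by rewrite (mul_sinv pn0) mul1r Dp.
clearbody p; rewrite {}Dtp E !(Dp, D_mul); ring.
Unshelve. all: by end_near. Qed.
End AncientSolution.

(** * Classification *)

Section SpherePoints.
Context {R : realType} (u : 'rV[R]_3 -> R -> R).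
Implicit Types (x y z t : R) (n : 'rV[R]_3).
Hypothesis smooth_u : smooth_conformal_factor u.
Hypothesis flow_u : ricci_flow u.
Hypothesis lim_u : limiting_sphere u.

Local Notation p := (chart_press smooth_u).
Let p_gt0 := chart_press_gt0 smooth_u.
Let flow := chart_flow smooth_u flow_u.
Let conf := conformal_chart smooth_u.
Local Notation ev g t := (sfun_fun g (pt 0 0 t)).

Lemma stereo_pole n : dot3 n n = 1 -> n 0 2 = 1 -> n = stereo true (vec2 0 0).
Proof.
rewrite dot3_sqr => n1 n2.
have : n 0 0 ^+ 2 + n 0 1 ^+ 2 + 0 ^+ 2 = 0 by move: n1; rewrite n2; lra.
move=> /sum3_sqr_eq0[n00 n01 _].
by apply/rowP; apply: ord3P; rewrite /stereo !mxE /= ?n00 ?n01 ?n2 ?mulr0//; field.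
Qed.

Lemma stereo_off_pole n : dot3 n n = 1 -> n 0 2 != 1 -> exists x y, n = stereo false (vec2 x y).
Proof.
rewrite dot3_sqr => n1 n2; have d0 : 1 - n 0 2 != 0 by rewrite subr_eq0 eq_sym.
exists (n 0 0 / (1 - n 0 2)), (n 0 1 / (1 - n 0 2)).
have e : 1 + ((n 0 0 / (1 - n 0 2)) ^+ 2 + (n 0 1 / (1 - n 0 2)) ^+ 2) = 2 / (1 - n 0 2).
  have n00 : n 0 0 ^+ 2 = 1 - n 0 1 ^+ 2 - n 0 2 ^+ 2 by rewrite -n1; ring.
  by rewrite expr_div_n n00; field.
have e' : (n 0 0 / (1 - n 0 2)) ^+ 2 + (n 0 1 / (1 - n 0 2)) ^+ 2 - 1 = 2 / (1 - n 0 2) - 2.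
  by rewrite -e; ring.
by apply/rowP; apply: ord3P; rewrite /stereo !mxE /= e ?e' ?expr0; field.
Qed.

Lemma stereo_surj n : dot3 n n = 1 -> exists b x y, n = stereo b (vec2 x y).
Proof.
move=> n1; have [n2|n2] := eqVneq (n 0 2) 1.
  by exists true, 0, 0; exact: stereo_pole.
by have [x [y ->]] := stereo_off_pole n1 n2; exists false, x, y.
Qed.

Lemma sphere_dot3 n : dot3 n n = 1 -> sphere n.
Proof. by rewrite /sphere/= sum3 dot3_sqr. Qed.

Lemma pressure_gt0 n t : t < 0 -> dot3 n n = 1 -> 0 < pressure u n t.
Proof. by move=> t0 /sphere_dot3 n1; rewrite invr_gt0 smooth_u.1. Qed.

Lemma pressure_bounded T : T < 0 -> exists C, forall t n, t <= T -> dot3 n n = 1 ->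
  pressure u n t <= C.
Proof.
move=> T0; have [M HM] := bounded_slab (compat_press conf) (lexx T) T0; exists M => t n tT.
move=> /stereo_surj[b [x [y ->]]]; have t0 := le_lt_trans tT T0.
rewrite -(press_chart smooth_u)//; apply: le_trans (press_mono p_gt0 flow conf b x y tT T0) _.
by apply: HM; rewrite lexx.
Qed.

Lemma pressure_limit (e : R) : 0 < e -> exists2 d, 0 < d & forall t n,
  - d < t < 0 -> dot3 n n = 1 -> `|2 * - t * pressure u n t - 1| <= e.
Proof.
(* The normalized factor [w] stays above 1/2, so that [|1 / w - 1| = |1 - w| / w] is at most
   [2 r <= e]. *)
move=> e0; pose r := Num.min (1 / 2) (e / 2).
have r0 : 0 < r by rewrite lt_min !divr_gt0.
have re : r <= e / 2 by rewrite ge_min lexx orbT.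
have r1 : r <= 1 / 2 by rewrite ge_min lexx.
pose near1 : set ('rV[R]_3 -> R) := [set h | forall n, sphere n -> `|1 - h n| < r].
have N : nbhs ((fun=> 1) : {uniform` @sphere R -> R}) near1.
  apply/uniform_nbhs; exists [set xy | ball xy.1 r xy.2]; split; first exact: (entourage_ball _ (PosNum r0)).
  by move=> h; apply.
have : \forall t \near (0 : R)^'-, near1 (fun n => u n t / (2 * - t)) by exact: lim_u N.
move=> /nbhs_ballP[d /= d0 H]; exists d => // t n /andP[dt t0] n1.
have := H t _ t0 n (sphere_dot3 n1).
rewrite /ball/= sub0r normrN ltr0_norm// => /(_ _)/wrap[]; first by lra.
have u0 := smooth_u.1 n t (sphere_dot3 n1) t0.
have s0 : 0 < 2 * - t by rewrite mulr_gt0// oppr_gt0.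
have -> : 2 * - t * pressure u n t = (u n t / (2 * - t))^-1 by rewrite invf_div.
have w0 : 0 < u n t / (2 * - t) by rewrite divr_gt0.
move: (u n t / _) w0 => w w0 lt.
have w2 : 1 / 2 <= w by have := ltW lt; rewrite ler_norml => /andP[_ h]; lra.
have -> : w^-1 - 1 = (1 - w) / w by field; exact: lt0r_neq0.
rewrite normrM normfV (gtr0_norm w0) ler_pdivrMr//.
have : e / 2 <= e * w by rewrite ler_wpM2l//; [exact: ltW | lra].
lra.
Qed.

(** The chart [false] yields the formula at all points but its pole of projection. There the value
    comes from the other chart, and it is matched with the same coefficients by comparing the two
    polynomials along [y = 0]. *)
Lemma pressure_quad : exists a11 a22 a33 a12 a13 a23 b1 b2 b3 : sfun R,
  [/\ flat a11, flat a22 & flat a33] /\ [/\ flat a12, flat a13 & flat a23] /\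
  [/\ flat b1, flat b2 & flat b3] /\
  p false *+ 4 = quad_press a11 a22 a33 a12 a13 a23 b1 b2 b3 /\
  forall t n, t < 0 -> dot3 n n = 1 ->
    pressure u n t = quad_value a11 a22 a33 a12 a13 a23 b1 b2 b3 t (n 0 0) (n 0 1) (n 0 2).
Proof.
have [c1 c2] := cubic_eq0 p_gt0 flow conf false.
have [d1 d2] := cubic_eq0 p_gt0 flow conf true.
have [a11 [a22 [a33 [a12 [a13 [a23 [b1 [b2 [b3 [fl1 [fl2 [fl3 E]]]]]]]]]]]] := quad_press_form c1 c2.
have [A11 [A22 [A33 [A12 [A13 [A23 [B1 [B2 [B3 [gl1 [gl2 [gl3 G]]]]]]]]]]]] := quad_press_form d1 d2.
exists a11, a22, a33, a12, a13, a23, b1, b2, b3; do 4!split=> //.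
move=> t n t0 n1.
have pf x y := quad_press_pt x y fl1 fl2 fl3 t0; rewrite -E /= in pf.
have pT x y := quad_press_pt x y gl1 gl2 gl3 t0; rewrite -G /= in pT.
have [n2|n2] := eqVneq (n 0 2) 1; last first.
  have [x [y ->]] := stereo_off_pole n1 n2; rewrite -(press_chart smooth_u)// press_pt//.
  have := pf x y; rewrite snatE -(mulr_natl (p false _)) => ->; have d0 := den_neq0 x y.
  rewrite /quad_value /qform /stereo !mxE /= addrA expr0; field; exact: d0.
rewrite (stereo_pole n1 n2) -(press_chart smooth_u)// press_pt//.
have := pT 0 0; rewrite snatE -(mulr_natl (p true _)) => ->; rewrite [1 + 0 ^+ 2 + 0 ^+ 2](_ : _ = 1); last by rewrite expr0n !addr0.
rewrite expr1n divr1.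
have [n0 [n0' n2']] : stereo true (vec2 0 0) 0 0 = 0 :> R /\ stereo true (vec2 0 0) 0 1 = 0 :> R
    /\ stereo true (vec2 0 0) 0 2 = 1 :> R.
  by split; [|split]; rewrite /stereo !mxE /= ?expr1; field.
rewrite n0 n0' n2' /quad_value /qform.
(* On the line [y = 0] the change of chart is [x |-> 1 / x] with conformal weight [x ^+ 4], which
   reverses the order of the coefficients of a quartic. *)
have rev x : x != 0 -> p true (pt x 0 t) *+ 4 = x ^+ 4 * (p false (pt x^-1 0 t) *+ 4).
  move=> x0; have := @conf x 0 t t0; rewrite expr0n addr0 => -> //; last by rewrite expf_neq0.
  have -> : x * inv2 x 0 = x^-1 by rewrite /inv2; field.
  by rewrite mul0r -exprM mulrnAr.
have {}rev x : x != 0 -> (ev A22 t + ev A33 t) * x ^+ 2 * 4 + (ev A11 t + ev A22 t) * (x ^+ 2 - 1) ^+ 2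
    - ev A13 t * x * (x ^+ 2 - 1) * 4 + ev B1 t * x * (x ^+ 2 + 1) * 4 + ev B3 t * (x ^+ 4 - 1) * 2 =
  (ev a22 t + ev a33 t) * x ^+ 2 * 4 + (ev a11 t + ev a22 t) * (1 - x ^+ 2) ^+ 2
    - ev a13 t * x * (1 - x ^+ 2) * 4 + ev b1 t * x * (x ^+ 2 + 1) * 4 + ev b3 t * (1 - x ^+ 4) * 2.
  move=> x0; have := rev x x0; rewrite -!snatE pT pf; move: (ev A11 t) (ev A22 t) (ev A33 t) (ev A13 t) (ev B1 t) (ev B3 t).
  move: (ev a11 t) (ev a22 t) (ev a33 t) (ev a13 t) (ev b1 t) (ev b3 t).
  move=> c1' c2' c3' c4' c5' c6' k1 k2 k3 k4 k5 k6 h.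
  apply: etrans (etrans h _); first by ring.
  by field.
have r1 := rev 1 (oner_neq0 _); have n1' : -1 != 0 :> R by rewrite oppr_eq0.
have two : 2 != 0 :> R by []. have ntwo : -2 != 0 :> R by rewrite oppr_eq0.
have three : 3 != 0 :> R by [].
(* Both sides have degree at most four in [x], so five values determine all coefficients, among them
   the constant one, which is the value at the pole. *)
move: r1 (rev _ n1') (rev _ two) (rev _ ntwo) (rev _ three).
move: (ev A11 t) (ev A22 t) (ev A33 t) (ev A13 t) (ev B1 t) (ev B3 t).
move: (ev a11 t) (ev a22 t) (ev a33 t) (ev a13 t) (ev b1 t) (ev b3 t).
clear c1 c2 d1 d2 E G pf pT fl1 fl2 fl3 gl1 gl2 gl3 rev => *; lra.
Qed.
End SpherePoints.

Lemma dot3_sphere_coord (R : realType) (psi theta : R) :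
  dot3 (sphere_coord psi theta) (sphere_coord psi theta) = 1.
Proof.
rewrite dot3_sqr !mxE /= !exprMn -mulrDr cos2Dsin2 mulr1; exact: cos2Dsin2.
Qed.

(** If the frame through [q] has determinant -1, its opposite has determinant 1, the order being
    odd, and the change of sign is invisible in the square. *)
Lemma special_frame3 (R : realType) (q : 'rV[R]_3) : dot3 q q = 1 ->
  exists Q : 'M[R]_3, [/\ Q *m Q^T = 1%:M, \det Q = 1 &
    forall v, dot3 (v *m Q) q ^+ 2 = v 0 2 ^+ 2].
Proof.
move=> /frame3[P [PP rP]].
have dq v : dot3 (v *m P) q = v 0 2.
  rewrite -rP rowE dot3_orthogonal// /dot3 !mxE /=; ring.
have := congr1 determinant PP; rewrite det_mulmx det_tr det1 -expr2 => /eqP.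
rewrite sqrf_eq1 => /orP[/eqP d1|/eqP d1].
  by exists P; split=> // v; rewrite dq.
exists (- P); split=> [| |v].
- by rewrite linearN mulNmx mulmxN opprK.
- by rewrite -scaleN1r detZ d1 -signr_odd expr1 mulrNN mulr1.
- by rewrite mulmxN; move: (dq v); rewrite /dot3 !mxE => <-; ring.
Qed.

Theorem theorem1p2 (R : realType) (u : 'rV[R]_3 -> R -> R) :
  ancient_compact_solution u -> contracting_sphere u \/ king_rosenau u.
Proof.
move=> [smooth_u flow_u _ lim_u].
have [a11 [a22 [a33 [a12 [a13 [a23 [b1 [b2 [b3 [fl1 [fl2 [fl3 [E HV]]]]]]]]]]]]] :=
  pressure_quad smooth_u flow_u.
have [[D1 D2 D3] [[D4 D5 D6] [D7 D8 D9]]] :=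
  quad_press_flow fl1 fl2 fl3 E (chart_flow smooth_u flow_u false).
have [f1 f2 f3] := fl1; have [f4 f5 f6] := fl2.
have V t x y z : t < 0 -> x ^+ 2 + y ^+ 2 + z ^+ 2 = 1 -> dot3 (vec3 x y z) (vec3 x y z) = 1 /\
    quad_value a11 a22 a33 a12 a13 a23 b1 b2 b3 t x y z = pressure u (vec3 x y z) t.
  move=> t0 n1; have n1' : dot3 (vec3 x y z) (vec3 x y z) = 1 by rewrite dot3_sqr !mxE.
  by split=> //; rewrite HV// !mxE.
have [| | |q q1 cl] := @quad_classification R a11 a22 a33 a12 a13 a23 b1 b2 b3 f1 f2 f3 f4 f5 f6
    D1 D2 D3 D4 D5 D6 D7 D8 D9.
- by move=> t x y z t0 /(V t _ _ _ t0)[n1 ->]; exact: pressure_gt0.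
- move=> T T0; have [C HC] := pressure_bounded smooth_u flow_u T0; exists C => t x y z tT.
  by move=> /(V t _ _ _ (le_lt_trans tT T0))[n1 ->]; exact: HC.
- move=> e e0; have [d d0 H] := pressure_limit smooth_u lim_u e0; exists d => // t x y z td.
  by have /andP[_ t0] := td; move=> /(V t _ _ _ t0)[n1 ->]; exact: H.
case: cl => [cl|[mu mu0 cl]].
  by left=> psi theta t t0; rewrite HV ?cl ?dot3_sphere_coord.
right; have [Q [QQ detQ dQ]] := special_frame3 q1.
exists mu, Q; split=> // psi theta t t0 a b.
have n1 : dot3 (sphere_coord psi theta *m Q) (sphere_coord psi theta *m Q) = 1.
  by rewrite dot3_orthogonal// dot3_sphere_coord.
by rewrite HV// cl// dQ mxE.
Qed.
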